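(* Let $\delta\in(0,1)$ be a parameter and $d\geq 2$ any fixed constant. There is an explicit depth-$d$ monotone $\mathrm{AC}^0$ formula $\Gamma_d$ that solves the $\delta$-coin problem, where $\Gamma_d$ has size $\exp(O(d(1/\delta)^{1/(d-1)}))$ and sample complexity $(1/\delta)^{2^{O(d)}}$. All constants implicit in the $O(\cdot)$ notation are absolute constants.
   Context: For $\alpha\in[0,1]$ and integer $N\geq 1$, $D_\alpha^N$ is the product distribution on $\{0,1\}^N$ in which each bit is independently $1$ with probability $\alpha$. Let $\mu_0^N=D^N_{(1-\delta)/2}$ and $\mu_1^N=D^N_{(1+\delta)/2}$. A function $g:\{0,1\}^N\to\{0,1\}$ solves the $\delta$-coin problem (with error $0.1$) if $\Pr_{x\sim\mu_0^N}[g(x)=1]\leq 0.1$ and $\Pr_{x\sim\mu_1^N}[g(x)=1]\geq 0.9$; its sample complexity is $N$. A monotone $\mathrm{AC}^0$ formula of depth $d$ is a depth-$d$ Boolean formula with unbounded fan-in AND and OR gates only; its size is its total number of gates including input gates. Explicit means there is a deterministic polynomial-time algorithm which, given the parameter (in binary) and descriptions of two gates of the formula, decides whether there is a wire between them. *)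

(* Defs.v *)
From mathcomp Require Import all_boot all_order all_algebra.
From mathcomp Require Import reals sequences exp.
Set Implicit Arguments.
Unset Strict Implicit.
Unset Printing Implicit Defensive.
Import Order.TTheory GRing.Theory Num.Theory.

Inductive conn := And | Or.

(* Taking the first subformula apart from the others excludes gates of fan-in
   0, that is, the constants. *)
Inductive formula (N : nat) :=
| Input of 'I_N
| Gate of conn & formula N & seq (formula N).

Arguments Input {N}.
Arguments Gate {N}.

Fixpoint eval N (x : {ffun 'I_N -> bool}) (F : formula N) : bool :=
  match F with
  | Input i => x i
  | Gate And f fs => eval x f && all (eval x) fs
  | Gate Or f fs => eval x f || has (eval x) fs
  end.

Fixpoint depth N (F : formula N) : nat :=
  if F is Gate _ f fs then (foldr maxn (depth f) (map (@depth N) fs)).+1 else 0.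

(* Every occurrence of a variable is an input gate of its own. *)
Fixpoint fsize N (F : formula N) : nat :=
  if F is Gate _ f fs then (fsize f + sumn (map (@fsize N) fs)).+1 else 1.

Section Coin.
Local Open Scope ring_scope.

Definition coin_dist (R : realType) (alpha : R) (N : nat)
    (x : {ffun 'I_N -> bool}) : R :=
  \prod_(i < N) (if x i then alpha else 1 - alpha).

Definition coin_prob (R : realType) (alpha : R) (N : nat)
    (g : {ffun 'I_N -> bool} -> bool) : R :=
  \sum_(x : {ffun 'I_N -> bool} | g x) coin_dist alpha x.

Definition solves_coin (R : realType) (delta : R) (N : nat)
    (g : {ffun 'I_N -> bool} -> bool) : Prop :=
  coin_prob ((1 - delta) / 2) g <= 1 / 10 /\
  9 / 10 <= coin_prob ((1 + delta) / 2) g.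

End Coin.

(* A gate is described by its label (AND, OR or a variable) and its position in
   the formula, a position being the list of the child indices met on the way
   down from the output gate.  Positions alone would not do: whether one
   extends the other by one index does not depend on the formula. *)
Definition gate_desc := ((conn + nat) * seq nat)%type.

Definition glabel N (F : formula N) : conn + nat :=
  match F with Input i => inr (i : nat) | Gate c _ _ => inl c end.

Fixpoint subformula N (F : formula N) (p : seq nat) : option (formula N) :=
  if p is k :: p' then
    if F is Gate _ f fs then
      if onth (f :: fs) k is Some G then subformula G p' else None
    else None
  else Some F.

Definition is_gate N (F : formula N) (g : gate_desc) : Prop :=
  omap (@glabel N) (subformula F g.2) = Some g.1.

Definition wire N (F : formula N) (g h : gate_desc) : Prop :=
  [/\ is_gate F g, is_gate F h &
      exists k, g.2 = rcons h.2 k \/ h.2 = rcons g.2 k].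

(* The model of computation: programs acting on finitely many stacks over the
   alphabet {0, 1, #}, written [Some false], [Some true], [None], with the top
   of a stack at the head of the list.  A step looks at or changes the top of a
   single stack, and the control is finite, because only finitely many lists of
   pending instructions are reachable from a given program.  So a stack is a
   tape and a step is O(1) steps of a multitape Turing machine; conversely a
   tape is a pair of stacks. *)
Definition symbol := option bool.
Definition store := nat -> seq symbol.

Inductive instr :=
| Push of nat & symbol
| Pop of nat
| IfTop of nat & symbol & seq instr & seq instr
| WhileNonempty of nat & seq instr.

Definition update (st : store) (r : nat) (w : seq symbol) : store :=
  fun r' => if r' == r then w else st r'.

Definition step (cfg : seq instr * store) : seq instr * store :=
  let: (c, st) := cfg in
  match c with
  | [::] => cfg
  | Push r a :: k => (k, update st r (a :: st r))
  | Pop r :: k => (k, update st r (behead (st r)))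
  | IfTop r a b1 b2 :: k =>
      ((if ohead (st r) == Some a then b1 else b2) ++ k, st)
  | WhileNonempty r b :: k =>
      (if st r is [::] then k else b ++ WhileNonempty r b :: k, st)
  end.

Definition halts_in (c : seq instr) (st : store) (t : nat) (st' : store) : Prop :=
  iter t step (c, st) = ([::], st').

Definition accepting (st : store) : Prop := ohead (st 0) = Some (Some true).

(* Binary notation, least significant bit first, without leading zeros. *)
Fixpoint pos_bits (p : BinNums.positive) : seq bool :=
  match p with
  | BinNums.xH => [:: true]
  | BinNums.xO p' => false :: pos_bits p'
  | BinNums.xI p' => true :: pos_bits p'
  end.

Definition nat_bits (n : nat) : seq bool :=
  if bin_of_nat n is BinNums.Npos p then pos_bits p else [::].

Definition enc_nat (n : nat) : seq symbol := map Some (nat_bits n).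

Definition enc_label (l : conn + nat) : seq symbol :=
  match l with
  | inl And => [:: Some false; Some false]
  | inl Or => [:: Some false; Some true]
  | inr i => Some true :: enc_nat i
  end.

Definition enc_gate (g : gate_desc) : seq symbol :=
  enc_label g.1 ++ None :: flatten [seq rcons (enc_nat k) None | k <- g.2].

Definition query (p q : nat) (g h : gate_desc) : seq (seq symbol) :=
  [:: enc_nat p; enc_nat q; enc_gate g; enc_gate h].

(* A parameter that can be given in binary is a rational p/q.  The two gate
   descriptions are arbitrary, so that the program also has to recognize the
   descriptions of gates of the formula (see [wire]). *)
Definition explicit (R : realType) (N : R -> nat)
    (Gamma : forall delta : R, formula (N delta)) : Prop :=
  exists (c : seq instr) (e : nat),
  forall (p q : nat) (g h : gate_desc), 0 < p < q ->
  exists (t : nat) (st : store),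
    [/\ halts_in c (nth [::] (query p q g h)) t st,
        t <= size (flatten (query p q g h)) ^ e + e &
        accepting st <-> wire (Gamma (p%:R / q%:R)%R) g h].

(* Main.v *)
From mathcomp Require Import all_boot all_order all_algebra.
From mathcomp Require Import reals sequences exp.
From mathcomp Require Import cyclic finfield boolp functions topology normedtype derive realfun lra ring zify.
Require Import Defs.
Import Order.TTheory GRing.Theory Num.Theory.
Import numFieldNormedType.Exports.
Set Implicit Arguments.
Unset Strict Implicit.
Unset Printing Implicit Defensive.

(** Put m = 2^a with m of order (1/delta)^(1/(d-1)).  The formula alternates OR
and AND gates, all gates of level i having the same fan-in M_i: M_1 = m,
M_d = 2^m, and in between M_i is of order m 2^m.  Write E_i for the event that
a formula of level i takes the value i mod 2; as the gates of odd level are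
ANDs, E_(i+1) says that no child of the gate satisfies E_i.  If the children
were independent, the probability c_i of E_i for unbiased bits would satisfy
c_(i+1) = (1 - c_i)^(M_(i+1)); the fan-ins keep c_i within a factor 2 of
2^-m for 0 < i < d.
A relative bias eta of c_i becomes at least eta m / 16 one level up, so that
after d - 1 levels the bias is large enough for the last gate to decide.

Children cannot be on disjoint variables, as the sample complexity would then
be as large as the formula.  The copy k of a level-i formula uses its variable
j paired with the hash P_k(j), where P_k is the polynomial over GF(2^s) whose
coefficients are the digits of k.  Two copies then rarely share variables.
Since the E_i are monotone, the lower bound (1 - c_i)^M on the probability of
E_(i+1) follows from Harris' inequality, and an upper bound of nearly the same
size from Janson's inequality.

The field is GF(2)[X]/(X^(2h) + X^h + 1) with h a power of 3, so that the wires
are decided in polynomial time without searching for irreducible polynomials.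
A fan-in M_i is an approximation of 2^(m+a) ln 2 by a partial sum of the series
of ln 2; it is only evaluated on inputs that are as long as its binary
expansion, so that this takes polynomial time as well. *)

(** The obstacle is to keep c_i in its window with fan-ins that can be computed. An error in 2^m c_i
    reappears one level up multiplied by about m, so closed fan-ins work only if 2^m dominates
    (4m)^(d-1), which holds once a is large compared with d. For the finitely many smaller a the
    fan-ins come from an existence argument and are hard-wired into the program, which may depend on
    d. Janson's inequality adds a term p^2 w, with w the sum, over the copies that share variables
    with a given one, of 4 to the number of shared variables. It has to stay below the initial bias,
    of order m^-(d-1). So the hashes of a level need as many bits as there are index bits below it,
    and about a d more. As the number of index bits at most triples per level, there are 2^(a
    2^(O(d))) samples, a power of 1/delta. The bias is computed for some delta1 <= delta that fits a
    power of two; monotonicity of the formula does the rest. For delta close to 1 no power of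
    1/delta of bounded exponent absorbs an absolute constant, so that case is treated apart, with
    one sample. *)

(** * Expectations under a biased product measure, one coordinate at a time *)

Section Averaging.
Local Open Scope ring_scope.
Variables (R : realType) (N : nat).
Local Notation cube := {ffun 'I_N -> bool}.
Implicit Types (f g : cube -> R) (x : cube) (i : 'I_N) (s : seq 'I_N).

Definition setb x i b : cube := [ffun j => if j == i then b else x j].

Lemma setbb x i b c : setb (setb x i b) i c = setb x i c.
Proof. by apply/ffunP => j; rewrite !ffunE; case: eqP. Qed.

Lemma setbC x i j b c : i != j ->
  setb (setb x i b) j c = setb (setb x j c) i b.
Proof.
move=> ij; apply/ffunP => l; rewrite !ffunE.
by case: (eqVneq l j) => [->|//]; rewrite eq_sym (negPf ij).
Qed.

Lemma setb_id x i : setb x i (x i) = x.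
Proof. by apply/ffunP => j; rewrite !ffunE; case: eqP => [->|]. Qed.

Variable al : R.
Hypothesis al01 : 0 <= al <= 1.

(** The average over bit i is kept as a function on the whole cube. Averages over several bits are
    then iterated operators, and the inequalities below become inductions over a list of
    coordinates. *)
Definition av i f x : R :=
  al * f (setb x i true) + (1 - al) * f (setb x i false).

Definition avs s f : cube -> R := foldr av f s.

Definition expect f : R := \sum_x coin_dist al x * f x.

Definition indep f i := forall x b, f (setb x i b) = f x.

(** Both directions in one predicate: increasing for [b = true], decreasing for [b = false]. The
    direction changes from each level of the formula to the next. *)
Definition mon b f := forall i x, f (setb x i (~~ b)) <= f (setb x i b).

Lemma al_ge0 : 0 <= al. Proof. by case/andP: al01. Qed.
Lemma al1_ge0 : 0 <= 1 - al. Proof. by case/andP: al01; rewrite subr_ge0. Qed.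

Lemma le_av i f g : (forall x, f x <= g x) -> forall x, av i f x <= av i g x.
Proof.
by move=> fg x; apply: lerD; apply: ler_wpM2l; rewrite ?al_ge0 ?al1_ge0.
Qed.

Lemma av_ge0 i f : (forall x, 0 <= f x) -> forall x, 0 <= av i f x.
Proof. by move=> f0 x; rewrite addr_ge0 ?mulr_ge0 ?al_ge0 ?al1_ge0. Qed.

Lemma avs_ge0 s f : (forall x, 0 <= f x) -> forall x, 0 <= avs s f x.
Proof. by move=> f0; elim: s => //= i s IH; apply: av_ge0. Qed.

Lemma indep_av i f : indep (av i f) i.
Proof. by move=> x b; rewrite /av !setbb. Qed.

Lemma indep_av_other i j f : indep f j -> indep (av i f) j.
Proof.
move=> fj x b; case: (eqVneq i j) => [->|ij]; first exact: indep_av.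
by rewrite /av !(setbC _ _ _ (_ : j != i)) 1?eq_sym // !fj.
Qed.

Lemma indep_avs s f i : indep f i -> indep (avs s f) i.
Proof. by move=> fi; elim: s => //= j s; apply: indep_av_other. Qed.

Lemma indep_avs_mem s f i : i \in s -> indep (avs s f) i.
Proof.
elim: s => //= j s IH; rewrite inE => /orP[/eqP->|/IH]; first exact: indep_av.
exact: indep_av_other.
Qed.

Lemma mon_av b i f : mon b f -> mon b (av i f).
Proof.
move=> fb j x; case: (eqVneq i j) => [->|ij]; first by rewrite !indep_av.
rewrite /av !(setbC _ _ _ (_ : j != i)) 1?eq_sym //.
by apply: lerD; apply: ler_wpM2l; rewrite ?al_ge0 ?al1_ge0.
Qed.

Lemma mon_avs b s f : mon b f -> mon b (avs s f).
Proof. by move=> fb; elim: s => //= j s; apply: mon_av. Qed.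

(** The last term is the covariance of two functions of a single bit. It is nonnegative if both are
    monotone in the same direction, which gives Harris' inequality, and vanishes if one of them
    ignores the bit. *)
Lemma av_mul i f g x : av i (fun y => f y * g y) x = av i f x * av i g x +
  al * (1 - al) * ((f (setb x i true) - f (setb x i false)) *
                   (g (setb x i true) - g (setb x i false))).
Proof. by rewrite /av; ring. Qed.

Lemma avs_mul_ge b s f g : mon b f -> mon b g -> forall x,
  avs s f x * avs s g x <= avs s (fun y => f y * g y) x.
Proof.
move=> fb gb; elim: s => //= i s IH x.
apply: le_trans (le_av i IH x); rewrite av_mul lerDl.
apply: mulr_ge0; first by rewrite mulr_ge0 ?al_ge0 ?al1_ge0.
have := mon_avs s fb i x; have := mon_avs s gb i x.
by case: (b) => /= ? ?; [rewrite mulr_ge0 ?subr_ge0 | rewrite mulr_le0 ?subr_le0].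
Qed.

Lemma avs_mul_indep s f g : (forall i, i \in s -> indep f i \/ indep g i) ->
  forall x, avs s (fun y => f y * g y) x = avs s f x * avs s g x.
Proof.
elim: s => //= i s IH fg x.
rewrite [LHS](_ : _ = av i (fun y => avs s f y * avs s g y) x); last first.
  by rewrite /av !IH // => j js; apply: fg; rewrite inE js orbT.
rewrite av_mul; case: (fg i (mem_head _ _)) => /(indep_avs s) h; rewrite !h;
by rewrite subrr ?mul0r ?mulr0 addr0.
Qed.

(** If both values of a bit have probability at least 1/[be], nonnegative functions of that bit
    satisfy E(fg) <= [be] E(f) E(g): the diagonal terms of E(f) E(g) are enough. So each coordinate
    on which both functions depend costs one factor [be]. *)
Lemma avs_mul_le (be : R) (P : pred 'I_N) s f g :
  1 <= be * al -> 1 <= be * (1 - al) ->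
  (forall x, 0 <= f x) -> (forall x, 0 <= g x) ->
  (forall i, ~~ P i -> indep f i \/ indep g i) -> forall x,
  avs s (fun y => f y * g y) x <= be ^+ count P s * (avs s f x * avs s g x).
Proof.
move=> b1 b2 f0 g0 fg.
have be0 : 0 <= be.
  rewrite leNgt; apply/negP => be0; move: b1; rewrite leNgt => /negP[].
  by apply: le_lt_trans ltr01; rewrite mulr_le0_ge0 ?al_ge0 // ltW.
elim: s => [|i s IH] x /=; first by rewrite mul1r.
apply: le_trans (le_av i IH x) _.
rewrite /av (mulrCA al) (mulrCA (1 - al)) -mulrDr exprD -mulrA.
rewrite (mulrCA (be ^+ P i)) ler_wpM2l ?exprn_ge0 //.
rewrite -/(av i (fun y => avs s f y * avs s g y) x).
case: (boolP (P i)) => [Pi|/fg Pi]; last first.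
  rewrite expr0 mul1r -[X in _ <= X * _]/(av i (avs s f) x).
  rewrite -[X in _ <= _ * X]/(av i (avs s g) x) av_mul.
  by case: Pi => /(indep_avs s) h; rewrite !h subrr ?mul0r ?mulr0 addr0.
rewrite expr1 /av.
have := avs_ge0 s f0 (setb x i true); have := avs_ge0 s f0 (setb x i false).
have := avs_ge0 s g0 (setb x i true); have := avs_ge0 s g0 (setb x i false).
move: (avs s f _) (avs s f _) (avs s g _) (avs s g _) => u1 u0 v1 v0 hv0 hv1 hu0 hu1.
have e1 : al * (u1 * v1) <= be * al * (al * (u1 * v1)).
  by rewrite ler_peMl // mulr_ge0 ?al_ge0 // mulr_ge0.
have e2 : (1 - al) * (u0 * v0) <= be * (1 - al) * ((1 - al) * (u0 * v0)).
  by rewrite ler_peMl // mulr_ge0 ?al1_ge0 // mulr_ge0.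
apply: le_trans (lerD e1 e2) _.
rewrite -subr_ge0 [X in 0 <= X](_ : _ =
  be * (al * (1 - al)) * (u1 * v0 + u0 * v1)); last by ring.
by rewrite !mulr_ge0 ?al_ge0 ?al1_ge0 // addr_ge0 // mulr_ge0.
Qed.

(** Each point is grouped with the one that differs in bit i; on such a pair the weighted sums of f
    and of its average coincide. Doubling the sum avoids a choice of representatives. *)
Lemma expect_av i f : expect (av i f) = expect f.
Proof.
pose fl x := setb x i (~~ x i).
have flK : involutive fl.
  by move=> x; rewrite /fl setbb ffunE eqxx negbK setb_id.
have half (h : cube -> R) : 2 * \sum_x h x = \sum_x (h x + h (fl x)).
  by rewrite mulr_natl mulr2n big_split /= [X in X + _](reindex_inj (inv_inj flK)) addrC.
apply: (@mulfI _ 2); first by rewrite pnatr_eq0.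
rewrite /expect !half; apply: eq_bigr => x _.
have avfl : av i f (fl x) = av i f x by rewrite /fl indep_av.
rewrite avfl -mulrDl.
pose W := \prod_(j < N | j != i) (if x j then al else 1 - al).
have w b : coin_dist al (setb x i b) = (if b then al else 1 - al) * W.
  rewrite /coin_dist (bigD1 i) //= ffunE eqxx; congr (_ * _).
  by apply: eq_bigr => j ji; rewrite ffunE (negPf ji).
have wx : coin_dist al x = (if x i then al else 1 - al) * W.
  by rewrite -w setb_id.
have wfl : coin_dist al (fl x) = (if ~~ x i then al else 1 - al) * W.
  by rewrite /fl w.
have fx : f x = f (setb x i (x i)) by rewrite setb_id.
rewrite /av wfl wx /fl fx.
by case: (x i) => /=; ring.
Qed.

Lemma expect_avs s f : expect (avs s f) = expect f.
Proof. by elim: s => //= i s IH; rewrite expect_av. Qed.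

Lemma expect_cst (c : R) : expect (fun=> c) = c.
Proof.
rewrite /expect -mulr_suml.
rewrite -(bigA_distr_bigA (fun (i : 'I_N) b => if b then al else 1 - al)) /=.
rewrite big1 ?mul1r // => i _.
by rewrite big_bool /= subrKC.
Qed.

Lemma eq_expect f g : f =1 g -> expect f = expect g.
Proof. by move=> fg; apply: eq_bigr => x _; rewrite fg. Qed.

Lemma indep_cst f : (forall i, indep f i) -> forall x y, f x = f y.
Proof.
move=> fi x y.
have h s : f [ffun j => if j \in s then y j else x j] = f x.
  elim: s => [|i s IH]; first by congr f; apply/ffunP => j; rewrite ffunE.
  rewrite -IH -[RHS](fi i _ (y i)); congr f; apply/ffunP => j; rewrite !ffunE inE.
  by case: eqP => [->|].
rewrite -(h (enum 'I_N)); congr f; apply/ffunP => j.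
by rewrite ffunE mem_enum.
Qed.

Lemma avs_expect s f x : (forall i, i \in s) -> avs s f x = expect f.
Proof.
move=> hs; rewrite -(expect_avs s) -[LHS](expect_cst); apply: eq_expect => y.
by apply: indep_cst => i; apply: indep_avs_mem.
Qed.

Let x0 : cube := [ffun=> false].

Lemma avs_enum f : avs (enum 'I_N) f x0 = expect f.
Proof. by apply: avs_expect => i; rewrite mem_enum. Qed.

Lemma coin_dist_ge0 x : 0 <= coin_dist al x.
Proof. by apply: prodr_ge0 => i _; case: ifP; rewrite ?al_ge0 ?al1_ge0. Qed.

Lemma le_expect f g : (forall x, f x <= g x) -> expect f <= expect g.
Proof.
by move=> fg; apply: ler_sum => x _; apply: ler_wpM2l; rewrite ?coin_dist_ge0.
Qed.

Lemma expect_ge0 f : (forall x, 0 <= f x) -> 0 <= expect f.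
Proof. by move=> /le_expect; rewrite expect_cst. Qed.

Lemma expectD f g : expect (fun x => f x + g x) = expect f + expect g.
Proof. by rewrite -big_split; apply: eq_bigr => x _; rewrite mulrDr. Qed.

Lemma expectZ c f : expect (fun x => c * f x) = c * expect f.
Proof. by rewrite /expect mulr_sumr; apply: eq_bigr => x _; rewrite mulrCA. Qed.

Lemma expectB f g : expect (fun x => f x - g x) = expect f - expect g.
Proof.
rewrite expectD; congr (_ + _).
by rewrite -[RHS]mulN1r -expectZ; apply: eq_expect => x; rewrite mulN1r.
Qed.

Lemma expect_sum (I : Type) (r : seq I) (P : pred I) (F : I -> cube -> R) :
  expect (fun x => \sum_(k <- r | P k) F k x) = \sum_(k <- r | P k) expect (F k).
Proof.
rewrite /expect [RHS]exchange_big /=.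
by apply: eq_bigr => x _; rewrite mulr_sumr.
Qed.

Lemma harris b f g : mon b f -> mon b g ->
  expect f * expect g <= expect (fun x => f x * g x).
Proof. by move=> fb gb; rewrite -!avs_enum; apply: (avs_mul_ge (b := b)). Qed.

Lemma harrisN b f g : mon b f -> mon (~~ b) g ->
  expect (fun x => f x * g x) <= expect f * expect g.
Proof.
move=> fb gb; rewrite -[leRHS]opprK lerNr -mulrN.
have e h : expect (fun x => - h x) = - expect h.
  by rewrite -[RHS]mulN1r -expectZ; apply: eq_expect => x; rewrite mulN1r.
rewrite -!e; apply: le_trans (harris fb (g := fun x => - g x) _) _.
  by move=> i x; have := gb i x; rewrite lerN2 negbK.
by apply: le_expect => x; rewrite mulrN.
Qed.

Lemma expect_mul_indep f g : (forall i, indep f i \/ indep g i) ->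
  expect (fun x => f x * g x) = expect f * expect g.
Proof. by move=> fg; rewrite -!avs_enum; apply: avs_mul_indep. Qed.

Lemma expect_mul_le (be : R) (P : pred 'I_N) f g :
  1 <= be * al -> 1 <= be * (1 - al) ->
  (forall x, 0 <= f x) -> (forall x, 0 <= g x) ->
  (forall i, ~~ P i -> indep f i \/ indep g i) ->
  expect (fun x => f x * g x) <= be ^+ #|P| * (expect f * expect g).
Proof.
move=> b1 b2 f0 g0 fg; rewrite -!avs_enum cardE.
have -> : enum P = seq.filter P (enum 'I_N) by rewrite enumT.
by rewrite size_filter; apply: avs_mul_le.
Qed.

End Averaging.

(** * Harris' and Janson's inequalities for products of factors 1 - F_k *)

Section Prod01.
Local Open Scope ring_scope.
Variables (R : realType) (N : nat).
Local Notation cube := {ffun 'I_N -> bool}.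

Lemma prod01_ge0 (I : Type) (r : seq I) (P : pred I) (F : I -> R) :
  (forall k, 0 <= F k <= 1) -> 0 <= \prod_(k <- r | P k) (1 - F k).
Proof. by move=> F01; apply: prodr_ge0 => k _; rewrite subr_ge0; case/andP: (F01 k). Qed.

Lemma prod01_le1 (I : Type) (r : seq I) (P : pred I) (F : I -> R) :
  (forall k, 0 <= F k <= 1) -> \prod_(k <- r | P k) (1 - F k) <= 1.
Proof.
move=> F01; elim: r => [|k r IH]; first by rewrite big_nil.
rewrite big_cons; case: ifP => // _; case/andP: (F01 k) => F0 F1.
by rewrite mulr_ile1 ?prod01_ge0 ?subr_ge0 // lerBlDr lerDl.
Qed.

Lemma union_bound (I : Type) (r : seq I) (P : pred I) (F : I -> R) :
  (forall k, 0 <= F k <= 1) ->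
  1 - \sum_(k <- r | P k) F k <= \prod_(k <- r | P k) (1 - F k).
Proof.
move=> F01; elim: r => [|k r IH]; first by rewrite !big_nil subr0.
rewrite !big_cons; case: ifP => // _.
have F0 : 0 <= F k by case/andP: (F01 k).
have p1 := prod01_le1 r P F01.
rewrite mulrBl mul1r opprD addrA [1 - F k]addrC -addrA addrC.
by apply: lerB => //; rewrite ler_piMr.
Qed.

Lemma mon_prod b (I : Type) (r : seq I) (P : pred I) (F : I -> cube -> R) :
  (forall k, mon b (F k)) -> (forall k x, 0 <= F k x <= 1) ->
  mon (~~ b) (fun x => \prod_(k <- r | P k) (1 - F k x)).
Proof.
move=> Fb F01 i x; rewrite negbK; apply: ler_prod => k _.
rewrite subr_ge0; case/andP: (F01 k (setb x i b)) => _ -> /=.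
by rewrite lerD2l lerN2; apply: Fb.
Qed.

Lemma indep_prod (I : eqType) (r : seq I) (P : pred I) (F : I -> cube -> R) i :
  (forall k, P k -> indep (F k) i) ->
  indep (fun x => \prod_(k <- r | P k) (1 - F k x)) i.
Proof. by move=> Fi x b; apply: eq_bigr => k Pk; rewrite Fi. Qed.

End Prod01.

Lemma size_index_ord n : size (index_enum 'I_n) = n.
Proof. by rewrite /index_enum unlock -enumT size_enum_ord. Qed.

Section Janson.
Local Open Scope ring_scope.
Variables (R : realType) (N : nat) (al : R) (al01 : 0 <= al <= 1).
Local Notation cube := {ffun 'I_N -> bool}.
Local Notation E := (@expect R N al).
Variables (M : nat) (F : 'I_M -> cube -> R) (b : bool) (p : R).
Hypothesis (Fb : forall k, mon b (F k)) (F01 : forall k x, 0 <= F k x <= 1).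
Hypothesis (Fp : forall k, E (F k) = p).

Lemma avoid_ge : (1 - p) ^+ M <= E (fun x => \prod_(k < M) (1 - F k x)).
Proof.
suff h : forall r : seq 'I_M,
    (1 - p) ^+ size r <= E (fun x => \prod_(k <- r) (1 - F k x)).
  by have := h (index_enum 'I_M); rewrite size_index_ord.
elim=> [|k r IH] /=.
  rewrite expr0 -[leLHS](expect_cst N al).
  by apply: le_expect => // x; rewrite big_nil.
have p1 : 0 <= 1 - p.
  rewrite -(Fp k) -[1](expect_cst N al) -expectB.
  by apply: expect_ge0 => // x; rewrite subr_ge0; case/andP: (F01 k x).
rewrite exprS; apply: (@le_trans _ _ (E (fun x => 1 - F k x) *
    E (fun x => \prod_(k <- r) (1 - F k x)))).
  by rewrite expectB expect_cst Fp ler_wpM2l.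
apply: le_trans (harris al01 (b := ~~ b) _ _) _.
- by move=> i x; rewrite negbK lerD2l lerN2; apply: Fb.
- exact: (@mon_prod R N b).
by apply: le_expect => // x; rewrite big_cons.
Qed.

(* The Boppana-Spencer proof of Janson's inequality, for [0,1]-valued functions
   in place of events. *)
Lemma avoid_le (adj : rel 'I_M) (w : R) :
  (forall k l i, ~~ adj l k -> indep (F k) i \/ indep (F l) i) ->
  (forall k, \sum_(l < M | (l != k) && adj l k) E (fun x => F k x * F l x) <= w) ->
  E (fun x => \prod_(k < M) (1 - F k x)) <= (1 - p + w) ^+ M.
Proof.
move=> Hadj Hw.
suff h : forall r : seq 'I_M, uniq r ->
    E (fun x => \prod_(k <- r) (1 - F k x)) <= (1 - p + w) ^+ size r.
  by have := h (index_enum 'I_M) (index_enum_uniq _); rewrite size_index_ord.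
elim=> [|k r IH] /=.
  move=> _; rewrite expr0 -[leRHS](expect_cst N al).
  by apply: le_expect => // x; rewrite big_nil.
case/andP => kr ur.
have w0 : 0 <= w.
  apply: le_trans (Hw k); apply: sumr_ge0 => l _; apply: expect_ge0 => // x.
  by rewrite mulr_ge0 //; [case/andP: (F01 k x) | case/andP: (F01 l x)].
have p1 : 0 <= 1 - p.
  rewrite -(Fp k) -[1](expect_cst N al) -expectB.
  by apply: expect_ge0 => // x; rewrite subr_ge0; case/andP: (F01 k x).
rewrite exprS; apply: le_trans (ler_wpM2l _ (IH ur)); last exact: addr_ge0.
(* [C] collects the factors that may be correlated with F_k, and [B] the others. The aim is E(F_k G)
   >= (p - w) E(G), so that the new factor 1 - F_k multiplies E(G) by at most 1 - p + w. *)
pose G x := \prod_(l <- r) (1 - F l x).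
pose B x := \prod_(l <- r | ~~ adj l k) (1 - F l x).
pose C x := \prod_(l <- r | adj l k) (1 - F l x).
have GBC x : G x = C x * B x by rewrite /G (bigID (fun l => adj l k)).
have B0 x : 0 <= B x by apply: prod01_ge0.
have C1 x : C x <= 1 by apply: prod01_le1.
have Fk0 x : 0 <= F k x by case/andP: (F01 k x).
have Fl0 l x : 0 <= F l x by case/andP: (F01 l x).
rewrite (@eq_expect _ _ _ _ (fun x => G x - F k x * G x)); last first.
  by move=> x; rewrite big_cons mulrBl mul1r.
rewrite expectB -/G (_ : 1 - p + w = 1 - (p - w)); last by ring.
rewrite mulrBl mul1r lerD2l lerN2.
have EB0 : 0 <= E B by apply: expect_ge0.
have EG0 : 0 <= E G by apply: expect_ge0 => // x; apply: prod01_ge0.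
have EGB : E G <= E B.
  by apply: le_expect => // x; rewrite GBC ler_piMl.
(* The union bound handles [C]. F_k is independent of [B], while F_k F_l and [B] are monotone in
   opposite directions, so Harris' inequality bounds the correction terms from above. *)
have low : (p - w) * E B <= E (fun x => F k x * G x).
  apply: (@le_trans _ _ (E (fun x => F k x * B x -
     \sum_(l <- r | adj l k) (F k x * F l x) * B x))); last first.
    apply: le_expect => // x; rewrite GBC mulrCA [leRHS]mulrC.
    have := union_bound r (fun l => adj l k) (F01^~ x) => /(ler_wpM2r (mulr_ge0 (Fk0 x) (B0 x))).
    rewrite -/(C x) mulrBl mul1r mulr_suml => h.
    rewrite [leRHS]mulrC; apply: le_trans h; rewrite lerD2l lerN2 le_eqVlt.
    by apply/orP; left; apply/eqP; apply: eq_bigr => l _; ring.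
  rewrite expectB expect_mul_indep; last first.
    move=> i.
    have [Hi|Hi] := pselect (indep (F k) i); [by left | right].
    by apply: indep_prod => l /Hadj - /(_ i) [].
  rewrite Fp mulrBl lerD2l lerN2 expect_sum.
  apply: (@le_trans _ _ (\sum_(l <- r | adj l k) E (fun x => F k x * F l x) * E B)).
    apply: ler_sum => l _; apply: (harrisN al01 (b := b)) => //; last exact: (@mon_prod R N b).
    by move=> i x; apply: ler_pM => //; apply: Fb.
  rewrite -mulr_suml ler_wpM2r //.
  apply: le_trans (Hw k).
  have En0 l : 0 <= E (fun x => F k x * F l x).
    by apply: expect_ge0 => // x; apply: mulr_ge0.
  rewrite -big_filter [leRHS]big_mkcond /=.
  rewrite [leRHS](bigID (mem [seq l <- r | adj l k])) /=.
  rewrite -[leLHS]addr0 lerD //; last by apply: sumr_ge0 => l _; case: ifP.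
  rewrite big_uniq ?filter_uniq //= le_eqVlt; apply/orP; left; apply/eqP.
  apply: eq_big => // l; rewrite mem_filter => /andP[adjl lr].
  by rewrite adjl andbT; case: eqP => // lk; rewrite -lk lr in kr.
(* If p - w >= 0, then E(B) may be replaced by the smaller E(G); otherwise the lower bound to be
   shown is not positive. *)
have [pw|pw] := lerP 0 (p - w).
  by apply: le_trans low; rewrite ler_wpM2l.
apply: (@le_trans _ _ 0); first by rewrite mulr_le0_ge0 // ltW.
by apply: expect_ge0 => // x; rewrite mulr_ge0 // prod01_ge0.
Qed.

End Janson.

(** * One level of the formula: copies of a function under injective renamings *)

Section Rename.
Local Open Scope ring_scope.
Variables (R : realType) (al : R) (N N' : nat) (sg : 'I_N -> 'I_N').
Hypothesis (al01 : 0 <= al <= 1) (sg_inj : injective sg).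

Definition pull (y : {ffun 'I_N' -> bool}) : {ffun 'I_N -> bool} :=
  [ffun j => y (sg j)].

Lemma pull_setb y j b : pull (setb y (sg j) b) = setb (pull y) j b.
Proof. by apply/ffunP => l; rewrite !ffunE (inj_eq sg_inj). Qed.

Lemma pull_setb_out y i b : (forall j, sg j != i) -> pull (setb y i b) = pull y.
Proof. by move=> h; apply/ffunP => l; rewrite !ffunE (negPf (h l)). Qed.

Lemma indep_pull (f : {ffun 'I_N -> bool} -> R) i :
  (forall j, sg j != i) -> indep (fun y => f (pull y)) i.
Proof. by move=> h y b; rewrite pull_setb_out. Qed.

Lemma mon_pull b (f : {ffun 'I_N -> bool} -> R) :
  mon b f -> mon b (fun y => f (pull y)).
Proof.
move=> fb i y; have [/existsP[j /eqP <-]|/existsPn h] := boolP [exists j, sg j == i].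
  by rewrite !pull_setb.
by rewrite !pull_setb_out.
Qed.

(** Averaging over a coordinate outside the image of [sg] changes nothing, and over [sg j] it
    amounts to averaging over j. So a list of all coordinates of the target turns into a list of all
    coordinates of the source. *)
Lemma expect_pull (f : {ffun 'I_N -> bool} -> R) :
  expect al (fun y => f (pull y)) = expect al f.
Proof.
pose inv i := [pick j | sg j == i].
have h s y : avs al s (fun y => f (pull y)) y = avs al (pmap inv s) f (pull y).
  elim: s y => //= i s IH y; rewrite {1}/av !IH /inv; case: pickP => [j /eqP <-|h] /=.
    by rewrite !pull_setb.
  by rewrite !pull_setb_out -?mulrDl ?subrKC ?mul1r // => j; rewrite h.
pose y0 : {ffun 'I_N' -> bool} := [ffun=> false].
rewrite -(@avs_expect _ _ _ (enum 'I_N') _ y0) => [|i]; last by rewrite mem_enum.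
rewrite h avs_expect // => j; rewrite mem_pmap; apply/mapP; exists (sg j).
  by rewrite mem_enum.
rewrite /inv; case: pickP => [l /eqP/sg_inj -> //|/(_ j)].
by rewrite eqxx.
Qed.

End Rename.

Section Layer.
Local Open Scope ring_scope.
Variables (R : realType) (al : R) (N N' M : nat) (sg : 'I_M -> 'I_N -> 'I_N').
Hypothesis (al01 : 0 <= al <= 1) (sg_inj : forall k, injective (sg k)).
Hypothesis sgP : forall k l i j, sg k i = sg l j -> i = j.
Variables (b : bool) (f : {ffun 'I_N -> bool} -> R).
Hypothesis (fb : mon b f) (f01 : forall x, 0 <= f x <= 1).

Definition layer y : R := \prod_(k < M) (1 - f (pull (sg k) y)).

Lemma mon_layer : mon (~~ b) layer.
Proof. by apply: mon_prod => // k; apply: mon_pull. Qed.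

Lemma layer01 y : 0 <= layer y <= 1.
Proof. by rewrite prod01_ge0 ?prod01_le1. Qed.

Lemma expect_layer_ge : (1 - expect al f) ^+ M <= expect al layer.
Proof.
apply: (avoid_ge al01 (b := b)) => // k; first exact: mon_pull.
exact: expect_pull.
Qed.

(** By [sgP] a variable common to two copies has the same index in both, so that indices describe
    the whole overlap. *)
Definition shared k l := [set j | sg k j == sg l j].

(** Janson's bound 1 - p + p^2 w is not monotone in p, so p must be allowed below the true
    expectation. Scaling f by [rho] makes the expectation equal to p and only increases the product.
    The scaled function is no longer Boolean, hence the [0,1]-valued form of the inequality. *)
Lemma expect_layer_le (be p w : R) :
  1 <= be * al -> 1 <= be * (1 - al) -> 0 <= p <= expect al f ->
  (forall k, \sum_(l < M | (l != k) && (shared l k != set0))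
     be ^+ #|shared l k| <= w) ->
  expect al layer <= (1 - p + p ^+ 2 * w) ^+ M.
Proof.
move=> b1 b2 /andP[p0 pf] hw.
have [q0|q0] := eqVneq (expect al f) 0.
  have -> : p = 0 by apply/eqP; rewrite eq_le p0 andbT -q0.
  rewrite subr0 expr0n /= mul0r addr0 expr1n -[leRHS](expect_cst N' al).
  by apply: le_expect => // y; case/andP: (layer01 y).
pose rho := p / expect al f.
have q_gt0 : 0 < expect al f.
  by rewrite lt0r q0 (le_trans p0 pf).
have rho0 : 0 <= rho by rewrite divr_ge0 // ltW.
have rho1 : rho <= 1 by rewrite ler_pdivrMr // mul1r.
pose F k y := rho * f (pull (sg k) y).
have F01 k y : 0 <= F k y <= 1.
  by case/andP: (f01 (pull (sg k) y)) => h0 h1; apply/andP; split; [apply: mulr_ge0 | apply: mulr_ile1].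
apply: (@le_trans _ _ (expect al (fun y => \prod_(k < M) (1 - F k y)))).
  apply: le_expect => // y; apply: ler_prod => k _.
  case/andP: (f01 (pull (sg k) y)) => h0 h1.
  by rewrite subr_ge0 h1 lerD2l lerN2 ler_piMl.
have EF k : expect al (F k) = p.
  by rewrite expectZ expect_pull // divfK.
have indF k i : (forall j, sg k j != i) -> indep (F k) i.
  by move=> h y c; rewrite /F (indep_pull f h).
apply: (@avoid_le _ _ _ al01 _ F b p _ F01 EF (fun l k => shared l k != set0)).
- move=> k i y; rewrite /F ler_wpM2l //.
exact: (mon_pull (@sg_inj k) fb i y).
- move=> k l i; rewrite negbK => /eqP h.
  have [/existsP[j /eqP hj]|/existsPn] := boolP [exists j, sg k j == i]; last first.
    by move/indF; left.
  right; apply: indF => j'; apply/eqP => hj'.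
  have jj : j' = j by apply: (@sgP l k); rewrite hj hj'.
  have : j \in shared l k by rewrite inE hj -jj hj'.
  by rewrite h inE.
move=> k; rewrite mulrC; apply: le_trans (ler_wpM2r _ (hw k)); last exact: exprn_ge0.
rewrite mulr_suml; apply: ler_sum => l /andP[lk _].
pose P i := i \in [set sg l j | j in shared l k].
have -> : #|shared l k| = #|P| by rewrite -(card_imset _ (@sg_inj l)).
apply: le_trans (expect_mul_le al01 (P := P) b1 b2 _ _ _) _.
- by move=> y; case/andP: (F01 k y).
- by move=> y; case/andP: (F01 l y).
- move=> i; rewrite /P => hi.
  have [/existsP[j /eqP hj]|/existsPn] := boolP [exists j, sg k j == i]; last first.
    by move/indF; left.
  right; apply: indF => j'; apply/eqP => hj'; case/imsetP: hi; exists j' => //.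
  have jj : j' = j by apply: (@sgP l k); rewrite hj hj'.
  by rewrite inE hj' jj hj.
by rewrite !EF expr2.
Qed.

End Layer.

Section CoinProb.
Local Open Scope ring_scope.
Variables (R : realType) (N : nat).

Lemma coin_probE (al : R) (g : {ffun 'I_N -> bool} -> bool) :
  coin_prob al g = expect al (fun x => (g x)%:R).
Proof.
rewrite /coin_prob big_mkcond; apply: eq_bigr => x _.
by case: (g x); rewrite ?mulr1 ?mulr0.
Qed.

(** The bias is raised in one coordinate after another, in place of a coupling of the two
    measures. *)
Lemma expect_mono (al al' : R) (f : {ffun 'I_N -> bool} -> R) :
  0 <= al -> al <= al' -> al' <= 1 -> mon true f -> expect al f <= expect al' f.
Proof.
move=> al0 alal al1 fm.
have h1 : 0 <= al <= 1 by rewrite al0 (le_trans alal).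
have h2 : 0 <= al' <= 1 by rewrite al1 (le_trans al0).
have h s x : avs al s f x <= avs al' s f x.
  elim: s x => //= i s IH x; apply: (le_trans (le_av h1 i IH x)).
  have := mon_avs h2 s fm i x => /=; rewrite /av.
  move: (avs al' s f _) (avs al' s f _) => u v uv; nra.
rewrite -(@avs_expect _ _ al (enum 'I_N) f [ffun=> false]); last first.
  by move=> i; rewrite mem_enum.
rewrite -(@avs_expect _ _ al' (enum 'I_N) f [ffun=> false]); last first.
  by move=> i; rewrite mem_enum.
exact: h.
Qed.

End CoinProb.

(** * Running times of stack programs *)

Notation W := (seq symbol).

Section Runs.
Implicit Types (st : store) (w : W).

(** The code runs in front of an arbitrary continuation [k], which makes sequencing and loops
    compositional. T is only an upper bound, as branches may differ in time. *)
Definition runs c st T st' : Prop :=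
  exists2 t, t <= T & forall k, iter t step (c ++ k, st) = (k, st').

Lemma runs_le c st T T' st' : T <= T' -> runs c st T st' -> runs c st T' st'.
Proof. by move=> TT [t tT h]; exists t => //; apply: leq_trans TT. Qed.

Lemma runs_nil st : runs [::] st 0 st.
Proof. by exists 0. Qed.

Lemma runs_cat c1 c2 st T1 st1 T2 st2 :
  runs c1 st T1 st1 -> runs c2 st1 T2 st2 -> runs (c1 ++ c2) st (T1 + T2) st2.
Proof.
move=> [t1 l1 h1] [t2 l2 h2]; exists (t2 + t1); first by rewrite addnC leq_add.
by move=> k; rewrite iterD -catA h1 h2.
Qed.

Lemma runs_push r a st : runs [:: Push r a] st 1 (update st r (a :: st r)).
Proof. by exists 1. Qed.

Lemma runs_pop r st : runs [:: Pop r] st 1 (update st r (behead (st r))).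
Proof. by exists 1. Qed.

Lemma runs_if r a b1 b2 st T st' :
  runs (if ohead (st r) == Some a then b1 else b2) st T st' ->
  runs [:: IfTop r a b1 b2] st T.+1 st'.
Proof. by move=> [t tT h]; exists t.+1 => // k; rewrite iterSr /= h. Qed.

Lemma runs_while0 r b st : st r = [::] -> runs [:: WhileNonempty r b] st 1 st.
Proof. by move=> h; exists 1 => // k; rewrite /= h. Qed.

Lemma runs_whileS r b st T st1 T' st2 : st r <> [::] -> runs b st T st1 ->
  runs [:: WhileNonempty r b] st1 T' st2 ->
  runs [:: WhileNonempty r b] st (T + T').+1 st2.
Proof.
move=> h [t tT ht] [t' tT' ht']; exists (t' + t).+1.
  by rewrite ltnS addnC leq_add.
move=> k; rewrite iterSr iterD /=; case E: (st r) => [//|a w].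
by rewrite ht (ht' k).
Qed.

Lemma updateE st r w : update st r w r = w.
Proof. by rewrite /update eqxx. Qed.

Lemma update_neq st r w r' : r' <> r -> update st r w r' = st r'.
Proof. by rewrite /update; case: eqP. Qed.

Lemma update_update st r w w' : update (update st r w) r w' = update st r w'.
Proof. by apply: funext => r'; rewrite /update; case: eqP. Qed.

Lemma update_id st r : update st r (st r) = st.
Proof. by apply: funext => r'; rewrite /update; case: eqP => [->|]. Qed.

Lemma update_nil st r : st r = [::] -> update st r [::] = st.
Proof. by move=> <-; rewrite update_id. Qed.

(** A case distinction on the popped symbol, unfolded over the three symbols; on a nonempty stack
    the last one needs no test. *)
Definition shift_top r (c : symbol -> seq instr) :=
  [:: IfTop r (Some true) (Pop r :: c (Some true))
    [:: IfTop r (Some false) (Pop r :: c (Some false)) (Pop r :: c None)]].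

Lemma runs_shift_top r (c : symbol -> seq instr) st T st' a w : st r = a :: w ->
  runs (c a) (update st r w) T st' -> runs (shift_top r c) st T.+3 st'.
Proof.
move=> E h.
have hp : runs (Pop r :: c a) st T.+1 st'.
  by apply: (runs_cat (c1 := [:: Pop r]) (runs_pop r st)); rewrite E.
rewrite /shift_top; apply: runs_if; rewrite E.
by case: a E h hp => [[]|] E h hp /=; [apply: runs_le hp; lia | |];
  apply: runs_if; rewrite E.
Qed.

Definition clear r := [:: WhileNonempty r [:: Pop r]].

Lemma runs_clear r st : runs (clear r) st (2 * size (st r)).+1 (update st r [::]).
Proof.
move E: (st r) => w; elim: w st E => [|a w IH] st E.
  by rewrite update_nil //; apply: runs_while0.
have h : st r <> [::] by rewrite E.
have := runs_whileS h (runs_pop r st) (IH _ _); rewrite E updateE update_update.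
by move=> /(_ erefl); apply: runs_le => /=; lia.
Qed.

Definition mv src dst :=
  [:: WhileNonempty src (shift_top src (fun a => [:: Push dst a]))].

Lemma runs_mv src dst st : src <> dst -> runs (mv src dst) st (5 * size (st src)).+1
  (update (update st src [::]) dst (catrev (st src) (st dst))).
Proof.
move=> sd; move E: (st src) => w; elim: w st E => [|a w IH] st E.
  by rewrite update_nil // update_id; apply: runs_while0.
have h : st src <> [::] by rewrite E.
have h1 : runs (shift_top src (fun a => [:: Push dst a])) st 4
    (update (update st src w) dst (a :: st dst)).
  apply: runs_shift_top E _.
  have := runs_push dst a (update st src w).
  by rewrite update_neq // => /nesym.
set st1 := update _ _ _ in h1.
have E1 : st1 src = w by rewrite /st1 update_neq // updateE.
have := runs_whileS h h1 (IH st1 E1).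
rewrite /st1 updateE => h2.
rewrite (_ : update (update st src [::]) dst (catrev (a :: w) (st dst)) =
  update (update (update (update st src w) dst (a :: st dst)) src [::]) dst
         (catrev w (a :: st dst))).
  by apply: runs_le h2 => /=; lia.
by apply: funext => r; rewrite /update; case: eqP => //; case: eqP.
Qed.

Definition mv2 src d1 d2 :=
  [:: WhileNonempty src (shift_top src (fun a => [:: Push d1 a; Push d2 a]))].

Lemma runs_mv2 src d1 d2 st : src <> d1 -> src <> d2 -> d1 <> d2 ->
  runs (mv2 src d1 d2) st (6 * size (st src)).+1
  (update (update (update st src [::]) d1 (catrev (st src) (st d1)))
     d2 (catrev (st src) (st d2))).
Proof.
move=> s1 s2 d12; move E: (st src) => w; elim: w st E => [|a w IH] st E.
  by rewrite update_nil // !update_id; apply: runs_while0.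
have h : st src <> [::] by rewrite E.
have h1 : runs (shift_top src (fun a => [:: Push d1 a; Push d2 a])) st 5
    (update (update (update st src w) d1 (a :: st d1)) d2 (a :: st d2)).
  apply: runs_shift_top E _.
  apply: (runs_cat (c1 := [:: _]) (T1 := 1) (T2 := 1)).
    exact: runs_push.
  have := runs_push d2 a (update (update st src w) d1 (a :: st d1)).
  by rewrite !(update_neq _ _ (r' := d1)) ?(update_neq _ _ (r' := d2)) //; congruence.
set st1 := update _ _ _ in h1.
have E1 : st1 src = w by rewrite /st1; do 2 rewrite update_neq //; rewrite updateE.
have := runs_whileS h h1 (IH st1 E1).
have e1 : st1 d1 = a :: st d1 by rewrite /st1 update_neq // updateE.
have e2 : st1 d2 = a :: st d2 by rewrite /st1 updateE.
rewrite e1 e2 => h2.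
rewrite (_ : update (update (update st src [::]) d1 _) d2 _ =
  update (update (update st1 src [::]) d1 (catrev w (a :: st d1))) d2
         (catrev w (a :: st d2))).
  by apply: runs_le h2 => /=; lia.
by apply: funext => r; rewrite /st1 /update; do !case: eqP => //.
Qed.

(** [mv] reverses a stack. The way back from [tmp] restores the order and can write the original and
    its duplicate at once. *)
Definition copy src dst tmp := mv src tmp ++ mv2 tmp src dst.

Lemma runs_copy src dst tmp st : src <> dst -> src <> tmp -> dst <> tmp ->
  st tmp = [::] -> st dst = [::] ->
  runs (copy src dst tmp) st (11 * size (st src) + 2) (update st dst (st src)).
Proof.
move=> sd stmp dt et ed.
have h1 := runs_mv st stmp.
set st1 := update _ _ _ in h1.
have h2 := runs_mv2 st1 (nesym stmp) (nesym dt) sd.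
have e1 : st1 tmp = rev (st src) by rewrite /st1 updateE et.
have e2 : st1 src = [::] by rewrite /st1 update_neq // updateE.
have e3 : st1 dst = [::] by rewrite /st1 !update_neq //; congruence.
rewrite e1 e2 e3 size_rev -/(rev _) revK in h2.
rewrite (_ : update st dst (st src) = update (update (update st1 tmp [::]) src (st src))
  dst (st src)); last first.
  apply: funext => r; rewrite /st1 /update; do !case: eqP => //; congruence.
by apply: runs_le (runs_cat h1 h2); lia.
Qed.

End Runs.

(** * Polynomial bounds and polynomial-time functions of an environment *)

Notation env := (nat -> W).

Section PolyBound.
Implicit Types (s t : env -> nat) (e : env).

Definition sumsize n e := \sum_(i < n) size (e i).

(** Only finitely many entries of the environment may count. With one number as both summand and
    exponent, two bounds are merged by enlarging the constants. *)
Definition PB t := exists n c, forall e, t e <= (sumsize n e + c) ^ c.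

Lemma leq_sumsize n n' e : n <= n' -> sumsize n e <= sumsize n' e.
Proof.
move=> nn; rewrite /sumsize -(big_mkord xpredT (fun i => size (e i))).
rewrite -(big_mkord xpredT (fun i => size (e i))) (big_cat_nat _ nn) //.
exact: leq_addr.
Qed.

Lemma PB_le t s : (forall e, t e <= s e) -> PB s -> PB t.
Proof. by move=> ts [n [c h]]; exists n, c => e; apply: leq_trans (ts e) (h e). Qed.

Lemma leq_pow2 x y c c' : x <= y -> c <= c' -> 0 < y -> x ^ c <= y ^ c'.
Proof.
move=> xy; case: c => [|c] cc y0; first by rewrite expn0 expn_gt0 y0.
by apply: (@leq_trans (y ^ c.+1)); rewrite ?leq_exp2r ?leq_pexp2l.
Qed.

Lemma PB_const k : PB (fun=> k).
Proof.
exists 0, k.+1 => e; apply: (@leq_trans k.+1) => //.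
by apply: (@leq_trans ((sumsize 0 e + k.+1) ^ 1)); [rewrite expn1 leq_addl
  | rewrite leq_pexp2l // addnS].
Qed.

Lemma PB_var i : PB (fun e => size (e i)).
Proof.
exists i.+1, 1 => e; rewrite expn1; apply: leq_trans (leq_addr _ _).
by rewrite /sumsize (bigD1 ord_max) //= leq_addr.
Qed.

Lemma PB_mul s t : PB s -> PB t -> PB (fun e => s e * t e).
Proof.
move=> [n [c h]] [n' [c' h']]; exists (n + n'), (c + c').+1 => e.
set y := sumsize _ _ + _.
apply: (@leq_trans (y ^ (c + c'))); last by rewrite leq_pexp2l // /y addnS.
rewrite expnD leq_mul //.
  apply: leq_trans (h e) _; apply: leq_pow2 => //; last by rewrite /y addnS.
  by rewrite leq_add ?leq_sumsize ?leq_addr //; lia.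
apply: leq_trans (h' e) _; apply: leq_pow2 => //; last by rewrite /y addnS.
by rewrite leq_add ?leq_sumsize ?leq_addl //; lia.
Qed.

Lemma PB_add s t : PB s -> PB t -> PB (fun e => s e + t e).
Proof.
move=> hs ht; apply: (@PB_le _ (fun e => (s e + 1) * (t e + 1))) => [e|]; first by nia.
have h1 u : PB u -> PB (fun e => u e + 1).
  move=> [n [c h]]; exists n, c.+2 => e; rewrite addn1.
  apply: leq_ltn_trans (h e) _.
  apply: (@leq_ltn_trans ((sumsize n e + c.+2) ^ c)).
    by apply: leq_pow2 => //; rewrite ?addnS // ltnW // ltnW.
  by rewrite ltn_exp2l // !addnS.
by apply: PB_mul; apply: h1.
Qed.

End PolyBound.

Section PolyBound2.
Implicit Types (s t : env -> nat) (e : env).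

Lemma PB_sum (s : nat -> env -> nat) n : (forall i, PB (s i)) ->
  PB (fun e => \sum_(i < n) s i e).
Proof.
move=> h; elim: n => [|n IH].
  by apply: PB_le (PB_const 0) => e; rewrite big_ord0.
by apply: PB_le (PB_add IH (h n)) => e; rewrite big_ord_recr.
Qed.

Lemma PB_exp s n : PB s -> PB (fun e => s e ^ n).
Proof.
move=> h; elim: n => [|n IH]; first exact: PB_const.
by apply: PB_le (PB_mul h IH) => e; rewrite expnS.
Qed.

Lemma PB_subst t (g : nat -> env -> W) : PB t -> (forall i, PB (fun e => size (g i e))) ->
  PB (fun e => t (fun i => g i e)).
Proof.
move=> [n [c h]] hg; apply: PB_le (fun e => h (fun i => g i e)) _.
by apply/PB_exp/PB_add/PB_const; apply: (@PB_sum (fun i e => size (g i e))).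
Qed.

End PolyBound2.

Section PT.
Implicit Types (st : store) (w : W) (e : env) (f g : env -> W).

Definition regs (rs : nat -> nat) st : env := fun i => st (rs i).

(* The environment is held in the stacks [rs i]; those from [b] on are free. *)
Definition computes (code : (nat -> nat) -> nat -> seq instr)
    (t : env -> nat) (F : env -> store -> nat -> store) :=
  forall rs b st, (forall i, rs i < b) -> (forall r, b <= r -> st r = [::]) ->
  runs (code rs b) st (t (regs rs st)) (F (regs rs st) st b).

(** The length of the value is bounded as part of the notion, because it enters the running time of
    whatever is applied to it next. The value goes to stack b and every other stack is restored. *)
Definition PT f := PB (fun e => size (f e)) /\
  exists code t, PB t /\ computes code t (fun e st b => update st b (f e)).

Lemma eq_PT f g : f =1 g -> PT f -> PT g.
Proof. by move=> /funext ->. Qed.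

Lemma regs_update rs st b w : (forall i, rs i < b) ->
  regs rs (update st b w) = regs rs st.
Proof.
by move=> h; apply: funext => i; rewrite /regs update_neq // => E; have := h i;
  rewrite E ltnn.
Qed.

Lemma PT_var i : PT (fun e => e i).
Proof.
split; first exact: PB_var.
exists (fun rs b => copy (rs i) b b.+1), (fun e => 11 * size (e i) + 2); split.
  by apply/PB_add/PB_const/PB_mul/PB_var/PB_const.
by move=> rs b st h he; apply: runs_copy; rewrite ?he //; have := h i; lia.
Qed.

Lemma PT_nil : PT (fun=> [::]).
Proof.
split; first exact: PB_const.
exists (fun _ _ => [::]), (fun=> 0); split; first exact: PB_const.
by move=> rs b st h he; rewrite update_nil ?he //; apply: runs_nil.
Qed.

Lemma PT_cons a f : PT f -> PT (fun e => a :: f e).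
Proof.
move=> [sf [c [t [ht hc]]]]; split.
  by apply: PB_le (PB_add sf (PB_const 1)) => e /=; rewrite addn1.
exists (fun rs b => c rs b ++ [:: Push b a]), (fun e => t e + 1); split.
  exact/PB_add/PB_const.
move=> rs b st h he; apply: runs_cat (hc rs b st h he) _.
have := runs_push b a (update st b (f (regs rs st))).
by rewrite updateE update_update.
Qed.

Lemma PT_behead f : PT f -> PT (fun e => behead (f e)).
Proof.
move=> [sf [c [t [ht hc]]]]; split.
  by apply: PB_le sf => e; rewrite size_behead leq_pred.
exists (fun rs b => c rs b ++ [:: Pop b]), (fun e => t e + 1); split.
  exact/PB_add/PB_const.
move=> rs b st h he; apply: runs_cat (hc rs b st h he) _.
have := runs_pop b (update st b (f (regs rs st))).
by rewrite updateE update_update.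
Qed.

Lemma PT_if a f g1 g2 : PT f -> PT g1 -> PT g2 ->
  PT (fun e => if ohead (f e) == Some a then g1 e else g2 e).
Proof.
move=> [sf [c [t [ht hc]]]] [s1 [c1 [t1 [ht1 hc1]]]] [s2 [c2 [t2 [ht2 hc2]]]].
split.
  by apply: PB_le (PB_add s1 s2) => e; case: ifP; rewrite ?leq_addr ?leq_addl.
exists (fun rs b => c rs b ++ [:: IfTop b a (clear b ++ c1 rs b) (clear b ++ c2 rs b)]),
  (fun e => t e + ((2 * size (f e)).+1 + (t1 e + t2 e)).+1); split.
  apply: PB_add => //; apply: PB_le (PB_add (PB_add (PB_mul (PB_const 2) sf) (PB_const 2))
    (PB_add ht1 ht2)) => e; lia.
move=> rs b st h he; apply: runs_cat (hc rs b st h he) _.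
apply: runs_if; rewrite updateE.
have hclear := runs_clear b (update st b (f (regs rs st))).
rewrite updateE update_update update_nil ?he // in hclear.
by case: ifP => _; apply: runs_cat hclear _; [apply: runs_le (hc1 rs b st h he) |
  apply: runs_le (hc2 rs b st h he)]; rewrite ?leq_addr ?leq_addl.
Qed.

(** Renaming variables costs no time: only the assignment of stacks to variables changes, which is
    the reason for the parameter [rs]. *)
Lemma PT_ren f (rho : nat -> nat) : PT f -> PT (fun e => f (fun i => e (rho i))).
Proof.
move=> [sf [c [t [ht hc]]]]; split.
  by apply: (PB_subst (t := fun e => size (f e))) => // i; apply: PB_var.
exists (fun rs => c (fun i => rs (rho i))), (fun e => t (fun i => e (rho i))); split.
  by apply: PB_subst => // i; apply: PB_var.
by move=> rs b st h he; apply: hc.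
Qed.

Definition upds st b (ws : seq W) : store :=
  fun r => if b <= r < b + size ws then nth [::] ws (r - b) else st r.

Lemma upds_nil st b : upds st b [::] = st.
Proof. by apply: funext => r; rewrite /upds addn0; case: ifP => //; lia. Qed.

Lemma upds_cons st b w ws : upds (update st b w) b.+1 ws = upds st b (w :: ws).
Proof.
apply: funext => r; rewrite /upds /update /=.
have [->|/eqP rb] := eqVneq r b.
  by rewrite ltnn leqnn addnS leq_addr subnn.
case: ifP => [h|h]; last by case: ifP => //; lia.
by rewrite ifT; [rewrite (_ : r - b = (r - b.+1).+1) //; lia | lia].
Qed.

Fixpoint PTs (fs : seq (env -> W)) : Prop :=
  if fs is f :: fs' then PT f /\ PTs fs' else True.

Definition evals (fs : seq (env -> W)) e : seq W := [seq f e | f <- fs].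

Lemma PTs_code fs : PTs fs -> exists code t, PB t /\
  computes code t (fun e st b => upds st b (evals fs e)).
Proof.
elim: fs => [|f fs IH] /=.
  move=> _; exists (fun _ _ => [::]), (fun=> 0); split; first exact: PB_const.
  by move=> rs b st h he; rewrite upds_nil; apply: runs_nil.
move=> [[sf [c [t [ht hc]]]] /IH[c' [t' [ht' hc']]]].
exists (fun rs b => c rs b ++ c' rs b.+1), (fun e => t e + t' e); split.
  exact: PB_add.
move=> rs b st h he; apply: runs_cat (hc rs b st h he) _.
have h' i : rs i < b.+1 by rewrite ltnW ?ltnS.
have he' r : b < r -> update st b (f (regs rs st)) r = [::].
  by move=> br; rewrite update_neq ?he //; lia.
by have := hc' _ _ _ h' he'; rewrite regs_update // upds_cons.
Qed.

(** Replaces the state of a loop by its successor. Each stack goes through [tmp] to keep its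
    order. *)
Fixpoint mvs src dst tmp k : seq instr :=
  if k is k'.+1 then
    clear dst ++ mv src tmp ++ mv tmp dst ++ mvs src.+1 dst.+1 tmp k'
  else [::].

Lemma runs_mvs src dst tmp k st B : dst + k <= src -> src + k <= tmp ->
  st tmp = [::] -> (forall r, dst <= r < src + k -> size (st r) <= B) ->
  runs (mvs src dst tmp k) st (k * (12 * B + 3)) (fun r =>
    if dst <= r < dst + k then st (src + (r - dst)) else
    if src <= r < src + k then [::] else st r).
Proof.
elim: k src dst st => [|k IH] src dst st ds sk et hB.
  rewrite (_ : (fun r => _) = st); first exact: runs_nil.
  by apply: funext => r; rewrite !addn0; do 2 (case: ifP; first lia).
have r1 := runs_clear dst st; set st1 := update _ _ _ in r1.
have srctmp : src <> tmp by lia.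
have r2 := runs_mv st1 srctmp.
have e1 : st1 src = st src by rewrite /st1 update_neq //; lia.
have e2 : st1 tmp = [::] by rewrite /st1 update_neq //; lia.
rewrite e1 e2 in r2; set st2 := update _ _ _ in r2.
have tmpdst : tmp <> dst by lia.
have r3 := runs_mv st2 tmpdst.
have e3 : st2 tmp = rev (st src) by rewrite /st2 updateE.
have e4 : st2 dst = [::].
  by rewrite /st2; do 2 (rewrite update_neq; last lia); rewrite /st1 updateE.
rewrite e3 e4 size_rev -/(rev _) revK in r3; set st3 := update _ _ _ in r3.
have e5 r : st3 r = if r == dst then st src else if r == src then [::] else st r.
  rewrite /st3 /st2 /st1 /update; do !case: eqP => //; move=> *; subst; rewrite ?et //; lia.
have r4 := IH src.+1 dst.+1 st3; rewrite e5 in r4.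
have h1 := runs_cat r1 (runs_cat r2 (runs_cat r3 (r4 _ _ _ _))).
rewrite (_ : (fun r => _) = (fun r => if dst.+1 <= r < dst.+1 + k
  then st3 (src.+1 + (r - dst.+1)) else if src.+1 <= r < src.+1 + k then [::] else st3 r)).
  apply: (runs_le _ (h1 _ _ _ _)); [|lia..| |].
  - have := hB dst; have := hB src; lia.
  - by do 2 (case: eqP; first lia).
  - move=> r hr; rewrite e5; case: ifP => _; first by apply: hB; lia.
    by case: ifP => // _; apply: hB; lia.
apply: funext => r; rewrite !e5.
have [->|/eqP rd] := eqVneq r dst.
  rewrite leqnn ltnn /= addnS ltnS leq_addr subnn addn0.
  by rewrite ifF //; lia.
have [->|/eqP rs] := eqVneq r src.
  rewrite ifF; last lia; rewrite ifT; last lia.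
  by do 2 (rewrite ifF; last lia).
case: ifP => h2; first (rewrite ifT; last lia).
  rewrite (_ : src + (r - dst) = src.+1 + (r - dst.+1)); last lia.
  by do 2 (rewrite ifF; last lia).
rewrite (_ : (dst < r < dst.+1 + k) = false); last lia.
by congr (if _ then _ else _); lia.
Qed.

Fixpoint clears b k : seq instr :=
  if k is k'.+1 then clear b ++ clears b.+1 k' else [::].

Lemma runs_clears b k st B : (forall r, b <= r < b + k -> size (st r) <= B) ->
  runs (clears b k) st (k * (2 * B).+1)
    (fun r => if b <= r < b + k then [::] else st r).
Proof.
elim: k b st => [|k IH] b st hB.
  rewrite (_ : (fun r => _) = st); first exact: runs_nil.
  by apply: funext => r; rewrite addn0; case: ifP; first lia.
have hB1 r : b.+1 <= r < b.+1 + k -> size (update st b [::] r) <= B.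
  by move=> hr; rewrite /update; case: eqP => // _; apply: hB; lia.
have := runs_cat (runs_clear b st) (IH b.+1 _ hB1).
rewrite (_ : (fun r => _) = (fun r => if b <= r < b + k.+1 then [::] else st r)).
  by apply: runs_le; have := hB b; nia.
apply: funext => r; rewrite /update; have [->|/eqP rb] := eqVneq r b.
  by rewrite ltnn leqnn addnS ltnS leq_addr.
by congr (if _ then _ else _); lia.
Qed.

End PT.

(** * Loops over the symbols of a string *)

Section Loop.
Implicit Types (st : store) (w : W) (e : env) (ws : seq W).

Definition cats ws e : env :=
  fun i => if i < size ws then nth [::] ws i else e (i - size ws).

Definition stepS (Gs : seq (env -> W)) e ws := evals Gs (cats ws e).

Lemma PB_cats (t s : env -> nat) : PB t -> PB s -> exists2 u, PB u &
  forall e ws, (forall w, w \in ws -> size w <= s e) -> t (cats ws e) <= u e.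
Proof.
move=> [n [c h]] hs; exists (fun e => (n * (s e + sumsize n e) + c.+1) ^ c).
  apply/PB_exp/PB_add/PB_const/PB_mul/PB_add => //; first exact: PB_const.
  by apply: (@PB_sum (fun i e => size (e i))) => i; apply: PB_var.
move=> e ws hw; apply: leq_trans (h _) _.
apply: leq_pow2; rewrite ?addnS // ltnW // ltnS leq_add2r. rewrite [leqRHS](_ : _ = \sum_(i < n) (s e + sumsize n e)).
  apply: leq_sum => i _; rewrite /cats; case: ifP => iw.
    by apply: leq_trans (hw _ (mem_nth _ iw)) (leq_addr _ _).
  have hi : i - size ws < n by apply: leq_ltn_trans (leq_subr _ _) (ltn_ord i).
  rewrite (leq_trans _ (leq_addl _ _)) // /sumsize (bigD1 (Ordinal hi)) //=.
  exact: leq_addr.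
by rewrite sum_nat_const card_ord.
Qed.

Variables (Gs Is : seq (env -> W)) (x : env -> W) (s : env -> nat).
Hypothesis (GI : size Gs = size Is) (hG : PTs Gs) (hI : PTs Is) (hx : PT x).
Hypothesis (hs : PB s).
Hypothesis hbound : forall e i w, i <= size (x e) ->
  w \in iter i (stepS Gs e) (evals Is e) -> size w <= s e.

Let k := size Is.

Lemma size_iter_stepS e i : size (iter i (stepS Gs e) (evals Is e)) = k.
Proof. by case: i => [|i] /=; rewrite size_map. Qed.

Lemma regs_upds rs st b ws : (forall i, rs i < b) ->
  regs rs (upds st b ws) = regs rs st.
Proof.
move=> h; apply: funext => i; rewrite /regs /upds ifF //.
by apply/negbTE; rewrite leqNgt h.
Qed.

Definition loop_regs rs b := fun i => if i < k then b + i else rs (i - k).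

Lemma regs_loop rs st b ws w : (forall i, rs i < b) -> size ws = k ->
  regs (loop_regs rs b) (update (upds st b ws) (b + k) w) = cats ws (regs rs st).
Proof.
move=> h sw; apply: funext => i; rewrite /regs /loop_regs /cats sw.
case: ifP => ik; rewrite update_neq; [|lia| |have := h (i - k); lia].
  by rewrite /upds sw ifT; [congr nth|]; lia.
by rewrite /upds ifF //; have := h (i - k); lia.
Qed.

(** Limited recursion on notation, with k values updated simultaneously. The bound [hbound] on all
    intermediate states rules out exponential growth by repeated doubling. *)
Lemma PT_loop : 0 < k ->
  PT (fun e => nth [::] (iter (size (x e)) (stepS Gs e) (evals Is e)) 0).
Proof.
move=> k0.
have nth_bound e i j : i <= size (x e) ->
    size (nth [::] (iter i (stepS Gs e) (evals Is e)) j) <= s e.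
  move=> ix; have [js|js] := ltnP j (size (iter i (stepS Gs e) (evals Is e))).
    exact/(hbound ix)/mem_nth.
  by rewrite nth_default.
split; first by apply: PB_le hs => e; apply: nth_bound.
have [cG [tG [htG hcG]]] := PTs_code hG.
have [cI [tI [htI hcI]]] := PTs_code hI.
have [sx [cx [tx [htx hcx]]]] := hx.
have [u hu tGu] := PB_cats htG hs.
(* Stacks b to b + k - 1 hold the state, and b + k the symbols still to be read. The new state is
   computed above them from the old one and moved down, with the stack after it as scratch space. *)
pose body rs b := Pop (b + k) :: cG (loop_regs rs b) (b + k).+1 ++
  mvs (b + k).+1 b (b + k + k).+1 k.
exists (fun rs b => cI rs b ++ cx rs (b + k) ++
  [:: WhileNonempty (b + k) (body rs b)] ++ clears b.+1 k.-1).
pose T1 e := (1 + (u e + k * (12 * (s e + size (x e)) + 3))).+1.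
exists (fun e => tI e + (tx e + ((size (x e) * T1 e).+1 +
   k * (2 * (s e)).+1))); split.
  have ht1 : PB T1.
    apply: (@PB_le _ (fun e => 2 + (u e + k * (12 * (s e + size (x e)) + 3)))) => [e|].
      by rewrite /T1; lia.
    apply/PB_add/PB_add/PB_mul/PB_add/PB_const/PB_mul/PB_add => //; exact: PB_const.
  do 2 (apply: PB_add => //); apply: PB_add.
    apply: (@PB_le _ (fun e => size (x e) * T1 e + 1)) => [e|]; first by rewrite addn1.
    by apply/PB_add/PB_const/PB_mul.
  apply: (@PB_le _ (fun e => k * (2 * s e + 1))) => [e|]; first by rewrite addn1.
  by apply/PB_mul/PB_add/PB_const/PB_mul => //; apply: PB_const.
move=> rs b st h he; set E := regs rs st.
pose it i := iter i (stepS Gs E) (evals Is E).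
have sit i : size (it i) = k by apply: size_iter_stepS.
have fresh ws r : size ws = k -> b + k <= r -> upds st b ws r = [::].
  by move=> sw br; rewrite /upds ifF; [apply: he; lia | lia].
apply: runs_cat (hcI rs b st h he) _; rewrite -/E -/(it 0).
have h' i : rs i < b + k by apply: leq_trans (h i) (leq_addr _ _).
have rx := hcx rs (b + k) (upds st b (it 0)) h' (fun r => fresh _ r (sit 0)).
rewrite regs_upds // -/E in rx; apply: runs_cat rx _.
pose S i w := update (upds st b (it i)) (b + k) w.
have rbody i a w : i < size (x E) -> size (a :: w) <= size (x E) ->
    runs (body rs b) (S i (a :: w)) (T1 E).-1 (S i.+1 w).
  move=> ix aw.
  have r1 := runs_pop (b + k) (S i (a :: w)).
  rewrite /S updateE update_update /= in r1.
  have r2 := hcG (loop_regs rs b) (b + k).+1 (S i w) _ _.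
  rewrite regs_loop // -/E in r2.
  have itw j v : j <= size (x E) -> v \in it j -> size v <= s E by apply: hbound.
  have {}r2 : runs (cG (loop_regs rs b) (b + k).+1) (S i w) (u E)
      (upds (S i w) (b + k).+1 (it i.+1)).
    apply: runs_le (r2 _ _).
    - by apply: tGu => v; apply: itw; apply: ltnW.
    - by move=> j; rewrite /loop_regs; case: ifP => [|_]; [lia|have := h' (j - k); lia].
    move=> r br; rewrite /S update_neq; last lia.
    by apply: fresh => //; lia.
  apply: (runs_cat (c1 := [:: _]) r1); apply: (runs_cat r2).
  have nthit j l : j <= size (x E) -> size (nth [::] (it j) l) <= s E.
    exact: nth_bound.
  have r3 := @runs_mvs (b + k).+1 b (b + k + k).+1 k
    (upds (S i w) (b + k).+1 (it i.+1)) (s E + size (x E)) _ _ _ _.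
  rewrite [S i.+1 w](_ : _ = (fun r => if b <= r < b + k
    then upds (S i w) (b + k).+1 (it i.+1) ((b + k).+1 + (r - b))
    else if (b + k).+1 <= r < (b + k).+1 + k then [::]
    else upds (S i w) (b + k).+1 (it i.+1) r)).
    apply: r3; rewrite ?leqnSn //.
    - by rewrite /upds ifF; [rewrite /S update_neq; [apply: fresh; rewrite ?sit|] |]; rewrite ?sit; lia.
    move=> r hr; rewrite /upds; case: ifP => _.
      by apply: leq_trans (nthit _ _ ix) (leq_addr _ _).
    rewrite /S /update; case: eqP => _.
      by apply: leq_trans (leq_addl _ _); apply: leq_trans aw => /=.
    rewrite /upds; case: ifP => _.
      by apply: leq_trans (nthit _ _ (ltnW ix)) (leq_addr _ _).
    by rewrite he //; lia.
  apply: funext => r; rewrite /upds !sit.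
  case: ifP => h1.
    rewrite ifT; last lia.
    rewrite /S update_neq /upds ?sit ?h1; last lia.
    by congr nth; lia.
  case: ifP => h2.
    by rewrite /S update_neq; [apply: fresh; rewrite ?sit; lia | lia].
  have key j : upds st b (it j) r = st r by rewrite /upds sit h1.
  rewrite [RHS]ifF; last lia.
  by rewrite /S /update; case: eqP => // _; rewrite !key.
have rloop w i : i + size w = size (x E) ->
    runs [:: WhileNonempty (b + k) (body rs b)] (S i w) (size w * T1 E).+1
      (S (size (x E)) [::]).
  elim: w i => [|a w IH] i /= iw.
    rewrite addn0 in iw; rewrite mul0n iw; apply: runs_while0.
    by rewrite /S updateE.
  have r1 := rbody i a w _ _; have r2 := IH i.+1 _.
  have := @runs_whileS (b + k) (body rs b) (S i (a :: w)) _ _ _ _ _ (r1 _ _) (r2 _).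
  move=> r; apply: runs_le (r _ _ _ _) => //=; try lia.
    by rewrite mulSn /T1; lia.
  by rewrite /S updateE.
apply: runs_cat (rloop (x E) 0 _) _; first by rewrite add0n.
rewrite -/(it (size (x E))); set n := size (x E).
have := @runs_clears b.+1 k.-1 (S n [::]) (s E) _.
rewrite (_ : (fun r => _) = update st b (nth [::] (it n) 0)).
  move=> r; apply: runs_le (r _) => [|r' hr].
    by rewrite leq_mul // leq_pred.
  rewrite /S update_neq; last lia.
  by rewrite /upds; case: ifP => _; [apply: nth_bound | rewrite he //; lia].
apply: funext => r; rewrite /S /update /upds sit.
case: eqP => [->|rk].
  case: eqP => [|_]; first lia.
  by rewrite he ?leq_addr // if_same.
case: eqP => [->|rb].
  by rewrite ifF; [rewrite ifT ?subnn //; lia | lia].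
case: ifP => h1; first by rewrite he //; lia.
by rewrite ifF //; lia.
Qed.

End Loop.

(** * Closure properties, and a library of functions on strings *)

Section Combinators.
Implicit Types (w u v : W) (e : env).

Lemma PT_const w : PT (fun=> w).
Proof. by elim: w => [|a w IH]; [exact: PT_nil | exact: PT_cons]. Qed.

Definition tt w := ohead w == Some (Some true).

Definition PTB (b : env -> bool) :=
  PT (fun e => if b e then [:: Some true] else [::]).

Lemma PT_ifb b f g : PTB b -> PT f -> PT g ->
  PT (fun e => if b e then f e else g e).
Proof.
move=> hb hf hg; apply: eq_PT (PT_if (Some true) hb hf hg) => e.
by case: (b e).
Qed.

Lemma PTB_head a f : PT f -> PTB (fun e => ohead (f e) == Some a).
Proof. by move=> hf; apply: PT_if => //; apply: PT_const. Qed.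

Lemma PTB_tt f : PT f -> PTB (fun e => tt (f e)).
Proof. exact: PTB_head. Qed.

Lemma PTB_const b : PTB (fun=> b).
Proof. by rewrite /PTB; case: b; apply: PT_const. Qed.

Lemma PTB_not b : PTB b -> PTB (fun e => ~~ b e).
Proof.
move=> hb; apply: eq_PT (PT_ifb hb PT_nil (PT_const [:: Some true])) => e.
by case: (b e).
Qed.

Lemma PTB_if b c d : PTB b -> PTB c -> PTB d ->
  PTB (fun e => if b e then c e else d e).
Proof.
by move=> hb hc hd; apply: eq_PT (PT_ifb hb hc hd) => e; case: (b e).
Qed.

Lemma PTB_and b c : PTB b -> PTB c -> PTB (fun e => b e && c e).
Proof. by move=> hb hc; apply: (PTB_if hb hc); apply: PTB_const. Qed.

Lemma PTB_or b c : PTB b -> PTB c -> PTB (fun e => b e || c e).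
Proof. by move=> hb hc; apply: (PTB_if hb _ hc); apply: PTB_const. Qed.

Lemma eq_PTB b c : b =1 c -> PTB b -> PTB c.
Proof. by move=> /funext ->. Qed.

Lemma PTB_nilp f : PT f -> PTB (fun e => nilp (f e)).
Proof.
move=> hf; apply: eq_PTB (PTB_not (PTB_or (PTB_head (Some true) hf)
  (PTB_or (PTB_head (Some false) hf) (PTB_head None hf)))) => e.
by case: (f e) => [|[[]|] w].
Qed.

Definition pushhd u v := if ohead u is Some a then a :: v else v.

Lemma PT_pushhd f g : PT f -> PT g -> PT (fun e => pushhd (f e) (g e)).
Proof.
move=> hf hg; apply: eq_PT (PT_if (Some true) hf (PT_cons (Some true) hg)
  (PT_if (Some false) hf (PT_cons (Some false) hg)
  (PT_if None hf (PT_cons None hg) hg))) => e.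
by rewrite /pushhd; case: (f e) => [|[[]|] w].
Qed.

Definition fold3 (g1 g2 g3 : symbol -> W -> W -> W -> W) i1 i2 i3 (x : W) :=
  foldl (fun p a => (g1 a p.1.1 p.1.2 p.2, g2 a p.1.1 p.1.2 p.2,
                     g3 a p.1.1 p.1.2 p.2)) (i1, i2, i3) x.

Definition fold2 (g1 g2 : symbol -> W -> W -> W) i1 i2 (x : W) :=
  foldl (fun p a => (g1 a p.1 p.2, g2 a p.1 p.2)) (i1, i2) x.

Lemma fold3_rcons g1 g2 g3 i1 i2 i3 l a :
  fold3 g1 g2 g3 i1 i2 i3 (rcons l a) = let p := fold3 g1 g2 g3 i1 i2 i3 l in
  (g1 a p.1.1 p.1.2 p.2, g2 a p.1.1 p.1.2 p.2, g3 a p.1.1 p.1.2 p.2).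
Proof. by rewrite /fold3 foldl_rcons. Qed.

Lemma fold2_rcons g1 g2 i1 i2 l a :
  fold2 g1 g2 i1 i2 (rcons l a) = let p := fold2 g1 g2 i1 i2 l in
  (g1 a p.1 p.2, g2 a p.1 p.2).
Proof. by rewrite /fold2 foldl_rcons. Qed.

(** The unread part of x is a fourth loop variable, in position 3; [rho] steps over it. As the
    symbol is a parameter of the step functions and not a variable, [lift] selects among their three
    instances. *)
Lemma PT_fold3 (G1 G2 G3 : env -> symbol -> W -> W -> W -> W)
    (i1 i2 i3 x : env -> W) (s : env -> nat) :
  (forall a, PT (fun e => G1 (fun i => e i.+3) a (e 0) (e 1) (e 2))) ->
  (forall a, PT (fun e => G2 (fun i => e i.+3) a (e 0) (e 1) (e 2))) ->
  (forall a, PT (fun e => G3 (fun i => e i.+3) a (e 0) (e 1) (e 2))) ->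
  PT i1 -> PT i2 -> PT i3 -> PT x -> PB s ->
  (forall e l, size l <= size (x e) ->
     let r := fold3 (G1 e) (G2 e) (G3 e) (i1 e) (i2 e) (i3 e) l in
     [/\ size r.1.1 <= s e, size r.1.2 <= s e & size r.2 <= s e]) ->
  PT (fun e => (fold3 (G1 e) (G2 e) (G3 e) (i1 e) (i2 e) (i3 e) (x e)).1.1).
Proof.
move=> h1 h2 h3 hi1 hi2 hi3 hx hs hb.
pose rho i := if i < 3 then i else i.+1.
pose lift (G : env -> symbol -> W -> W -> W -> W) (e : env) :=
  let e' := fun i => e (rho i) in
  let r a := G (fun i => e' i.+3) a (e' 0) (e' 1) (e' 2) in
  if ohead (e 3) == Some (Some true) then r (Some true) else
  if ohead (e 3) == Some (Some false) then r (Some false) else r None.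
have hl G : (forall a, PT (fun e => G (fun i => e i.+3) a (e 0) (e 1) (e 2))) ->
    PT (lift G).
  move=> h; apply: PT_if; first exact: PT_var.
    exact: (PT_ren rho (h (Some true))).
  apply: PT_if; first exact: PT_var.
    exact: (PT_ren rho (h (Some false))).
  exact: (PT_ren rho (h None)).
pose Gs := [:: lift G1; lift G2; lift G3; fun e => behead (e 3)].
pose Is := [:: i1; i2; i3; x].
pose r e l := fold3 (G1 e) (G2 e) (G3 e) (i1 e) (i2 e) (i3 e) l.
have E e i : i <= size (x e) -> iter i (stepS Gs e) (evals Is e) =
    [:: (r e (take i (x e))).1.1; (r e (take i (x e))).1.2; (r e (take i (x e))).2;
        drop i (x e)].
  elim: i => [|i IH] ix; first by rewrite take0 drop0.
  have liftE G u v w a z : lift G (cats [:: u; v; w; a :: z] e) = G e a u v w.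
    rewrite /lift /=.
    have -> : (fun i => cats [:: u; v; w; a :: z] e (rho i.+3)) = e.
      by apply: funext => l; rewrite /cats /rho /=; congr e; lia.
    by rewrite /cats /=; case: a => [[]|].
  rewrite iterS IH 1?ltnW // (drop_nth None) // (take_nth None) //.
  by rewrite /r fold3_rcons /stepS /evals /Gs [LHS]/= !liftE.
have hGs : PTs Gs by do 3 (split; first exact: hl); split=> //; apply/PT_behead/PT_var.
have hIs : PTs Is by [].
apply: (@eq_PT _ _ _ (@PT_loop Gs Is x (fun e => s e + size (x e)) erefl hGs hIs hx _ _ _)) => //.
- by move=> e; rewrite E // take_size.
- by apply: PB_add => //; case: hx.
move=> e i w ix; rewrite E // !inE => hw.
have [|b1 b2 b3] := hb e (take i (x e)); first by rewrite size_take; case: ifP => //; lia.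
case/or4P: hw => /eqP->; [move: b1 | move: b2 | move: b3 |]; rewrite -?/(r _ _).
1-3: by move=> h; apply: leq_trans h (leq_addr _ _).
by apply: leq_trans (leq_addl _ _); rewrite size_drop leq_subr.
Qed.

Lemma PT_fold2 (G1 G2 : env -> symbol -> W -> W -> W)
    (i1 i2 x : env -> W) (s : env -> nat) :
  (forall a, PT (fun e => G1 (fun i => e i.+2) a (e 0) (e 1))) ->
  (forall a, PT (fun e => G2 (fun i => e i.+2) a (e 0) (e 1))) ->
  PT i1 -> PT i2 -> PT x -> PB s ->
  (forall e l, size l <= size (x e) ->
     let r := fold2 (G1 e) (G2 e) (i1 e) (i2 e) l in
     size r.1 <= s e /\ size r.2 <= s e) ->
  PT (fun e => (fold2 (G1 e) (G2 e) (i1 e) (i2 e) (x e)).1).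
Proof.
move=> h1 h2 hi1 hi2 hx hs hb.
have E e l : (fold3 (fun a u v _ => G1 e a u v) (fun a u v _ => G2 e a u v)
    (fun _ _ _ _ => [::]) (i1 e) (i2 e) [::] l).1 =
    fold2 (G1 e) (G2 e) (i1 e) (i2 e) l /\
    (fold3 (fun a u v _ => G1 e a u v) (fun a u v _ => G2 e a u v)
    (fun _ _ _ _ => [::]) (i1 e) (i2 e) [::] l).2 = [::].
  elim/last_ind: l => [//|l a [IH1 IH2]].
  by rewrite fold3_rcons fold2_rcons /= IH1.
pose rho i := if i < 2 then i else i.+1.
apply: (@eq_PT _ _ _ (@PT_fold3 (fun e a u v _ => G1 e a u v)
  (fun e a u v _ => G2 e a u v) (fun _ _ _ _ _ => [::]) i1 i2 (fun=> [::]) x s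
  _ _ _ _ _ _ _ _ _)) => //.
- by move=> e; case: (E e (x e)) => ->.
- by move=> a; apply: (PT_ren rho (h1 a)).
- by move=> a; apply: (PT_ren rho (h2 a)).
- by move=> a; apply: PT_nil.
- exact: PT_nil.
move=> e l hl r; have [e1 e2] := E e l; have [b1 b2] := hb e l hl.
by rewrite /r e1 e2.
Qed.

Lemma PT_fold1 (G1 : env -> symbol -> W -> W) (i1 x : env -> W) (s : env -> nat) :
  (forall a, PT (fun e => G1 (fun i => e i.+1) a (e 0))) ->
  PT i1 -> PT x -> PB s ->
  (forall e l, size l <= size (x e) ->
     size (foldl (fun u a => G1 e a u) (i1 e) l) <= s e) ->
  PT (fun e => foldl (fun u a => G1 e a u) (i1 e) (x e)).
Proof.
move=> h1 hi1 hx hs hb.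
have E e l : fold2 (fun a u _ => G1 e a u) (fun _ _ _ => [::]) (i1 e) [::] l =
    (foldl (fun u a => G1 e a u) (i1 e) l, [::]).
  elim/last_ind: l => [//|l a IH].
  by rewrite fold2_rcons foldl_rcons /= IH.
pose rho i := if i < 1 then i else i.+1.
apply: (@eq_PT _ _ _ (@PT_fold2 (fun e a u _ => G1 e a u)
  (fun _ _ _ _ => [::]) i1 (fun=> [::]) x s _ _ _ _ _ _ _)) => //.
- by move=> e; rewrite E.
- by move=> a; apply: (PT_ren rho (h1 a)).
- by move=> a; apply: PT_nil.
- exact: PT_nil.
by move=> e l hl r; rewrite /r E; split => //; apply: hb.
Qed.

(** The passage to the format of [explicit]: the value is computed in a fresh stack and moved to
    stack 0 by two reversals. An input of at least two symbols allows additive constants to be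
    absorbed into a power of its size. *)
Lemma PT_program (f : W -> W -> W -> W -> W) :
  PT (fun e => f (e 0) (e 1) (e 2) (e 3)) ->
  exists (c : seq instr) (k : nat), forall ws : seq W, size ws = 4 ->
  1 < size (flatten ws) ->
  exists (t : nat) (st : store), [/\ halts_in c (nth [::] ws) t st,
     t <= size (flatten ws) ^ k + k &
     st 0 = f (nth [::] ws 0) (nth [::] ws 1) (nth [::] ws 2) (nth [::] ws 3)].
Proof.
move=> [[ns [cs hs]] [code [t [[n [c ht]] hc]]]].
(* All variables from 3 on refer to stack 3, so that the stacks from 4 on are free. *)
pose rs i := minn i 3.
exists (code rs 4 ++ clear 0 ++ mv 4 5 ++ mv 5 0).
exists ((n + c).+1 * c + ((ns + cs).+1 * cs + 15)) => ws sw S1.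
set st := nth [::] ws; set S := size (flatten ws).
have hS r : size (st r) <= S.
  rewrite /S /st; have [r4|r4] := ltnP r 4; last by rewrite nth_default ?sw.
  move: sw; do 4 (case: ws st S S1 => //= ? ws st S S1); case: ws st S S1 => // st S S1 _.
  by move: r4; do 4 (case: r => [_|r] /=; [rewrite !size_cat; lia|]).
have r1 := hc rs 4 st _ _; set E := regs rs st in r1.
have e4 : f (E 0) (E 1) (E 2) (E 3) = f (st 0) (st 1) (st 2) (st 3) by [].
rewrite e4 in r1; set y := f _ _ _ _ in e4 r1 *.
have hsum m k : (sumsize m E + k) ^ k <= S ^ ((m + k).+1 * k).
  rewrite expnM; case: k => [|k]; first by rewrite !expn0.
  rewrite leq_exp2r //; apply: (@leq_trans (S * m + k.+1)).
    rewrite leq_add2r mulnC; rewrite [leqRHS](_ : _ = \sum_(i < m) S); last first.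
      by rewrite sum_nat_const card_ord.
    by apply: leq_sum => i _; apply: hS.
  apply: (@leq_trans (S * (m + k.+1))); first by nia.
  by rewrite expnS leq_mul // ltnW // ltn_expl.
set st1 := update st 4 y in r1.
have st_4 r : 3 < r -> st r = [::] by move=> h; rewrite /st nth_default // sw.
have r2 := runs_clear 0 st1; set st2 := update _ _ _ in r2.
have n45 : 4 <> 5 by []; have r3 := runs_mv st2 n45.
have e4' : st2 4 = y by [].
have e5 : st2 5 = [::] by rewrite /st2 /st1 /update /= st_4.
rewrite e4' e5 in r3; set st3 := update _ _ _ in r3.
have n50 : 5 <> 0 by []; have r4 := runs_mv st3 n50.
have e5' : st3 5 = rev y by [].
have e0 : st3 0 = [::] by [].
rewrite e5' e0 size_rev -/(rev _) revK in r4.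
have hrs i : rs i < 4 by rewrite /rs; lia.
have [t' lt' ht'] := runs_cat (r1 hrs st_4) (runs_cat r2 (runs_cat r3 r4)).
eexists; eexists; split; first by have := ht' [::]; rewrite cats0; apply.
  apply: leq_trans lt' _.
  have y1 : size y <= S ^ ((ns + cs).+1 * cs) by apply: leq_trans (hs E) (hsum _ _).
  have t1 : t E <= S ^ ((n + c).+1 * c) by apply: leq_trans (ht E) (hsum _ _).
  have s0 := hS 0.
  have s01 : size (st1 0) = size (st 0) by [].
  rewrite s01.
  set A := _.+1 * c in t1 *; set B := _.+1 * cs in y1 *.
  have : S ^ A * S ^ B * S ^ 15 <= S ^ (A + (B + 15)) by rewrite (expnD S A) (expnD S B) mulnA.
  have A0 : 0 < S ^ A by rewrite expn_gt0; lia.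
  have B0 : 0 < S ^ B by rewrite expn_gt0; lia.
  have S15 : 2 ^ 13 * S <= S ^ 15.
    by rewrite (expnD S 14 1) expn1 leq_mul // (@leq_trans (2 ^ 14)) // leq_exp2r.
  move: (S ^ A) (S ^ B) (S ^ 15) A0 B0 S15 t1 y1 => a b d A0 B0 S15 t1 y1.
  have : a * b * (2 ^ 13 * S) <= a * b * d by rewrite leq_mul2l S15 orbT.
  have : a + b <= a * b + 1 by nia.
  rewrite (_ : 2 ^ 13 = 8192) //; nia.
by rewrite updateE.
Qed.

End Combinators.

Create HintDb pt.
#[export] Hint Resolve PT_var PT_const PT_nil PT_cons PT_behead PT_ifb PT_pushhd : pt.
#[export] Hint Resolve PTB_tt PTB_const PTB_not PTB_if PTB_and PTB_or PTB_nilp : pt.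
#[export] Hint Resolve PB_const PB_add PB_mul : pt.

Ltac pt := solve [auto 40 with pt].

Lemma PT_PB f : PT f -> PB (fun e => size (f e)).
Proof. by case. Qed.
#[export] Hint Resolve PT_PB : pt.

Lemma PT_rev f : PT f -> PT (fun e => rev (f e)).
Proof.
move=> hf.
have E x : foldl (fun u a => a :: u) [::] x = rev x.
  by elim/last_ind: x => // x a IH; rewrite foldl_rcons IH rev_rcons.
apply: (eq_PT (f := fun e => foldl (fun u a => a :: u) [::] (f e))) => [e|]; first by rewrite E.
apply: (@PT_fold1 (fun e a u => a :: u) (fun=> [::]) f (fun e => size (f e))) => //; try pt.
by move=> e l hl; rewrite E size_rev.
Qed.
#[export] Hint Resolve PT_rev : pt.

Lemma PT_cat f g : PT f -> PT g -> PT (fun e => f e ++ g e).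
Proof.
move=> hf hg.
have E x y : foldl (fun u a => a :: u) y x = rev x ++ y.
  by elim/last_ind: x => // x a IH; rewrite foldl_rcons IH rev_rcons.
apply: (eq_PT (f := fun e => foldl (fun u a => a :: u) (g e) (rev (f e)))) => [e|].
  by rewrite E revK.
apply: (@PT_fold1 (fun e a u => a :: u) g (fun e => rev (f e)) (fun e => size (f e) + size (g e))) => //; try pt.
by move=> e l; rewrite E size_cat !size_rev leq_add2r.
Qed.
#[export] Hint Resolve PT_cat : pt.

Lemma PT_nseq a f : PT f -> PT (fun e => nseq (size (f e)) a).
Proof.
move=> hf.
have E x : foldl (fun u _ => a :: u) [::] x = nseq (size x) a.
  by elim/last_ind: x => // x b IH; rewrite foldl_rcons IH size_rcons.
apply: (eq_PT (f := fun e => foldl (fun u _ => a :: u) [::] (f e))) => [e|]; first by rewrite E.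
apply: (@PT_fold1 (fun e _ u => a :: u) (fun=> [::]) f (fun e => size (f e))) => //; try pt.
by move=> e l; rewrite E size_nseq.
Qed.
#[export] Hint Resolve PT_nseq : pt.

Lemma PT_drop f g : PT f -> PT g -> PT (fun e => drop (size (f e)) (g e)).
Proof.
move=> hf hg.
have E x y : foldl (fun u (_ : symbol) => behead u) y x = drop (size x) y.
  elim/last_ind: x => [|x b IH]; first by rewrite drop0.
  by rewrite foldl_rcons IH size_rcons -drop1 drop_drop add1n.
apply: (eq_PT (f := fun e => foldl (fun u _ => behead u) (g e) (f e))) => [e|]; first by rewrite E.
apply: (@PT_fold1 (fun e _ u => behead u) g f (fun e => size (g e))) => //; try pt.
by move=> e l; rewrite E size_drop leq_subr.
Qed.
#[export] Hint Resolve PT_drop : pt.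

Lemma PT_take f g : PT f -> PT g -> PT (fun e => take (size (f e)) (g e)).
Proof.
move=> hf hg.
have E x y : fold2 (fun _ u v => pushhd v u) (fun _ _ v => behead v) [::] y x =
    (rev (take (size x) y), drop (size x) y).
  elim/last_ind: x => [|x b IH]; first by rewrite take0 drop0.
  rewrite fold2_rcons IH /= size_rcons -drop1 drop_drop add1n.
  have [xy|xy] := ltnP (size x) (size y).
    by rewrite (take_nth None) // rev_rcons (drop_nth None).
  by rewrite drop_oversize // /pushhd /= !take_oversize // ltnW.
apply: (eq_PT (f := fun e => rev (fold2 (fun _ u v => pushhd v u) (fun _ _ v => behead v) [::] (g e) (f e)).1)) => [e|].
  by rewrite E revK.
apply: PT_rev.
apply: (@PT_fold2 (fun e _ u v => pushhd v u) (fun e _ _ v => behead v) (fun=> [::]) g f (fun e => size (g e))) => //; try pt.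
move=> e l hl r; rewrite /r E /= size_rev size_take size_drop leq_subr.
by case: ltnP => // /ltnW.
Qed.
#[export] Hint Resolve PT_take : pt.

Lemma PTB_leq f g : PT f -> PT g -> PTB (fun e => size (f e) <= size (g e)).
Proof.
move=> hf hg; apply: (eq_PTB (b := fun e => nilp (drop (size (g e)) (f e)))) => [e|].
  by rewrite /nilp size_drop subn_eq0.
by pt.
Qed.
#[export] Hint Resolve PTB_leq : pt.

Lemma PTB_ltn f g : PT f -> PT g -> PTB (fun e => size (f e) < size (g e)).
Proof.
move=> hf hg; apply: (eq_PTB (b := fun e => ~~ (size (g e) <= size (f e)))) => [e|].
  by rewrite ltnNge.
by pt.
Qed.
#[export] Hint Resolve PTB_ltn : pt.

Lemma PTB_prefix f g : PT f -> PT g -> PTB (fun e => prefix (f e) (g e)).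
Proof.
move=> hf hg.
have E x y : fold2 (fun a u v => if ohead v == Some a then u else [::])
    (fun _ _ v => behead v) [:: Some true] y x =
    (if prefix x y then [:: Some true] else [::], drop (size x) y).
  elim/last_ind: x => [|x b IH]; first by rewrite drop0 prefix0s.
  rewrite fold2_rcons IH /= size_rcons -drop1 drop_drop add1n; congr pair.
  have [/prefixP[z ->]|xy] := boolP (prefix x y).
    have -> : prefix (rcons x b) (x ++ z) = prefix [:: b] z.
      by rewrite -cats1; elim: (x) => //= c l ->; rewrite eqxx.
    rewrite drop_size_cat //; case: z => //= c z.
    by rewrite (inj_eq (@Some_inj _)) eq_sym prefix0s andbT.
  case: ifP => _; case: ifP => // /prefixP[z e]; case/negP: xy;
  by rewrite e -cats1 -catA prefix_prefix.
apply: (eq_PTB (b := fun e => tt (fold2 (fun a u v => if ohead v == Some a then u else [::])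
    (fun _ _ v => behead v) [:: Some true] (g e) (f e)).1)) => [e|].
  by rewrite E /=; case: ifP.
apply: PTB_tt.
apply: (@PT_fold2 (fun e a u v => if ohead v == Some a then u else [::])
  (fun e _ _ v => behead v) (fun=> [:: Some true]) g f (fun e => size (g e) + 1)) => //; try pt.
- by move=> a; apply: PT_if; pt.
move=> e l hl r; rewrite /r E /= size_drop; split; last by lia.
by case: ifP => //= _; rewrite addn1.
Qed.
#[export] Hint Resolve PTB_prefix : pt.

Lemma PTB_eq f g : PT f -> PT g -> PTB (fun e => f e == g e).
Proof.
move=> hf hg; apply: (eq_PTB (b := fun e => prefix (f e) (g e) && (size (g e) <= size (f e)))) => [e|].
  apply/andP/eqP => [[/prefixP[z ->]]|->]; last by rewrite prefix_refl.
  by rewrite size_cat -{2}[size _]addn0 leq_add2l leqn0 size_eq0 => /eqP ->; rewrite cats0.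
by pt.
Qed.
#[export] Hint Resolve PTB_eq : pt.

Fixpoint before (w : W) : W := if w is a :: w' then if a == None then [::] else a :: before w' else [::].
Fixpoint after (w : W) : W := if w is a :: w' then if a == None then w' else after w' else [::].

Lemma PT_before f : PT f -> PT (fun e => before (f e)).
Proof.
move=> hf.
pose g1 (a : symbol) (u v : W) : W := if nilp v && (a != None) then a :: u else u.
pose g2 (a : symbol) (u v : W) : W := if a == None then [:: Some true] else v.
have E x : fold2 g1 g2 [::] [::] x =
    (rev (before x), if None \in x then [:: Some true] else [::]).
  elim/last_ind: x => // x b IH; rewrite fold2_rcons IH /g1 /g2 /= mem_rcons inE.
  congr pair; last by rewrite eq_sym; case: ifP.
  have h : before (rcons x b) = if None \in x then before x else if b == None then before x
    else rcons (before x) b.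
    elim: x {IH} => [|c x IH] /=; first by case: ifP.
    rewrite inE; case: c => [c|] //=; rewrite IH.
    by case: ifP => // _; case: ifP.
  by rewrite h; case: (None \in x) => //=; case: (b == None); rewrite ?rev_rcons.
apply: (eq_PT (f := fun e => rev (fold2 g1 g2 [::] [::] (f e)).1)) => [e|].
  by rewrite E revK.
apply: PT_rev.
apply: (@PT_fold2 (fun e => g1) (fun e => g2) (fun=> [::]) (fun=> [::]) f (fun e => size (f e) + 1)) => //; try pt.
- by move=> a; rewrite /g1; case: (a != None); pt.
- by move=> a; rewrite /g2; case: (a == None); pt.
move=> e l hl r; rewrite /r E /= size_rev; split; last by case: ifP => //= _; rewrite addn1.
have hb : size (before l) <= size l by elim: (l) => //= a l' IH; case: ifP.
by lia.
Qed.
#[export] Hint Resolve PT_before : pt.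

Lemma PT_after f : PT f -> PT (fun e => after (f e)).
Proof.
move=> hf.
pose g1 (a : symbol) (u v : W) : W := if nilp v then [::] else a :: u.
pose g2 (a : symbol) (u v : W) : W := if a == None then [:: Some true] else v.
have E x : fold2 g1 g2 [::] [::] x =
    (rev (after x), if None \in x then [:: Some true] else [::]).
  elim/last_ind: x => // x b IH; rewrite fold2_rcons IH /g1 /g2 /= mem_rcons inE.
  congr pair; last by rewrite eq_sym; case: ifP.
  have h : after (rcons x b) = if None \in x then rcons (after x) b else [::].
    elim: x {IH} => [|c x IH] /=; first by case: ifP.
    by rewrite inE; case: c => [c|] //=; rewrite IH.
  by rewrite h; case: (None \in x) => //=; rewrite rev_rcons.
apply: (eq_PT (f := fun e => rev (fold2 g1 g2 [::] [::] (f e)).1)) => [e|].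
  by rewrite E revK.
apply: PT_rev.
apply: (@PT_fold2 (fun e => g1) (fun e => g2) (fun=> [::]) (fun=> [::]) f (fun e => size (f e) + 1)) => //; try pt.
- by move=> a; rewrite /g1; pt.
- by move=> a; rewrite /g2; case: (a == None); pt.
move=> e l hl r; rewrite /r E /= size_rev; split; last by case: ifP => //= _; rewrite addn1.
have hb : size (after l) <= size l by elim: (l) => //= a l' IH; case: ifP => //; lia.
by lia.
Qed.
#[export] Hint Resolve PT_after : pt.

(** * Arithmetic on bit strings, least significant bit first *)

Definition tr (a : symbol) := a == Some true.

Fixpoint val2 (w : W) : nat := if w is a :: w' then tr a + (val2 w').*2 else 0.

Lemma val2_lt w : val2 w < 2 ^ size w.
Proof. by elim: w => //= a w IH; rewrite expnS; case: (tr a); lia. Qed.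

Lemma val2_cat u w : val2 (u ++ w) = val2 u + 2 ^ size u * val2 w.
Proof.
by elim: u => [|a u IH] /=; rewrite ?mul1n // IH expnS -!muln2 !mulnDl; lia.
Qed.

Lemma val2_nseq n : val2 (nseq n (Some false)) = 0.
Proof. by elim: n => //= n ->. Qed.

Lemma fold2_cons g1 g2 u v a l : fold2 g1 g2 u v (a :: l) =
  fold2 g1 g2 (g1 a u v) (g2 a u v) l.
Proof. by []. Qed.

Lemma fold3_cons g1 g2 g3 u v w a l : fold3 g1 g2 g3 u v w (a :: l) =
  fold3 g1 g2 g3 (g1 a u v w) (g2 a u v w) (g3 a u v w) l.
Proof. by []. Qed.

Fixpoint xorW (x y : W) : W :=
  if x is a :: x' then Some (tr a (+) tt y) :: xorW x' (behead y) else [::].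

Lemma size_xorW x y : size (xorW x y) = size x.
Proof. by elim: x y => //= a x IH y; rewrite IH. Qed.

Lemma PT_xorW f g : PT f -> PT g -> PT (fun e => xorW (f e) (g e)).
Proof.
move=> hf hg.
pose g1 (a : symbol) (u v : W) : W := if tt v then Some (~~ tr a) :: u else Some (tr a) :: u.
have E x y : fold2 g1 (fun _ _ v => behead v) [::] y x =
    (rev (xorW x y), drop (size x) y).
  elim/last_ind: x => [|x b IH]; first by rewrite drop0.
  rewrite fold2_rcons IH /= size_rcons -drop1 drop_drop add1n; congr pair.
  have -> : xorW (rcons x b) y = rcons (xorW x y) (Some (tr b (+) tt (drop (size x) y))).
    elim: x {IH} y => [|c x IH] y /=; first by rewrite drop0.
    by rewrite IH -drop1 drop_drop addn1.
  by rewrite rev_rcons /g1; case: (tt _); rewrite ?addbT ?addbF.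
apply: (eq_PT (f := fun e => rev (fold2 g1 (fun _ _ v => behead v) [::] (g e) (f e)).1)) => [e|].
  by rewrite E revK.
apply: PT_rev.
apply: (@PT_fold2 (fun e => g1) (fun e _ _ v => behead v) (fun=> [::]) g f (fun e => size (f e) + size (g e))) => //; try pt.
- by move=> a; rewrite /g1; pt.
move=> e l hl r; rewrite /r E /= size_rev size_xorW size_drop; lia.
Qed.
#[export] Hint Resolve PT_xorW : pt.

(** The scan starts at the least significant bit: r is the verdict of the bits read so far, and any
    later difference overrides it. *)
Fixpoint ltb (r : bool) (x y : W) : bool :=
  if x is a :: x' then ltb (if tr a == tt y then r else tt y) x' (behead y) else r.

(** The loops run over their first argument; padding lets them reach all bits of the second. *)
Definition padz (x y : W) : W := x ++ nseq (size y) (Some false).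

Definition lessW (x y : W) := ltb false (padz x y) y.

Lemma ltbE r x y : size y <= size x ->
  ltb r x y = if val2 x == val2 y then r else val2 x < val2 y.
Proof.
elim: x r y => [|a x IH] r [|b y] //= xy.
  rewrite IH // /tt /=; case: (tr a) => /=; case: (val2 x) => // n.
rewrite IH // -[tt (b :: y)]/(tr b).
by case: (tr a); case: (tr b) => /=; do !case: eqP => //=; lia.
Qed.

Lemma val2_padz x y : val2 (padz x y) = val2 x.
Proof. by rewrite /padz val2_cat val2_nseq muln0 addn0. Qed.

Lemma lessWE x y : lessW x y = (val2 x < val2 y).
Proof.
rewrite /lessW ltbE; last by rewrite size_cat size_nseq leq_addl.
by rewrite val2_padz; case: eqP => // ->; rewrite ltnn.
Qed.

Lemma PTB_lessW f g : PT f -> PT g -> PTB (fun e => lessW (f e) (g e)).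
Proof.
move=> hf hg.
pose bit (b : bool) : W := if b then [:: Some true] else [::].
pose g1 (a : symbol) (u v : W) : W := if tt v then (if tr a then u else [:: Some true])
  else (if tr a then [::] else u).
have E x y r : fold2 g1 (fun _ _ v => behead v) (bit r) y x =
    (bit (ltb r x y), drop (size x) y).
  elim: x r y => [|a x IH] r y /=; first by rewrite drop0.
  rewrite fold2_cons.
  have -> : g1 a (bit r) y = bit (if tr a == tt y then r else tt y).
    by rewrite /g1; case: (tr a); case: (tt y).
  by rewrite IH -drop1 drop_drop addn1.
apply: (eq_PT (f := fun e => (fold2 g1 (fun _ _ v => behead v) (bit false) (g e) (padz (f e) (g e))).1)) => [e|].
  by rewrite E.
apply: (@PT_fold2 (fun e => g1) (fun e _ _ v => behead v) (fun=> bit false) g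
  (fun e => padz (f e) (g e)) (fun e => 1 + size (g e))) => //; try pt.
- by move=> a; rewrite /g1; case: (tr a); pt.
- by rewrite /padz; pt.
move=> e l hl r; rewrite /r E /= size_drop; split; last by lia.
by case: ltb.
Qed.
#[export] Hint Resolve PTB_lessW : pt.

Fixpoint addc (c : bool) (x y : W) : W :=
  if x is a :: x' then
    Some (tr a (+) tt y (+) c) ::
      addc (if tr a then tt y || c else tt y && c) x' (behead y)
  else [::].

Definition addW (x y : W) := addc false (rcons (padz x y) (Some false)) y.

Lemma size_addc c x y : size (addc c x y) = size x.
Proof. by elim: x c y => //= a x IH c y; rewrite IH. Qed.

Lemma addcE (c : bool) x y : size y <= size x -> val2 x + val2 y + c < 2 ^ size x ->
  val2 (addc c x y) = val2 x + val2 y + c.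
Proof.
elim: x c y => [|a x IH] c [|b y] //=; first by case: c.
  rewrite expnS => _ h; rewrite IH //=.
    by case: (tr a); case: (c) => /=; lia.
  by move: h; case: (tr a); case: (c) => /=; lia.
rewrite -[tt (b :: y)]/(tr b) => xy; rewrite expnS => h; rewrite IH //=.
  by case: (tr a); case: (tr b); case: (c) => /=; lia.
by move: h; case: (tr a); case: (tr b); case: (c) => /=; lia.
Qed.

Lemma addWE x y : val2 (addW x y) = val2 x + val2 y.
Proof.
have v : val2 (rcons (padz x y) (Some false)) = val2 x.
  by rewrite -cats1 val2_cat muln0 addn0 val2_padz.
have := @addcE false (rcons (padz x y) (Some false)) y.
rewrite -/(addW x y) v addn0 => -> //; rewrite size_rcons size_cat size_nseq; first by lia.
have := val2_lt x; have := val2_lt y; rewrite expnS expnD.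
have := expn_gt0 2 (size x); have := expn_gt0 2 (size y); nia.
Qed.

Lemma size_addW x y : size (addW x y) = (size x + size y).+1.
Proof. by rewrite size_addc size_rcons size_cat size_nseq. Qed.

Lemma PT_addW f g : PT f -> PT g -> PT (fun e => addW (f e) (g e)).
Proof.
move=> hf hg.
pose bit (b : bool) : W := if b then [:: Some true] else [::].
pose g1 (a : symbol) (u c v : W) : W :=
  if (if tt v then (if tt c then tr a else ~~ tr a) else (if tt c then ~~ tr a else tr a))
  then Some true :: u else Some false :: u.
pose g2 (a : symbol) (u c v : W) : W :=
  if (if tr a then tt v || tt c else tt v && tt c) then [:: Some true] else [::].
pose g3 (a : symbol) (u c v : W) : W := behead v.
have E x y c u : fold3 g1 g2 g3 u (bit c) y x = (rev (addc c x y) ++ u, (fold3 g1 g2 g3 u (bit c) y x).1.2, drop (size x) y)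
   /\ size (fold3 g1 g2 g3 u (bit c) y x).1.2 <= 1.
  elim: x c y u => [|a x IH] c y u /=; first by rewrite drop0; case: c.
  rewrite fold3_cons.
  have -> : g2 a u (bit c) y = bit (if tr a then tt y || c else tt y && c).
    by rewrite /g2; case: (c).
  have := IH (if tr a then tt y || c else tt y && c) (behead y) (g1 a u (bit c) y).
  rewrite /g3; move: (fold3 _ _ _ _ _ _ _) => [[p1 p2] p3] /= [[-> ->] ->].
  rewrite rev_cons cat_rcons -drop1 drop_drop addn1; split => //.
  by congr (_ ++ _, _, _); rewrite /g1; case: (tt y); case: (c); case: (tr a).
apply: (eq_PT (f := fun e => rev (fold3 g1 g2 g3 [::] (bit false) (g e) (rcons (padz (f e) (g e)) (Some false))).1.1)) => [e|].
  by case: (E (rcons (padz (f e) (g e)) (Some false)) (g e) false [::]) => -> _ /=; rewrite cats0 revK.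
apply: PT_rev.
apply: (@PT_fold3 (fun e => g1) (fun e => g2) (fun e => g3) (fun=> [::]) (fun=> bit false) g
  (fun e => rcons (padz (f e) (g e)) (Some false)) (fun e => 2 + (size (f e) + size (g e)))) => //; try pt.
- by move=> a; rewrite /g1; case: (tr a); pt.
- by move=> a; rewrite /g2; case: (tr a); pt.
- by move=> a; rewrite /g3; pt.
- apply: (eq_PT (f := fun e => padz (f e) (g e) ++ [:: Some false])) => [e|]; first by rewrite cats1.
  by rewrite /padz; pt.
move=> e l; rewrite size_rcons size_cat size_nseq => hl r; rewrite /r.
case: (E l (g e) false [::]) => e1 e2; split; [|by lia|]; rewrite e1 /=.
  by rewrite cats0 size_rev size_addc; lia.
by rewrite size_drop; lia.
Qed.
#[export] Hint Resolve PT_addW : pt.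

(* Long division of 2^t by n; the remainder is only kept at most n, which makes
   the case n = 1 uniform. *)
Fixpoint qr (t n : nat) : nat * nat :=
  if t is t'.+1 then
    let p := qr t' n in
    if n <= p.2.*2 then (p.1.*2.+1, p.2.*2 - n) else (p.1.*2, p.2.*2)
  else (0, 1).

Lemma qrE t n : (qr t n).1 * n + (qr t n).2 = 2 ^ t.
Proof.
elim: t => [|t IH] //=; rewrite expnS -IH; case: ifP => /= h; last by lia.
by rewrite mulSn -!mul2n -mulnA; lia.
Qed.

Lemma qr_le t n : 0 < n -> (qr t n).2 <= n.
Proof. by move=> n0; elim: t => [|t IH] //=; case: ifP => /= h; lia. Qed.

(** Divisor and remainder are in unary, where doubling is a concatenation and subtraction is [drop];
    only the quotient is in binary. *)
Definition divstep1 (n : W) (_ : symbol) (u v : W) : W :=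
  if size n <= size (v ++ v) then Some true :: u else Some false :: u.
Definition divstep2 (n : W) (_ : symbol) (u v : W) : W :=
  if size n <= size (v ++ v) then drop (size n) (v ++ v) else v ++ v.

Definition divW (t n : W) : W :=
  (fold2 (divstep1 n) (divstep2 n) [::] [:: Some true] t).1.

Lemma divWE t n : let r := fold2 (divstep1 n) (divstep2 n) [::] [:: Some true] t in
  [/\ val2 r.1 = (qr (size t) (size n)).1, size r.2 = (qr (size t) (size n)).2 &
      size r.1 = size t].
Proof.
elim/last_ind: t => // t b /=; rewrite fold2_rcons size_rcons /=.
move: (fold2 _ _ _ _ _) => [u v] /= [h1 h2 h3].
rewrite /divstep1 /divstep2 size_cat addnn h2 -h1.
by case: ifP => h /=; split; rewrite ?h3 // ?size_drop size_cat h2 addnn.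
Qed.

Lemma val2_divW t n : val2 (divW t n) = (qr (size t) (size n)).1.
Proof. by case: (divWE t n). Qed.

Lemma size_divW t n : size (divW t n) = size t.
Proof. by case: (divWE t n). Qed.

Lemma PT_divW f g : PT f -> PT g -> (forall e, 0 < size (g e)) ->
  PT (fun e => divW (f e) (g e)).
Proof.
move=> hf hg g0.
apply: (@PT_fold2 (fun e => divstep1 (g e)) (fun e => divstep2 (g e)) (fun=> [::])
  (fun=> [:: Some true]) f (fun e => size (f e) + size (g e))) => //; try pt.
- move=> a; have hg2 := PT_ren (fun i => i.+2) hg; rewrite /divstep1; pt.
- move=> a; have hg2 := PT_ren (fun i => i.+2) hg; rewrite /divstep2; pt.
move=> e l hl r; rewrite /r; have [_ -> ->] := divWE l (g e).
by have := qr_le (size l) (g0 e); lia.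
Qed.

(* The partial sum 2^t (1/(1*2) + ... + 1/(t*2^t)) of 2^t ln 2, term by term
   rounded. *)
Definition LMnat (t : nat) := \sum_(1 <= n < t.+1) (qr (t - n) n).1.

Definition lm1 (_ : symbol) (s n T : W) : W := addW s (divW (behead T) (Some true :: n)).

Definition LMW (t : W) : W :=
  (fold3 lm1 (fun _ _ n _ => Some true :: n) (fun _ _ _ T => behead T)
     [::] [::] t t).1.1.

Lemma LMWE t l : let r := fold3 lm1 (fun _ _ n _ => Some true :: n)
    (fun _ _ _ T => behead T) [::] [::] t l in
  [/\ val2 r.1.1 = \sum_(1 <= n < (size l).+1) (qr (size t - n) n).1,
      size r.1.2 = size l, size r.2 = size t - size l &
      size r.1.1 <= size l * (size t).+1].
Proof.
elim/last_ind: l => [|l b]; first by rewrite /= big_geq // subn0.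
rewrite /= fold3_rcons /= size_rcons.
move: (fold3 _ _ _ _ _ _ _) => [[u v] w] /= [h1 h2 h3 h4].
split; rewrite ?h2 // ?size_behead ?h3; try lia.
  by rewrite addWE h1 [RHS]big_nat_recr //= val2_divW size_behead h3 /= h2 subnS.
by rewrite size_addW size_divW size_behead h3 mulSn; lia.
Qed.

Lemma val2_LMW t : val2 (LMW t) = LMnat (size t).
Proof. by case: (LMWE t t). Qed.

Lemma PT_LMW f : PT f -> PT (fun e => LMW (f e)).
Proof.
move=> hf.
apply: (@PT_fold3 (fun e => lm1) (fun e _ _ n _ => Some true :: n)
  (fun e _ _ _ T => behead T) (fun=> [::]) (fun=> [::]) f f
  (fun e => size (f e) * (size (f e) + 1) + size (f e))) => //; try pt.
- by move=> a; rewrite /lm1; apply: PT_addW; [pt | apply: PT_divW => //; pt].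
move=> e l hl r; rewrite /r; have [_ -> -> h] := LMWE (f e) l.
by split; [apply: leq_trans h _; rewrite addn1; nia | lia | lia].
Qed.
#[export] Hint Resolve PT_LMW : pt.

(** 2^|a| in unary, cut off at |k| + 1 to have polynomial length. The cut does not affect
    comparisons with |k|. *)
Definition powcap (a k : W) : W :=
  foldl (fun u _ => take (size (Some true :: k)) (u ++ u)) [:: Some true] a.

Lemma size_powcap a k : size (powcap a k) = minn (2 ^ size a) (size k).+1.
Proof.
rewrite /powcap; elim/last_ind: a => [|a b IH]; first by rewrite /=; lia.
rewrite foldl_rcons size_rcons size_take_min size_cat IH expnS /=.
move: (2 ^ size a) (size k).+1 => z n; rewrite /minn; do ?case: ifP; lia.
Qed.

Lemma PT_powcap f g : PT f -> PT g -> PT (fun e => powcap (f e) (g e)).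
Proof.
move=> hf hg.
apply: (@PT_fold1 (fun e _ u => take (size (Some true :: g e)) (u ++ u)) _ _
  (fun e => size (g e) + 1)) => //; try pt.
- move=> a; have hg2 := PT_ren (fun i => i.+1) hg.
  by apply: (@PT_take (fun e => Some true :: g (fun i => e i.+1))); pt.
by move=> e l hl; rewrite -/(powcap l (g e)) size_powcap; lia.
Qed.
#[export] Hint Resolve PT_powcap : pt.

(** * Hashing by polynomials over a binary field, and unary parameters *)

(** The polynomial X^h + 1, which replaces an overflowing X^(2h). *)
Definition red_mask (h : W) : W :=
  Some true :: nseq (size (behead h)) (Some false) ++
  Some true :: nseq (size (behead h)) (Some false).

(* Multiplication by X modulo X^(2h) + X^h + 1 over GF(2), with h in unary. *)
Definition mulx (h v : W) : W :=
  if tt (rev v) then xorW (take (size v) (Some false :: v)) (red_mask h)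
  else take (size v) (Some false :: v).

Definition mulW (h u v : W) : W :=
  foldl (fun acc a => if tr a then xorW (mulx h acc) v else mulx h acc)
    (nseq (size v) (Some false)) (rev u).

Definition oneW (h : W) : W :=
  Some true :: nseq (size (behead (h ++ h))) (Some false).

(* [hashW h j k] is the value at [j] of the polynomial whose coefficients are the
   blocks of [size (h ++ h)] bits of [k]. *)
Definition hash1 (h j : W) (_ : symbol) (acc pow rest : W) : W :=
  xorW acc (mulW h (take (size (h ++ h)) rest) pow).

Definition hash_state (h j k l : W) := fold3 (hash1 h j)
  (fun _ _ pow _ => mulW h j pow) (fun _ _ _ rest => drop (size (h ++ h)) rest)
  (nseq (size (h ++ h)) (Some false)) (oneW h) k l.

Definition hashW (h j k : W) : W := (hash_state h j k k).1.1.

Lemma size_mulx h v : size (mulx h v) = size v.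
Proof.
rewrite /mulx; case: ifP => _; rewrite ?size_xorW size_take_min /=; lia.
Qed.

Lemma size_mulW h u v : size (mulW h u v) = size v.
Proof.
rewrite /mulW; elim/last_ind: (rev u) => [|l a IH]; first by rewrite size_nseq.
by rewrite foldl_rcons; case: ifP => _; rewrite ?size_xorW size_mulx.
Qed.

Lemma PT_mulx f g : PT f -> PT g -> PT (fun e => mulx (f e) (g e)).
Proof. by move=> hf hg; rewrite /mulx /red_mask; pt. Qed.
#[export] Hint Resolve PT_mulx : pt.

Lemma PT_mulW f g k : PT f -> PT g -> PT k -> PT (fun e => mulW (f e) (g e) (k e)).
Proof.
move=> hf hg hk.
apply: (@PT_fold1 (fun e a acc => if tr a then xorW (mulx (f e) acc) (k e) else mulx (f e) acc)
  _ _ (fun e => size (k e))) => //; try pt.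
- move=> a; have hf2 := PT_ren (fun i => i.+1) hf; have hk2 := PT_ren (fun i => i.+1) hk.
  by case: (tr a); pt.
by move=> e l hl; rewrite -[l]revK -/(mulW (f e) (rev l) (k e)) size_mulW.
Qed.
#[export] Hint Resolve PT_mulW : pt.

Lemma size_hash_state h j k l : let r := hash_state h j k l in
  [/\ size r.1.1 = size (h ++ h), size r.1.2 = size (oneW h) & size r.2 <= size k].
Proof.
rewrite /= /hash_state; elim/last_ind: l => [|l a]; first by rewrite /= size_nseq.
rewrite fold3_rcons /= /hash1 size_xorW size_mulW => -[-> -> h3].
by split => //; rewrite size_drop; lia.
Qed.

Lemma size_hashW h j k : size (hashW h j k) = size (h ++ h).
Proof. by case: (size_hash_state h j k k). Qed.

Lemma PT_hashW f g k : PT f -> PT g -> PT k ->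
  PT (fun e => hashW (f e) (g e) (k e)).
Proof.
move=> hf hg hk.
apply: (@PT_fold3 (fun e => hash1 (f e) (g e)) (fun e _ _ pow _ => mulW (f e) (g e) pow)
  (fun e _ _ _ rest => drop (size (f e ++ f e)) rest) _ _ _ _
  (fun e => size (f e ++ f e) + size (oneW (f e)) + size (k e))) => //; try pt.
- move=> a; have hf2 := PT_ren (fun i => i.+3) hf; have hg2 := PT_ren (fun i => i.+3) hg.
  by rewrite /hash1; pt.
- by move=> a; have hf2 := PT_ren (fun i => i.+3) hf; have hg2 := PT_ren (fun i => i.+3) hg; pt.
- move=> a; have hf2 := PT_ren (fun i => i.+3) hf.
  by apply: (@PT_drop (fun e => f (fun i => e i.+3) ++ f (fun i => e i.+3))); pt.
- by apply: PT_cons; apply: (@PT_nseq _ (fun e => behead (f e ++ f e))); pt.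
- apply: PB_add; last by pt.
  apply: PB_add; first by apply: (@PT_PB (fun e => f e ++ f e)); pt.
  apply: (@PT_PB (fun e => oneW (f e))); apply: PT_cons.
  by apply: (@PT_nseq _ (fun e => behead (f e ++ f e))); pt.
move=> e l hl r; rewrite /r -/(hash_state (f e) (g e) (k e) l).
have [-> -> h] := size_hash_state (f e) (g e) (k e) l; split; lia.
Qed.
#[export] Hint Resolve PT_hashW : pt.

(* The least b with 2^(d1 b) p >= q, in unary; it is at most the length of q. *)
Definition apar_state (d1 : nat) (p q l : W) := fold2
  (fun _ c p' => if lessW p' q then Some true :: c else c)
  (fun _ _ p' => if lessW p' q then nseq d1 (Some false) ++ p' else p') [::] p l.

Definition apar d1 p q : W := (apar_state d1 p q q).1.

Lemma apar_stateE d1 p q l : let r := apar_state d1 p q l in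
  [/\ size r.1 <= size l, size r.2 = d1 * size r.1 + size p,
      val2 r.2 = 2 ^ (d1 * size r.1) * val2 p,
      (forall b, b < size r.1 -> 2 ^ (d1 * b) * val2 p < val2 q) &
      size r.1 < size l -> val2 q <= val2 r.2].
Proof.
rewrite /= /apar_state; elim/last_ind: l => [|l a] /=.
  by split; rewrite ?muln0 ?mul1n.
rewrite fold2_rcons /= size_rcons.
move: (fold2 _ _ _ _ _) => [c p'] /= [h1 h2 h3 h4 h5].
rewrite lessWE; case: ltnP => h /=.
  split => //.
  - by rewrite size_cat size_nseq h2 mulnS addnA.
  - by rewrite val2_cat val2_nseq size_nseq h3 mulnS expnD mulnA.
  - by move=> b; rewrite ltnS leq_eqVlt => /orP[/eqP->|/h4 //]; rewrite -h3.
  by rewrite ltnS => /h5; rewrite leqNgt h.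
by split => //; lia.
Qed.

Lemma aparE d1 p q : 0 < d1 -> 0 < val2 p ->
  val2 q <= 2 ^ (d1 * size (apar d1 p q)) * val2 p /\
  forall b, b < size (apar d1 p q) -> 2 ^ (d1 * b) * val2 p < val2 q.
Proof.
move=> d0 p0; have [h1 h2 h3 h4 h5] := apar_stateE d1 p q q.
split => //; rewrite -h3.
have [lt|ge] := ltnP (size (apar_state d1 p q q).1) (size q); first exact: h5.
rewrite h3; apply: leq_trans (ltnW (val2_lt q)) _.
apply: (@leq_trans (2 ^ (d1 * size (apar_state d1 p q q).1))); last by rewrite leq_pmulr.
by rewrite leq_pexp2l // (leq_trans ge) // leq_pmull.
Qed.

Lemma PT_apar d1 f g : PT f -> PT g -> PT (fun e => apar d1 (f e) (g e)).
Proof.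
move=> hf hg.
apply: (@PT_fold2 (fun e _ c p' => if lessW p' (g e) then Some true :: c else c)
  (fun e _ _ p' => if lessW p' (g e) then nseq d1 (Some false) ++ p' else p') _ _ _
  (fun e => (d1 + 1) * size (g e) + size (f e))) => //; try pt.
- by move=> a; have hg2 := PT_ren (fun i => i.+2) hg; pt.
- by move=> a; have hg2 := PT_ren (fun i => i.+2) hg; pt.
move=> e l hl r; rewrite /r -/(apar_state d1 (f e) (g e) l).
have [h1 h2 h3 h4 h5] := apar_stateE d1 (f e) (g e) l; rewrite h2.
by split; nia.
Qed.
#[export] Hint Resolve PT_apar : pt.

Definition trip (u : W) : W := u ++ u ++ u.

(* A power of 3 between |a| and 3|a|, in unary. *)
Definition h3W (a : W) : W :=
  foldl (fun u _ => if size a <= size u then u else trip u) [:: Some true] a.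

Lemma size_trip u : size (trip u) = 3 * size u.
Proof. by rewrite !size_cat; lia. Qed.

Lemma h3_state (a l : W) : 0 < size a ->
  let u := foldl (fun u _ => if size a <= size u then u else trip u) [:: Some true] l in
  [/\ exists n, size u = 3 ^ n, size u <= 3 * size a & size a <= size u \/ size l < size u].
Proof.
move=> a0 /=; elim/last_ind: l => [|l b].
  by split => /=; [exists 0 | lia | right].
rewrite foldl_rcons size_rcons; move: (foldl _ _ _) => u [[n hn] h1 h2].
case: ifP => h; first by split => //; [exists n | left].
by split; rewrite size_trip; [exists n.+1; rewrite expnS hn | lia | right; lia].
Qed.

Lemma h3WE a : 0 < size a -> exists n, [/\ size (h3W a) = 3 ^ n,
  size a <= 3 ^ n & 3 ^ n <= 3 * size a].
Proof.
by move=> a0; have [[n hn] h1 h2] := h3_state a a0; exists n; rewrite /h3W hn in h1 h2 *; split => //; lia.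
Qed.

Lemma PT_h3W f : PT f -> PT (fun e => h3W (f e)).
Proof.
move=> hf.
apply: (@PT_fold1 (fun e _ u => if size (f e) <= size u then u else trip u) _ _
  (fun e => 3 * size (f e) + 1)) => //; try pt.
- by move=> a; have hf2 := PT_ren (fun i => i.+1) hf; rewrite /trip; pt.
move=> e l hl; have [a0|a0] := posnP (size (f e)).
  by case: l hl => [|c l]; rewrite a0.
by have [_ h _] := h3_state l a0; lia.
Qed.
#[export] Hint Resolve PT_h3W : pt.

Definition tripn n u : W := iter n trip u.

Lemma size_tripn n u : size (tripn n u) = 3 ^ n * size u.
Proof. by elim: n => [|n IH]; rewrite ?mul1n //= size_trip IH expnS mulnA. Qed.

Lemma PT_tripn n f : PT f -> PT (fun e => tripn n (f e)).
Proof. by move=> hf; elim: n => //= n IH; rewrite /trip; pt. Qed.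
#[export] Hint Resolve PT_tripn : pt.

(** A finite table is hard-wired as a cascade of comparisons with unary constants. *)
Lemma PT_table (T : nat -> W) n f : PT f ->
  PT (fun e => if size (f e) < n then T (size (f e)) else [::]).
Proof.
move=> hf; elim: n => [|n IH]; first by pt.
have hn : PT (fun=> nseq n (Some true)) by pt.
apply: (eq_PT (f := fun e => if (size (f e) <= size (nseq n (Some true))) && (size (nseq n (Some true)) <= size (f e)) then T n else
  if size (f e) < n then T (size (f e)) else [::])) => [e|].
  rewrite size_nseq -eqn_leq; case: eqP => [->|hne]; first by rewrite ltnSn.
  by rewrite (_ : (size (f e) < n.+1) = (size (f e) < n)) //; lia.
by apply: PT_ifb => //; pt.
Qed.
#[export] Hint Resolve PT_table : pt.

(** * The formula for given fan-ins and hash functions *)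

Section Build.
Variables (M s : nat -> nat) (HW : nat -> W -> W -> W).

Fixpoint nb i := if i is i'.+1 then nb i' + s i else 0.

Definition bits n j : W := mkseq (fun i => Some (odd (j %/ 2 ^ i))) n.

Definition hnat i k j : nat := val2 (HW i.+1 (enc_nat k) (bits (nb i) j)).

Lemma sg_lt i k (j : 'I_(2 ^ nb i)) :
  j + 2 ^ nb i * (hnat i k j %% 2 ^ s i.+1) < 2 ^ nb i.+1.
Proof.
rewrite /= expnD; have := ltn_ord j.
have := ltn_pmod (hnat i k j) (expn_gt0 2 (s i.+1)); move: (_ %% _) => r; nia.
Qed.

(* Variable j of the k-th copy becomes the pair (j, hash of j under k). *)
Definition sg i k (j : 'I_(2 ^ nb i)) : 'I_(2 ^ nb i.+1) := Ordinal (sg_lt k j).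

Lemma sg_eq i k l j j' : @sg i k j = @sg i l j' -> j = j'.
Proof.
move=> /(congr1 val) /= /(congr1 (modn^~ (2 ^ nb i))).
rewrite !(addnC (nat_of_ord _)) !(mulnC (2 ^ _)) !modnMDl !modn_small //.
exact: val_inj.
Qed.

Definition conn_of i := if odd i then And else Or.

(** The construction goes down from the output gate, with [tau] the composite of the renamings met
    on the way; so no renaming has to be mapped over a finished formula. *)
Fixpoint build i N : ('I_(2 ^ nb i) -> 'I_N) -> formula N :=
  if i is i'.+1 return ('I_(2 ^ nb i) -> 'I_N) -> formula N then
    fun tau => Gate (conn_of i) (build (fun j => tau (sg 0 j)))
      [seq build (fun j => tau (sg k j)) | k <- iota 1 (M i).-1]
  else fun tau => Input (tau ord0).

Lemma depth_build i N (tau : 'I_(2 ^ nb i) -> 'I_N) : depth (build tau) = i.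
Proof.
elim: i N tau => //= i IH N tau; rewrite IH; congr _.+1.
by elim: iota => //= k l ->; rewrite IH maxnn.
Qed.

Fixpoint bsize i := if i is i'.+1 then (M i * bsize i').+1 else 1.

Hypothesis M0 : forall i, 0 < M i.

Lemma fsize_build i N (tau : 'I_(2 ^ nb i) -> 'I_N) : fsize (build tau) = bsize i.
Proof.
elim: i N tau => //= i IH N tau; rewrite IH; congr _.+1.
rewrite -{2}(prednK (M0 i.+1)) mulSn; congr addn.
suff h n m : sumn [seq fsize F | F <- [seq build (fun j => tau (sg k j)) | k <- iota m n]] =
  n * bsize i by [].
by elim: n m => //= n IHn m; rewrite IH IHn mulSn.
Qed.

Fixpoint ev i : {ffun 'I_(2 ^ nb i) -> bool} -> bool :=
  if i is i'.+1 return {ffun 'I_(2 ^ nb i) -> bool} -> bool then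
    fun x => if odd i then [forall k : 'I_(M i), ev (pull (@sg i' k) x)]
             else [exists k : 'I_(M i), ev (pull (@sg i' k) x)]
  else fun x => x ord0.

Lemma eval_build i N (tau : 'I_(2 ^ nb i) -> 'I_N) x :
  eval x (build tau) = ev (pull tau x).
Proof.
elim: i N tau x => [|i IH] N tau x; first by rewrite /= ffunE.
have pc k : pull (fun j => tau (sg k j)) x = pull (@sg i k) (pull tau x).
  by apply/ffunP => j; rewrite !ffunE.
have Mi := M0 i.+1.
rewrite /= /conn_of /=; case: (odd i) => /=; rewrite IH pc.
  rewrite has_map; apply/orP/existsP => [[h|/hasP[k]]|[[[|k] kM] h]].
  - by exists (Ordinal Mi).
  - rewrite mem_iota add1n prednK // => /andP[_ kM] /=; rewrite IH pc => h.
    by exists (Ordinal kM).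
  - by left.
  right; apply/hasP; exists k.+1; first by rewrite mem_iota add1n prednK.
  by rewrite /= IH pc.
rewrite all_map; apply/andP/forallP => [[h /allP hk] [[|k] kM] //|h].
  have := hk k.+1; rewrite mem_iota add1n prednK // kM => /(_ isT).
  by rewrite /= IH pc.
split; first exact: (h (Ordinal Mi)).
apply/allP => k; rewrite mem_iota add1n prednK // => /andP[_ kM] /=.
by rewrite IH pc; apply: (h (Ordinal kM)).
Qed.

Fixpoint vord i (p : seq nat) : 'I_(2 ^ nb i) :=
  if i is i'.+1 return 'I_(2 ^ nb i) then
    if p is k :: p' then sg k (vord i' p') else Ordinal (expn_gt0 2 (nb i'.+1))
  else ord0.

(** The verdict v on an input gate is passed in from outside, as its variable depends on the whole
    position and not only on the remaining part. *)
Fixpoint gchk i (p : seq nat) (l : conn + nat) (v : bool) : bool :=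
  if i is i'.+1 then
    if p is k :: p' then (k < M i) && gchk i' p' l v
    else if l is inl c then (match c, conn_of i with And, And | Or, Or => true | _, _ => false end)
    else false
  else nilp p && v.

Lemma build_label i N (tau : 'I_(2 ^ nb i) -> 'I_N) p l :
  omap (@glabel N) (subformula (build tau) p) = Some l <->
  gchk i p l (if l is inr j then j == tau (vord i p) :> nat else false).
Proof.
elim: i N tau p => [|i IH] N tau [|k p] //=.
- case: l => [c|j] /=; split => //; first by case=> ->.
  by move/eqP->.
- case: l {IH} => [c|j] /=; split => //.
  + by case=> <-; case: (conn_of _).
  + by case: c; case: (conn_of _).
have {}IH := IH N (fun j => tau (sg k j)) p.
case: k IH => [|k] IH /=; first by rewrite M0.
rewrite onthE; have [kM|kM] := ltnP k.+1 (M i.+1); last first.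
  by rewrite nth_default // !size_map size_iota; lia.
rewrite (nth_map (build (fun j => tau (sg 0 j)))) ?size_map ?size_iota; last lia.
rewrite (nth_map 0) ?size_iota; last lia.
by rewrite nth_iota ?add1n; last lia.
Qed.

End Build.

(** * Encodings of gates, and the decision procedure for wires *)

Lemma val2_pos_bits p : val2 (map Some (pos_bits p)) = nat_of_pos p.
Proof. by elim: p => //= p IH; rewrite IH ?NatTrec.trecE. Qed.

Lemma val2_enc n : val2 (enc_nat n) = n.
Proof.
rewrite -[RHS](bin_of_natK n) /enc_nat /nat_bits.
by case: bin_of_nat => //= p; rewrite val2_pos_bits.
Qed.

Lemma enc_nat_inj : injective enc_nat.
Proof. exact: can_inj val2_enc. Qed.

Lemma None_enc n : None \notin enc_nat n.
Proof. by apply/mapP => -[]. Qed.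

Lemma pos_bits_ge p : 2 ^ (size (pos_bits p)).-1 <= nat_of_pos p.
Proof.
have s0 q : size (pos_bits q) = (size (pos_bits q)).-1.+1 by case: q.
by elim: p => //= p IH; rewrite s0 expnS; lia.
Qed.

(** Because of this, fan-ins that are powers of two need not be computed to be compared with:
    lengths suffice. *)
Lemma size_enc_nat n t : (n < 2 ^ t) = (size (enc_nat n) <= t).
Proof.
apply/idP/idP => [h|h]; last first.
  rewrite -{1}(val2_enc n); apply: leq_trans (val2_lt _) _.
  by rewrite leq_pexp2l.
move: h; rewrite -{1}(bin_of_natK n) /enc_nat /nat_bits size_map.
case: bin_of_nat => //= p /(leq_ltn_trans (pos_bits_ge p)).
by rewrite ltn_exp2l //; lia.
Qed.

Definition enc_pos (p : seq nat) : W := flatten [seq rcons (enc_nat k) None | k <- p].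

Lemma enc_pos_cons k p : enc_pos (k :: p) = enc_nat k ++ None :: enc_pos p.
Proof. by rewrite /enc_pos /= cat_rcons. Qed.

Lemma before_block (u r : W) : None \notin u -> before (u ++ None :: r) = u.
Proof.
by elim: u => //= a u IH; rewrite inE negb_or eq_sym => /andP[/negPf -> /IH ->].
Qed.

Lemma after_block (u r : W) : None \notin u -> after (u ++ None :: r) = r.
Proof.
by elim: u => //= a u IH; rewrite inE negb_or eq_sym => /andP[/negPf -> /IH ->].
Qed.

Lemma None_label l : None \notin enc_label l.
Proof. by case: l => [[]|n] //=; rewrite inE /= None_enc. Qed.

Lemma enc_posE g : after (enc_gate g) = enc_pos g.2.
Proof. by rewrite /enc_gate after_block // None_label. Qed.

Lemma enc_labelE g : before (enc_gate g) = enc_label g.1.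
Proof. by rewrite /enc_gate before_block // None_label. Qed.

Lemma nilp_enc_pos p : nilp (enc_pos p) = nilp p.
Proof. by case: p => // k p; rewrite enc_pos_cons /nilp size_cat addnS. Qed.

Lemma bits_val2 (w : W) : None \notin w -> bits (size w) (val2 w) = w.
Proof.
move=> wN; apply: (@eq_from_nth _ None); first by rewrite size_mkseq.
move=> i; rewrite size_mkseq => iw; rewrite nth_mkseq //.
elim: w wN i iw => // a w IH; rewrite inE negb_or eq_sym => /andP[aN /IH {}IH].
case=> [|i] iw /=.
  by rewrite divn1 oddD odd_double addbF; case: a aN {iw} => [[]|].
by rewrite -IH // expnS divnMA divn2 half_bit_double.
Qed.

Lemma drop_block (u x y : W) :
  drop (size (u ++ None :: x)) (u ++ None :: y) = drop (size x) y.
Proof. by elim: u. Qed.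

Definition adjW (x y : W) : bool :=
  [&& prefix x y, ~~ nilp (drop (size x) y) & nilp (after (drop (size x) y))].

Lemma PTB_adjW f g : PT f -> PT g -> PTB (fun e => adjW (f e) (g e)).
Proof. by move=> hf hg; rewrite /adjW; pt. Qed.
#[export] Hint Resolve PTB_adjW : pt.

Lemma adjWE p q : adjW (enc_pos p) (enc_pos q) <-> exists k, q = rcons p k.
Proof.
elim: p q => [|k p IH] [|l q].
- by split=> // -[].
- rewrite /adjW drop0 nilp_enc_pos prefix0s /= enc_pos_cons after_block ?None_enc //.
  rewrite nilp_enc_pos; split; first by case: q => // _; exists l.
  by case=> c [_ ->].
- split=> [/and3P[/prefixP[z]]|[c]]; last by [].
  by rewrite enc_pos_cons; case: (enc_nat k).
rewrite /adjW !enc_pos_cons.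
have e : prefix (enc_nat k ++ None :: enc_pos p) (enc_nat l ++ None :: enc_pos q) =
    (k == l) && prefix (enc_pos p) (enc_pos q).
  apply/prefixP/andP => [[z E]|[/eqP-> /prefixP[z ->]]]; last first.
    by exists z; rewrite -catA.
  rewrite -catA /= in E; have := congr1 before E; have := congr1 after E.
  rewrite !after_block ?None_enc // !before_block ?None_enc // => -> /enc_nat_inj ->.
  by rewrite eqxx prefix_prefix.
rewrite e; split.
  case/and3P=> /andP[/eqP <- h1].
  rewrite drop_block => h2 h3; have /IH[c ->] : adjW (enc_pos p) (enc_pos q) by apply/and3P.
  by exists c.
case=> c [<- Eq]; have /IH/and3P[h1 h2 h3] : exists c, q = rcons p c by exists c.
by apply/and3P; rewrite eqxx h1 drop_block.
Qed.

Section GateCheck.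
Variables (M s : nat -> nat) (HW : nat -> W -> W -> W) (lt : nat -> W -> bool).

(** The counterpart of [vord] on strings: the index of the variable reached by a position, with the
    index inside the child in the low bits and the hash in the high bits. *)
Fixpoint JW i (r : W) : W :=
  if i is i'.+1 then JW i' (after r) ++ HW i (before r) (JW i' (after r)) else [::].

Fixpoint chkW i (r lab : W) (v : bool) : bool :=
  if i is i'.+1 then
    if nilp r then lab == enc_label (inl (conn_of i))
    else lt i (before r) && chkW i' (after r) lab v
  else nilp r && v.

(** The index found by [JW] may have leading zeros, unlike the one in the label, so equality is
    tested by two comparisons of values. *)
Definition gateW d (g : W) : bool :=
  chkW d (after g) (before g) (tt (before g) &&
    (~~ lessW (behead (before g)) (JW d (after g)) && ~~ lessW (JW d (after g)) (behead (before g)))).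

Definition wireW d (g h : W) : bool :=
  gateW d g && gateW d h && (adjW (after g) (after h) || adjW (after h) (after g)).

Hypothesis sHW : forall i k j, size (HW i.+1 k j) = s i.+1.
Hypothesis NHW : forall i k j, None \notin k -> None \notin HW i.+1 k j.
Hypothesis M0 : forall i, 0 < M i.

Lemma JWE i p : size p = i -> [/\ size (JW i (enc_pos p)) = nb s i,
  None \notin JW i (enc_pos p) & val2 (JW i (enc_pos p)) = vord s HW i p].
Proof.
elim: i p => [|i IH] [|k p] //= [sp]; have [h1 h2 h3] := IH p sp.
rewrite enc_pos_cons after_block ?None_enc // before_block ?None_enc //.
split; first by rewrite size_cat h1 sHW.
  by rewrite mem_cat negb_or h2 NHW ?None_enc.
have hb : bits (nb s i) (vord s HW i p) = JW i (enc_pos p) by rewrite -h3 -h1 bits_val2.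
rewrite val2_cat h1 h3 /hnat hb modn_small //.
by rewrite -(sHW i (enc_nat k) (JW i (enc_pos p))) val2_lt.
Qed.

Hypothesis ltE : forall i k, lt i.+1 (enc_nat k) = (k < M i.+1).

Lemma chkWE i p l v : chkW i (enc_pos p) (enc_label l) v = gchk M i p l v.
Proof.
elim: i p => [|i IH] [|k p] //=; rewrite ?nilp_enc_pos //.
  by rewrite /conn_of; case: l {IH} => [[]|n]; case: (odd _).
by rewrite enc_pos_cons after_block ?before_block ?None_enc // ltE IH.
Qed.

(** v is consulted only at positions of length i, and it is for these that [JWE] identifies the
    variable. *)
Lemma eq_gchk i p l v v' : (size p = i -> v = v') -> gchk M i p l v = gchk M i p l v'.
Proof.
elim: i p => [|i IH] [|k p] //= h; first by rewrite h.
by congr andb; apply: IH => sp; apply: h; rewrite sp.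
Qed.

Lemma gateWE d g : gateW d (enc_gate g) <->
  is_gate (build M (s := s) HW (i := d) id) g.
Proof.
rewrite /is_gate build_label // /gateW enc_posE enc_labelE chkWE.
rewrite (@eq_gchk _ _ _ _ (if g.1 is inr j then j == vord s HW d g.2 :> nat else false)) //.
move=> /JWE[_ _ h]; rewrite !lessWE h; case: g.1 => [[]|n] //=.
by rewrite val2_enc -!leqNgt -eqn_leq eq_sym.
Qed.

Lemma wireWE d g h : wireW d (enc_gate g) (enc_gate h) <->
  wire (build M (s := s) HW (i := d) id) g h.
Proof.
rewrite /wireW !enc_posE; split.
  case/andP=> /andP[/gateWE hg /gateWE hh] hadj; split => //.
  by case/orP: hadj => /adjWE[k E]; exists k; [right | left].
case=> /gateWE -> /gateWE -> [k [E|E]] /=; apply/orP; [right|left];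
by apply/adjWE; exists k.
Qed.

End GateCheck.

Section GateCheckPT.
Variables (HW : env -> nat -> W -> W -> W) (lt : env -> nat -> W -> bool).
Hypothesis pHW : forall i f g, PT f -> PT g -> PT (fun e => HW e i (f e) (g e)).
Hypothesis plt : forall i f, PT f -> PTB (fun e => lt e i (f e)).

Lemma PT_JW i f : PT f -> PT (fun e => JW (HW e) i (f e)).
Proof.
elim: i f => [|i IH] f hf /=; first by pt.
have h := IH _ (PT_after hf); apply: PT_cat => //.
by apply: pHW => //; pt.
Qed.

Lemma PTB_chkW i f g v : PT f -> PT g -> PTB v ->
  PTB (fun e => chkW (lt e) i (f e) (g e) (v e)).
Proof.
elim: i f => [|i IH] f hf hg hv /=; first by pt.
apply: PTB_if; [by pt | by apply: PTB_eq; pt |].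
by apply: PTB_and; [apply: plt; pt | apply: IH => //; pt].
Qed.

Lemma PTB_gateW d f : PT f -> PTB (fun e => gateW (HW e) (lt e) d (f e)).
Proof.
move=> hf; rewrite /gateW; apply: PTB_chkW; try by pt.
by have := PT_JW d (PT_after hf); pt.
Qed.

Lemma PTB_wireW d f g : PT f -> PT g ->
  PTB (fun e => wireW (HW e) (lt e) d (f e) (g e)).
Proof.
move=> hf hg; rewrite /wireW.
have := PTB_gateW d hf; have := PTB_gateW d hg; pt.
Qed.

End GateCheckPT.

(** * The field GF(2)[X]/(X^(2h) + X^h + 1) *)

Section TwoPowers.

Lemma pow_1p3 l u f : exists2 v, (1 + 3 ^ l.+1 * u) ^ f = 1 + 3 ^ l.+1 * v & v = f * u %[mod 3].
Proof.
elim: f => [|f [v IH hv]]; first by exists 0; rewrite ?muln0.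
exists (v + u + 3 * (3 ^ l * u * v)).
  by rewrite expnS IH expnS; nia.
by rewrite addnC (mulnC 3) modnMDl -modnDml hv modnDml mulSn addnC.
Qed.

(** Cubing 1 + 3^(l+1) u gives 1 + 3^(l+2) u' with u' = u mod 3. That u = 1 mod 3 says that the
    power of 3 is exact. *)
Lemma pow4_3 l : exists2 u, 2 ^ (2 * 3 ^ l) = 1 + 3 ^ l.+1 * u & u = 1 %[mod 3].
Proof.
elim: l => [|l [u IH hu]]; first by exists 1.
exists (u + 3 * (3 ^ l * u ^ 2 + 3 ^ l * 3 ^ l * u ^ 3)).
  rewrite [3 ^ l.+1]expnS mulnCA mulnC expnM IH !expnS; nia.
by rewrite addnC (mulnC 3) modnMDl.
Qed.

(** By induction e = 2 3^l f. Then 2^e = 1 + 3^(l+1) v with v = f mod 3, so that 3 has to divide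
    f. *)
Lemma order2_mod3 l e : 2 ^ e = 1 %[mod 3 ^ l.+1] -> 2 * 3 ^ l %| e.
Proof.
elim: l e => [|l IH] e he.
  rewrite expn0 muln1 dvdn2; apply/negP => oe; move: he.
  rewrite -[e]odd_double_half oe expnD -mul2n expnM -modnMmr -modnXm.
  by rewrite (_ : 2 ^ 2 %% 3 ^ 1 = 1) // exp1n.
have /IH /dvdnP[f Ef] : 2 ^ e = 1 %[mod 3 ^ l.+1].
  by rewrite -(@modn_dvdm (3 ^ l.+2)) ?he ?modn_dvdm // dvdn_exp2l.
have [u hu u1] := pow4_3 l; have [v hv v1] := pow_1p3 l u f.
move: he; rewrite Ef mulnC expnM hu hv => /eqP; rewrite eqn_mod_dvd ?leq_addr // addKn.
rewrite [3 ^ l.+2]expnSr dvdn_pmul2l ?expn_gt0 // => h3.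
have : 3 %| f.
  by move: h3; rewrite /dvdn v1 -modnMmr u1 modnMmr muln1.
by case/dvdnP=> g ->; apply/dvdnP; exists g; rewrite expnS; nia.
Qed.

End TwoPowers.

Section BinaryField.
Local Open Scope ring_scope.

Section Iota.
Variables (F : fieldType) (xi : F) (h : W).
Hypothesis char2 : (2%:R : F) = 0.

(** The polynomial with coefficients w, evaluated at x. At a root of the modulus it turns the
    operations on strings into those of an abstract finite field, where roots of polynomials can be
    counted. *)
Definition iota2 (x : F) (w : W) : F := foldr (fun a y => (tr a)%:R + x * y) 0 w.
Local Notation io := (iota2 xi).

Lemma addb2 (a b : bool) : ((a (+) b)%:R : F) = a%:R + b%:R.
Proof. by case: a; case: b => //=; rewrite ?addr0 ?add0r // -[1 + 1]/(2%:R) char2. Qed.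

Lemma add22 (x : F) : x + x = 0.
Proof. by rewrite -mulr2n -mulr_natl char2 mul0r. Qed.

Lemma iota_sq x w : iota2 x w ^+ 2 = iota2 (x ^+ 2) w.
Proof.
elim: w => [|a w IH] /=; first by rewrite expr0n.
rewrite sqrrD mulr2n add22 addr0 -IH exprMn.
by case: (tr a); rewrite ?expr1n ?expr0n.
Qed.

Lemma iota_nseq n : io (nseq n (Some false)) = 0.
Proof. by elim: n => //= n ->; rewrite mulr0 addr0. Qed.

Lemma iota_cat u w : io (u ++ w) = io u + xi ^+ size u * io w.
Proof.
elim: u => [|a u IH] /=; first by rewrite mul1r add0r.
by rewrite IH mulrDr exprS mulrA addrA.
Qed.

Lemma iota_xor (x y : W) : (size y <= size x)%N -> io (xorW x y) = io x + io y.
Proof.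
elim: x y => [|a x IH] [|b y] //= xy; first by rewrite addr0.
  rewrite IH //= addr0 /tt /= [tr (Some _)]/(_ == _).
  by case: (tr a); rewrite /tr /= addr0.
rewrite IH // -[tt (b :: y)]/(tr b) [tr (Some _)](_ : _ = tr a (+) tr b); last by case: (_ (+) _).
by rewrite addb2 mulrDr addrACA.
Qed.

Lemma iota_val2 u w : val2 u = val2 w -> io u = io w.
Proof.
elim: u w => [|a u IH] w /=.
  elim: w => //= b w IHw hv; rewrite -IHw; last by lia.
  have -> : tr b = false by move: hv; case: (tr b); lia.
  by rewrite mulr0 addr0.
case: w => [|b w] /= hv.
  rewrite (IH [::]) /= ?mulr0 ?addr0; last by lia.
  by have -> : tr a = false by move: hv; case: (tr a); lia.
have hab : tr a = tr b by move: hv; case: (tr a); case: (tr b); lia.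
by rewrite hab (IH w) //; move: hv; rewrite hab; lia.
Qed.

Hypothesis h0 : (0 < size h)%N.
Hypothesis xiE : xi ^+ (size h + size h) = 1 + xi ^+ size h.

Lemma iota_red_mask : io (red_mask h) = 1 + xi ^+ size h.
Proof.
rewrite /red_mask /= iota_cat iota_nseq add0r size_nseq /= iota_nseq mulr0 addr0 mulr1.
by rewrite -exprS size_behead prednK.
Qed.

Lemma size_red_mask : size (red_mask h) = (size h + size h)%N.
Proof. by rewrite /red_mask /= size_cat /= !size_nseq size_behead; lia. Qed.

Lemma iota_mulx v : size v = (size h + size h)%N -> io (mulx h v) = xi * io v.
Proof.
case/lastP: v => [|v a]; first by rewrite /=; lia.
rewrite size_rcons => sv.
have e : take (size (rcons v a)) (Some false :: rcons v a) = Some false :: v.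
  by rewrite size_rcons /= -cats1 take_size_cat.
have ev : io (rcons v a) = io v + xi ^+ size v * (tr a)%:R.
  by rewrite -cats1 iota_cat /= mulr0 addr0.
rewrite /mulx e rev_rcons ev mulrDr mulrA -exprS sv xiE -[tt _]/(tr a).
case: (tr a); last by rewrite /= mulr0 addr0 add0r.
have sm : (size (red_mask h) <= size (Some false :: v))%N by rewrite size_red_mask /= sv.
by rewrite iota_xor // iota_red_mask /= add0r mulr1.
Qed.

Lemma iota_mulW u v : size v = (size h + size h)%N -> io (mulW h u v) = io u * io v.
Proof.
move=> sv; elim: u => [|a u IH]; first by rewrite /mulW /= iota_nseq mul0r.
have -> : mulW h (a :: u) v = if tr a then xorW (mulx h (mulW h u v)) v
    else mulx h (mulW h u v) by rewrite /mulW rev_cons foldl_rcons.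
have em : io (mulx h (mulW h u v)) = xi * io u * io v.
  by rewrite iota_mulx ?size_mulW // IH mulrA.
rewrite /= mulrDl; case: (tr a) => /=; last by rewrite mul0r add0r.
by rewrite iota_xor ?size_mulx ?size_mulW // em mul1r addrC.
Qed.

Lemma size_oneW : size (oneW h) = (size h + size h)%N.
Proof. by rewrite /= size_nseq size_behead size_cat; lia. Qed.

Definition chunk (k : W) c : W := take (size (h ++ h)) (drop (c * size (h ++ h))%N k).

Lemma iota_hash j k : io (hashW h j k) = \sum_(c < size k) io (chunk k c) * io j ^+ c.
Proof.
suff H l : let r := hash_state h j k l in
  [/\ io r.1.1 = \sum_(c < size l) io (chunk k c) * io j ^+ c,
      io r.1.2 = io j ^+ size l & r.2 = drop (size l * size (h ++ h))%N k].
  by case: (H k).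
elim/last_ind: l => [|l a].
  by rewrite /= big_ord0 iota_nseq mul0n drop0 -/(oneW h) -[X in _ + xi * X]/(io _) iota_nseq mulr0 addr0.
have [s1 s2 _] := size_hash_state h j k l; move: s1 s2.
rewrite /hash_state fold3_rcons /= -/(hash_state h j k l) size_rcons.
move: (hash_state _ _ _ _) => [[acc pow] rest] /= s1 s2 [h1 h2 h3].
have sp : size pow = (size h + size h)%N by rewrite s2 -size_oneW.
split.
- rewrite /hash1 iota_xor ?size_mulW ?s1 ?sp ?size_cat // h1 iota_mulW // h2 h3.
  by rewrite big_ord_recr /chunk size_cat.
- by rewrite iota_mulW // h2 exprS.
by rewrite h3 drop_drop mulSn.
Qed.

End Iota.

(* 2 has order 2 * 3^l modulo 3^(l+1), so the conjugates of a primitive root of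
   unity of order 3^(l+1) are as many as the degree of X^(2h) + X^h + 1. *)
Lemma binary_field l : exists (F : finFieldType) (xi : F),
  [/\ (2%:R : F) = 0, xi ^+ (3 ^ l + 3 ^ l) = 1 + xi ^+ (3 ^ l) &
      forall w, (size w <= 3 ^ l + 3 ^ l)%N -> iota2 xi w = 0 -> val2 w = 0%N].
Proof.
have h0 : (0 < 3 ^ l)%N by rewrite expn_gt0.
have k0 : (0 < 2 * 3 ^ l)%N by rewrite muln_gt0.
(* By [pow4_3] the multiplicative group of the field with 2^(2 3^l) elements has order divisible by
   3^(l+1). *)
have [F pF cF] := pPrimePowerField (isT : prime 2) k0.
have c2 : (2%:R : F) = 0 by case/andP: pF => _ /eqP.
pose n := (3 ^ l.+1)%N; pose q := #|F|.-1.
have ndiv : (n %| q)%N.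
  have [u hu _] := pow4_3 l; rewrite /q cF hu add1n /=; exact: dvdn_mulr.
have q0 : (0 < q)%N.
  rewrite /q cF -subn1 subn_gt0; apply: (@leq_trans (2 ^ 1)%N) => //.
  by rewrite leq_pexp2l.
pose rs := [seq x <- enum F | x != 0].
have urs : uniq rs by rewrite filter_uniq // enum_uniq.
have srs : size rs = q.
  rewrite /q -(cardC1 (0 : F)) cardE /rs; congr size.
  by rewrite enumT.
have ars : all q.-unity_root rs.
  apply/allP => x; rewrite mem_filter unity_rootE => /andP[x0 _].
  rewrite -(inj_eq (mulfI x0)) mulr1 -exprS /q prednK ?expf_card //.
  by rewrite cF expn_gt0.
have /hasP[z _ pz] : has q.-primitive_root rs.
  by apply: has_prim_root; rewrite ?srs.
pose xi := z ^+ (q %/ n).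
have pxi : n.-primitive_root xi by apply: dvdn_prim_root.
have xi1 : xi ^+ (3 ^ l) != 1.
  rewrite -(prim_order_dvd pxi) gtnNdvd // /n expnS; lia.
(* xi^(3^l) is a cube root of unity other than 1, hence a root of 1 + X + X^2. *)
have xi2 : xi ^+ (3 ^ l + 3 ^ l) = 1 + xi ^+ (3 ^ l).
  have h3 : xi ^+ (3 ^ l) ^+ 3 = 1 by rewrite -exprM mulnC -expnS prim_expr_order.
  have : (xi ^+ (3 ^ l) - 1) * (1 + xi ^+ (3 ^ l) + xi ^+ (3 ^ l) ^+ 2) = 0.
    rewrite -[RHS](subrr 1) -{3}h3.
    by move: (xi ^+ _) => y; ring.
  move/eqP; rewrite mulf_eq0 subr_eq0 (negPf xi1) /= => /eqP h4.
  by rewrite exprD -expr2 -[LHS]add0r -h4 -addrA add22 ?addr0.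
exists F, xi; split => // w sw io0.
pose p := Poly [seq ((tr a)%:R : F) | a <- w].
have hp x : p.[x] = iota2 x w.
  rewrite /p; elim: (w) => [|a v IH] /=; first by rewrite horner0.
  by rewrite horner_cons IH mulrC addrC.
(* The coefficients of p are in GF(2), so its set of roots is closed under squaring. A nonzero p
   would have more roots than its degree allows. *)
have p0 : p = 0.
  apply/eqP/negP => /negP pn0.
  pose ys := [seq xi ^+ (2 ^ i) | i <- iota 0 (3 ^ l + 3 ^ l)].
  have := @max_poly_roots _ p ys pn0 _ _.
  rewrite size_map size_iota => H.
  suff : (3 ^ l + 3 ^ l < size p)%N.
    by rewrite ltnNge (leq_trans (size_Poly _)) // size_map.
  apply: H.
    apply/allP => y /mapP[i _ ->]; rewrite /root hp; apply/eqP.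
    elim: i => [|i IH]; first by rewrite expr1.
    by rewrite expnS mulnC exprM -iota_sq // IH expr0n.
  rewrite map_inj_in_uniq ?iota_uniq // => i j; rewrite !mem_iota !add0n.
  wlog ij : i j / (i <= j)%N.
    by move=> H hi hj E; case: (leqP i j) => [|/ltnW] ij; [|apply/esym]; apply: H.
  move=> /andP[_ hi] /andP[_ hj] /eqP; rewrite (eq_prim_root_expr pxi).
  rewrite eq_sym eqn_mod_dvd ?leq_pexp2l // -{1}(subnKC ij) expnD -{2}[(2 ^ i)%N]muln1 -mulnBr.
  rewrite Gauss_dvdr ?coprimeXl ?coprimeXr // -eqn_mod_dvd ?expn_gt0 // => /eqP/order2_mod3.
  by move=> /dvdn_leq; case: (posnP (j - i)) => h1 h2; [lia | have := h2 isT; lia].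
have tr0 i : tr (nth None w i) = false.
  have [iw|iw] := ltnP i (size w); last by rewrite nth_default.
  have := congr1 (fun r : {poly F} => r`_i) p0; rewrite coef_Poly coef0 (nth_map None) //.
  by case: (tr _) => // /eqP; rewrite oner_eq0.
elim: (w) tr0 => //= a v IH tr0; rewrite (tr0 0) IH // => i.
exact: (tr0 i.+1).
Qed.

End BinaryField.

(** * Different copies rarely share variables *)

Lemma val2_bits n j : j < 2 ^ n -> val2 (bits n j) = j.
Proof.
rewrite size_enc_nat => h.
pose w := enc_nat j ++ nseq (n - size (enc_nat j)) (Some false).
have sw : size w = n by rewrite size_cat size_nseq subnKC.
have vw : val2 w = j by rewrite val2_cat val2_nseq muln0 addn0 val2_enc.
rewrite -{1}sw -{1}vw bits_val2 //.
by rewrite mem_cat negb_or None_enc mem_nseq andbF.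
Qed.

Lemma val2_take_drop n (w : W) :
  val2 (take n w) = val2 w %% 2 ^ n /\ val2 (drop n w) = val2 w %/ 2 ^ n.
Proof.
have [nw|nw] := leqP n (size w); last first.
  have h : val2 w < 2 ^ n by rewrite (leq_trans (val2_lt w)) // leq_pexp2l // ltnW.
  by rewrite take_oversize ?drop_oversize ?(ltnW nw) // modn_small ?divn_small.
have st : size (take n w) = n by rewrite size_takel.
have h : val2 (take n w) < 2 ^ n by rewrite -{2}st val2_lt.
rewrite -[w in RHS](cat_take_drop n) -[X in _ /\ _ = val2 X %/ _](cat_take_drop n w).
rewrite val2_cat st addnC mulnC modnMDl modn_small // divnMDl ?expn_gt0 //.
by rewrite divn_small // addn0.
Qed.

Lemma eq_digits K k k' t : k %/ K ^ t = k' %/ K ^ t ->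
  (forall c, c < t -> k %/ K ^ c %% K = k' %/ K ^ c %% K) -> k = k'.
Proof.
elim: t => [|t IH] ht hd; first by rewrite -[k]divn1 ht divn1.
apply: IH => [|c ct]; last by apply: hd; rewrite ltnW.
rewrite [LHS](divn_eq _ K) [RHS](divn_eq _ K) -!divnMA -expnSr ht hd //.
Qed.

Lemma xorW0 (u v : W) : size u = size v -> val2 (xorW u v) = 0 -> val2 u = val2 v.
Proof.
elim: u v => [|a u IH] [|b v] //= [suv].
rewrite [tr (Some _)](_ : _ = tr a (+) tr b); last by rewrite /tr /tt; case: (_ (+) _).
move=> h; have hab : tr a = tr b by move: h; case: (tr a); case: (tr b) => //=; lia.
by rewrite hab (IH v) //; move: h; rewrite hab addbb; lia.
Qed.

Section Agree.
Local Open Scope ring_scope.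
Variables (l : nat) (h : W).
Hypothesis hl : size h = (3 ^ l)%N.
Let s := (3 ^ l + 3 ^ l)%N.

(* P_k - P_k' vanishes at |T| points, and its degree is less than |T| once the
   upper digits of k and k' agree. *)
Lemma hash_agree n k k' (T : seq nat) : (n <= s)%N -> uniq T ->
  (forall j, j \in T -> (j < 2 ^ n)%N /\
     hashW h (bits n j) (enc_nat k) = hashW h (bits n j) (enc_nat k')) ->
  (k %/ (2 ^ s) ^ size T = k' %/ (2 ^ s) ^ size T)%N -> k = k'.
Proof.
move=> ns uT hT hdiv.
have [F [xi [c2 hxi inj0]]] := binary_field l.
have h0 : (0 < size h)%N by rewrite hl expn_gt0.
have xiE : xi ^+ (size h + size h) = 1 + xi ^+ size h by rewrite hl.
have s0 : (0 < s)%N by rewrite /s addn_gt0 expn_gt0.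
have shh : size (h ++ h) = s by rewrite size_cat hl.
pose io := iota2 xi.
(* Evaluation at [xi] separates numbers of at most s bits: the xor of the padded strings is sent to
   0 only if it is 0. *)
have inj u v : (size u <= s)%N -> (size v <= s)%N -> io u = io v -> val2 u = val2 v.
  move=> su sv E; pose pad w : W := w ++ nseq (s - size w) (Some false).
  have vp w : val2 (pad w) = val2 w by rewrite val2_cat val2_nseq muln0 addn0.
  have sp w : (size w <= s)%N -> size (pad w) = s.
    by move=> sw; rewrite size_cat size_nseq subnKC.
  rewrite -(vp u) -(vp v); apply: xorW0; first by rewrite !sp.
  apply: inj0; first by rewrite size_xorW sp.
  rewrite iota_xor ?sp // (iota_val2 xi (vp u)) (iota_val2 xi (vp v)) -/(io u) E.
  by rewrite (add22 c2).
pose P k : {poly F} := \poly_(c < size (enc_nat k)) io (chunk h (enc_nat k) c).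
have vchunk k1 c : val2 (chunk h (enc_nat k1) c) = ((k1 %/ (2 ^ s) ^ c) %% 2 ^ s)%N.
  rewrite /chunk shh; have [-> _] := val2_take_drop s (drop (c * s) (enc_nat k1)).
  have [_ ->] := val2_take_drop (c * s) (enc_nat k1).
  by rewrite val2_enc mulnC expnM.
have coefP k1 c : (P k1)`_c = io (chunk h (enc_nat k1) c).
  rewrite coef_poly; case: ltnP => // hc.
  rewrite /chunk drop_oversize // (leq_trans hc) // leq_pmulr // shh //.
have evalP k1 j : (P k1).[io j] = io (hashW h j (enc_nat k1)).
  by rewrite horner_poly /io iota_hash.
pose D : {poly F} := P k - P k'.
have D0 : D = 0.
  apply/eqP/negP => /negP D0.
  pose ys := [seq io (bits n j) | j <- T].
  have sD : (size D <= size T)%N.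
    apply/leq_sizeP => c hc; rewrite /D coefB !coefP.
    suff -> : io (chunk h (enc_nat k) c) = io (chunk h (enc_nat k') c) by rewrite subrr.
    apply: iota_val2; rewrite !vchunk; congr modn.
    by rewrite -(subnKC hc) expnD !divnMA hdiv.
  have := @max_poly_roots _ D ys D0 _ _.
  rewrite size_map => H.
  suff : (size T < size D)%N by rewrite ltnNge sD.
  apply: H.
    apply/allP => y /mapP[j /hT[_ hj] ->].
    by rewrite /root /D hornerD hornerN !evalP hj subrr.
  rewrite map_inj_in_uniq // => i j /hT[hi _] /hT[hj _] E.
  have := inj (bits n i) (bits n j); rewrite !size_mkseq => /(_ ns ns E).
  by rewrite !val2_bits.
apply: eq_digits hdiv _ => c _; rewrite -!vchunk; apply: inj.
- by rewrite size_take_min shh geq_minl.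
- by rewrite size_take_min shh geq_minl.
by rewrite -!coefP (subr0_eq D0).
Qed.

End Agree.

(** Among K^|T| consecutive numbers at most one belongs to a copy that agrees with k on T. Counting
    k itself as such a copy makes up for an incomplete last block, so no additive error is left. *)
Lemma card_agree (M K N : nat) (k : 'I_M) (S : 'I_M -> {set 'I_N}) (T : {set 'I_N}) :
  0 < K -> T != set0 ->
  (forall l l' : 'I_M, (l == k) || (T \subset S l) -> (l' == k) || (T \subset S l') ->
     l %/ K ^ #|T| = l' %/ K ^ #|T| -> l = l') ->
  #|[set l | (l != k) && (T \subset S l)]| * K ^ #|T| <= M.
Proof.
move=> K0 T0 hinj; set A := [set l | _]; set q := K ^ #|T|.
have M0 : 0 < M by apply: leq_trans (ltn_ord k).
have q0 : 0 < q by rewrite expn_gt0 K0.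
have kA : k \notin A by rewrite inE eqxx.
have hlt (l : 'I_M) : l %/ q < (M.-1 %/ q).+1.
  by rewrite ltnS leq_div2r // -ltnS prednK.
have : #|k |: A| <= (M.-1 %/ q).+1.
  rewrite -[leqRHS]card_ord.
  rewrite -(@card_in_imset _ _ (fun l => Ordinal (hlt l))); first exact: max_card.
  move=> l l' hl hl' /(congr1 val) /= E; apply: hinj => //.
    by move: hl; rewrite !inE; case: eqP => //= _ /andP[].
  by move: hl'; rewrite !inE; case: eqP => //= _ /andP[].
rewrite cardsU1 kA add1n ltnS => h.
apply: (@leq_trans (M.-1 %/ q * q)); first by rewrite leq_mul2r h orbT.
by apply: leq_trans (leq_divM _ _) (leq_pred _).
Qed.

Section SumShared.
Local Open Scope ring_scope.

Lemma sum_subsets (R : comPzRingType) (N : nat) (x : R) :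
  \sum_(T : {set 'I_N}) x ^+ #|T| = (1 + x) ^+ N.
Proof.
rewrite -[RHS](_ : \prod_(i < N) (x + 1) = _); last first.
  by rewrite prodr_const card_ord addrC.
rewrite bigA_distr; apply: eq_bigr => T _.
by rewrite -big_mkcondr /= prodr_const.
Qed.

(** be^|S_l| is one of the terms be^|T| with T a nonempty subset of S_l. After exchanging the sums,
    each T belongs to few l by assumption, and what remains is a binomial expansion. *)
Lemma sum_shared (R : realFieldType) (N M K : nat) (S : 'I_M -> {set 'I_N})
    (k : 'I_M) (be : R) : (0 < K)%N -> 0 <= be ->
  (forall T, T != set0 ->
     (#|[set l | (l != k) && (T \subset S l)]| * K ^ #|T| <= M)%N) ->
  \sum_(l < M | (l != k) && (S l != set0)) be ^+ #|S l| <=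
    M%:R * ((1 + be / K%:R) ^+ N - 1).
Proof.
move=> K0 be0 hT; have K0' : 0 < K%:R :> R by rewrite ltr0n.
apply: (@le_trans _ _ (\sum_(l < M | l != k) \sum_(T : {set 'I_N} | (T != set0) && (T \subset S l)) be ^+ #|T|)).
  rewrite big_mkcondr; apply: ler_sum => l _; case: ifP => Sl; last first.
    by apply: sumr_ge0 => T _; apply: exprn_ge0.
  rewrite (bigD1 (S l)) ?Sl ?subxx //= lerDl.
  by apply: sumr_ge0 => T _; apply: exprn_ge0.
rewrite (exchange_big_dep (fun T => T != set0)) /=; last by move=> l T _ /andP[].
apply: (@le_trans _ _ (\sum_(T : {set 'I_N} | T != set0) M%:R * (be / K%:R) ^+ #|T|)).
  apply: ler_sum => T T0; rewrite (eq_bigl (mem [set l | (l != k) && (T \subset S l)])).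
    rewrite sumr_const expr_div_n mulrA ler_pdivlMr ?exprn_gt0 //.
    rewrite -[_ *+ #|_|]mulr_natl mulrAC ler_wpM2r ?exprn_ge0 //.
    by rewrite -natrX -natrM ler_nat hT.
  by move=> l; rewrite !inE T0.
rewrite -mulr_sumr ler_wpM2l // -sum_subsets [X in _ <= X - 1](bigD1 set0) //=.
by rewrite cards0 expr0 addrAC subrr add0r.
Qed.

End SumShared.

(** * Growth of the bias from level to level; the depth is d + 2 *)

Section Powers.
Local Open Scope ring_scope.
Variable R : realType.
Implicit Types (x y c eta : R).

Lemma bernoulli x n : -1 <= x -> 1 + n%:R * x <= (1 + x) ^+ n.
Proof.
move=> x1; elim: n => [|n IH]; first by rewrite mul0r addr0.
have x2 : 0 <= 1 + x by rewrite -lerBlDl sub0r.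
rewrite exprS; apply: le_trans (ler_wpM2l x2 IH).
rewrite -natr1 -subr_ge0 [X in 0 <= X](_ : _ = n%:R * x ^+ 2); last by ring.
by rewrite mulr_ge0 ?sqr_ge0.
Qed.

Lemma pow_1mx_le x n : 0 <= x <= 1 -> (1 - x) ^+ n <= (1 + n%:R * x)^-1.
Proof.
case/andP=> x0 x1; have n0 : 0 <= n%:R * x by rewrite mulr_ge0.
rewrite -[leRHS]mul1r ler_pdivlMr; last by rewrite ltr_wpDr.
apply: (@le_trans _ _ ((1 - x) ^+ n * (1 + x) ^+ n)).
  apply: ler_wpM2l; first by rewrite exprn_ge0 ?subr_ge0.
  by apply: bernoulli; apply: le_trans x0; rewrite oppr_le0.
rewrite -exprMn; apply: exprn_ile1; first by rewrite mulr_ge0 ?subr_ge0 ?addr_ge0.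
by rewrite -subr_ge0 [X in 0 <= X](_ : _ = x ^+ 2) ?sqr_ge0 //; ring.
Qed.

Lemma lerX n x y : 0 <= x -> x <= y -> x ^+ n <= y ^+ n.
Proof. by move=> x0 xy; apply: lerXn2r; rewrite ?nnegrE // (le_trans x0). Qed.

Lemma step_ge c eta q n : 0 <= c <= 2^-1 -> 0 <= eta -> q <= c * (1 - eta) ->
  (1 - c) ^+ n * (1 + n%:R * (c * eta)) <= (1 - q) ^+ n.
Proof.
move=> /andP[c0 c1] e0 hq.
have ce : 0 <= c * eta by rewrite mulr_ge0.
have c2 : 0 <= 1 - c by lra.
apply: (@le_trans _ _ ((1 - c) ^+ n * (1 + c * eta) ^+ n)).
  by rewrite ler_wpM2l ?exprn_ge0 ?bernoulli //; lra.
by rewrite -exprMn; apply: lerX; nra.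
Qed.

(** Half of the gain eta is given up to pay for the error p^2 w of Janson's inequality. The
    assumption makes this enough, since (1 + eta)^2 <= 4. *)
Lemma step_le c eta w n : 0 <= c <= 2^-1 -> 0 <= eta <= 1 ->
  4 * (c * w) <= eta / 2 ->
  (1 - c * (1 + eta) + (c * (1 + eta)) ^+ 2 * w) ^+ n <=
     (1 - c) ^+ n * (1 + n%:R * (c * eta / 2))^-1 \/ w < 0.
Proof.
move=> /andP[c0 c1] /andP[e0 e1] hw; case: (ltrP w 0) => w0; [by right | left].
have c2 : 0 <= 1 - c by lra.
have p1 : c * (1 + eta) <= 1 by nra.
have p0 : 0 <= c * (1 + eta) by nra.
apply: (@le_trans _ _ ((1 - c) ^+ n * (1 - c * eta / 2) ^+ n)).
  rewrite -exprMn; apply: lerX.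
    by rewrite addr_ge0 ?subr_ge0 // mulr_ge0 ?sqr_ge0.
  have : (c * (1 + eta)) ^+ 2 * w <= c * eta / 2.
    have h : (1 + eta) ^+ 2 * (c * w) <= eta / 2.
      by apply: le_trans hw; rewrite ler_wpM2r ?mulr_ge0 //; nra.
    rewrite [leLHS](_ : _ = c * ((1 + eta) ^+ 2 * (c * w))); last by ring.
    by rewrite -mulrA ler_wpM2l.
  by nra.
rewrite ler_wpM2l ?exprn_ge0 //; apply: pow_1mx_le; nra.
Qed.

End Powers.

Section Amplify.
Local Open Scope ring_scope.
Variables (R : realType) (d : nat) (m delta eps : R) (M : nat -> nat) (c : nat -> R).
Variables (hi lo : nat -> R).
Hypothesis m_ge : 2048 <= m.
Hypothesis deltaE : delta = 32 * (16 / m) ^+ d.+1.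
Hypothesis eps01 : 0 <= eps <= delta / (16 * m).
Hypothesis c01 : forall i, (i <= d.+1)%N -> 0 < c i <= 2^-1.
Hypothesis cS : forall i, (i <= d)%N -> c i.+1 = (1 - c i) ^+ M i.+1.
Hypothesis kappa : forall i, (i <= d)%N -> m / 4 <= (M i.+1)%:R * c i <= 2 * m.
Hypothesis hi1 : forall i, hi i <= 1.
Hypothesis hi0 : c 0%N * (1 + delta) <= hi 0%N.
Hypothesis lo0 : lo 0%N <= c 0%N * (1 - delta).
Hypothesis hiS : forall i, (i <= d.+1)%N -> (1 - lo i) ^+ M i.+1 <= hi i.+1.
Hypothesis loS : forall i p, (i <= d.+1)%N -> 0 <= p <= hi i ->
  lo i.+1 <= (1 - p + p ^+ 2 * ((M i.+1)%:R * eps)) ^+ M i.+1.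

(* The relative bias at level i. *)
Let eta i := delta * (m / 16) ^+ i.

Let m0 : 0 < m. Proof. by apply: lt_le_trans m_ge; rewrite ltr0n. Qed.
Let d0 : 0 < delta.
Proof. by rewrite deltaE mulr_gt0 ?exprn_gt0 ?divr_gt0. Qed.

Let m16 : 1 <= m / 16.
Proof. by move: m_ge => h; lra. Qed.

Let eta_ge i : delta <= eta i.
Proof. by apply: ler_peMr; [exact: ltW | exact: (exprn_ege1 _ m16)]. Qed.

Let eta_d : eta d = 512 / m.
Proof.
rewrite /eta deltaE exprS mulrA -!mulrA -exprMn.
by rewrite (_ : 16 / m * (m / 16) = 1) ?expr1n; field; rewrite gt_eqF.
Qed.

Let eta_le i : (i <= d)%N -> eta i <= 4^-1.
Proof.
move=> id; apply: (@le_trans _ _ (eta d)).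
  by rewrite /eta; apply: ler_wpM2l; [exact: ltW | exact: ler_weXn2l].
by rewrite eta_d ler_pdivrMr //; move: m_ge => h; lra.
Qed.

Let etaS i : eta i.+1 = eta i * (m / 16).
Proof. by rewrite /eta exprSr mulrA. Qed.

(** The gain is M_(i+1) c_i eta_i, where M_(i+1) c_i is at least m/4; on the side of Janson's
    inequality half of it is left. *)
Let step i : (i <= d)%N ->
  c i * (1 + eta i) <= hi i -> lo i <= c i * (1 - eta i) ->
  c i.+1 * (1 + m / 4 * eta i) <= hi i.+1 /\
  lo i.+1 <= c i.+1 * (1 + m / 8 * eta i)^-1.
Proof.
move=> id hhi hlo; have id1 : (i <= d.+1)%N by apply: leq_trans id _.
have /andP[ci0 ci1] := c01 id1; have /andP[k0 k1] := kappa id.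
have e0 : 0 < eta i by apply: lt_le_trans (eta_ge i).
have e1 := eta_le id; have cc : 0 <= c i <= 2^-1 by rewrite ltW.
have cS0 : 0 <= c i.+1 by rewrite cS // exprn_ge0 //; lra.
split.
  apply: le_trans (hiS id1); apply: le_trans (step_ge (M i.+1) cc (ltW e0) hlo).
  rewrite -cS // ler_wpM2l // lerD2l mulrA ler_wpM2r // ltW //.
have p0 : 0 <= c i * (1 + eta i) <= hi i by rewrite hhi andbT mulr_ge0 //; lra.
apply: le_trans (loS id1 p0) _.
case/andP: eps01 => eps0 eps1.
have ew : 4 * (c i * ((M i.+1)%:R * eps)) <= eta i / 2.
  have h1 : (M i.+1)%:R * c i * eps <= 2 * m * (delta / (16 * m)).
    by apply: ler_pM => //; rewrite mulr_ge0 // ltW.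
  have h2 : 2 * m * (delta / (16 * m)) = delta / 8 by field; rewrite gt_eqF.
  have := eta_ge i; rewrite h2 in h1.
  rewrite (_ : 4 * _ = 4 * ((M i.+1)%:R * c i * eps)); last by ring.
  lra.
have e01 : 0 <= eta i <= 1 by rewrite ltW //=; lra.
have [h|] := step_le (M i.+1) cc e01 ew; last first.
  by move=> h; have := mulr_ge0 (ler0n R (M i.+1)) eps0; lra.
apply: le_trans h _; rewrite -cS // ler_wpM2l //.
have ? : 0 < 1 + m / 8 * eta i by rewrite ltr_wpDr // mulr_ge0 ?divr_ge0 // ltW.
have : m / 8 * eta i <= (M i.+1)%:R * (c i * eta i / 2).
  rewrite [leRHS](_ : _ = (M i.+1)%:R * c i / 2 * eta i); last by ring.
  by rewrite ler_wpM2r ?(ltW e0) //; lra.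
by move=> h; rewrite lef_pV2 ?posrE //; lra.
Qed.

Lemma amplify_mid i : (i <= d)%N ->
  c i * (1 + eta i) <= hi i /\ lo i <= c i * (1 - eta i).
Proof.
elim: i => [|i IH] id; first by rewrite /eta expr0 mulr1.
have /andP[ci0 _] := c01 (leqW id).
have [h1 h2] := IH (ltnW id); have [h3 h4] := step (ltnW id) h1 h2.
have e0 : 0 < eta i by apply: lt_le_trans (eta_ge i).
have e1 := eta_le id; rewrite etaS in e1; rewrite etaS.
have x0 : 0 < m / 8 * eta i by rewrite mulr_gt0 ?divr_gt0.
split.
  apply: le_trans h3; rewrite ler_wpM2l ?(ltW ci0) // lerD2l mulrC ler_wpM2r ?(ltW e0) //.
  by rewrite ler_wpM2l ?(ltW m0) // lef_pV2 ?posrE // ler_nat.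
(* Another factor 2 is lost in 1/(1 + x) <= 1 - x/2, which explains the m/16 in [eta]. *)
apply: le_trans h4 _; rewrite ler_wpM2l ?(ltW ci0) //.
rewrite -[leLHS]mul1r ler_pdivrMr; last by lra.
have -> : eta i * (m / 16) = (m / 8 * eta i) / 2 by field.
have : m / 8 * eta i <= 2^-1.
  by rewrite (_ : m / 8 * eta i = 2 * (eta i * (m / 16))); [lra | field].
by move: (m / 8 * eta i) x0 => x x0 x1; nra.
Qed.

(** At the last gate M c is of order 1, and the bias is no longer a small perturbation: at level d +
    1 one probability is at least 129 c and the other at most c/65, with c the center. *)
Lemma amplify : M d.+2 != 0%N ->
  2^-1 <= (M d.+2)%:R * c d.+1 <= 2 -> 9 / 10 <= hi d.+2 /\ lo d.+2 <= 1 / 10.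
Proof.
move=> M0 /andP[k0 k1].
have [h1 h2] := amplify_mid (leqnn d); have [h3 h4] := step (leqnn d) h1 h2.
have /andP[c0 c1] := c01 (leqnn d.+1).
have e4 : m / 4 * eta d = 128 by rewrite eta_d; field; rewrite gt_eqF.
have e8 : m / 8 * eta d = 64 by rewrite eta_d; field; rewrite gt_eqF.
rewrite e4 in h3; rewrite e8 (_ : 1 + 64 = 65 :> R) in h4; last by ring.
set n := M d.+2 in M0 k0 k1 *; set q := c d.+1 in c0 c1 k0 k1 h3 h4 *.
have n0 : 0 < n%:R :> R by rewrite ltr0n lt0n.
split.
  apply: le_trans (hiS (leqnn d.+1)); rewrite -/n.
  apply: (@le_trans _ _ ((1 - q / 65) ^+ n)); last by apply: lerX; lra.
  apply: (@le_trans _ _ (1 + n%:R * (- (q / 65)))); last by apply: bernoulli; lra.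
  by rewrite mulrN mulrA; lra.
(* p is taken below [hi d.+1] to have n p = 32. The error p^2 n eps is then at most p/2, and (1 -
   p/2)^n at most 1/17. *)
pose p : R := 32 / n%:R.
have pq : p <= hi d.+1.
  apply: le_trans h3; rewrite /p ler_pdivrMr //.
  rewrite (_ : q * (1 + 128) * n%:R = n%:R * q * 129); last by ring.
  lra.
have p0 : 0 <= p by rewrite divr_ge0 // ltW.
have hp : 0 <= p <= hi d.+1 by rewrite p0.
apply: le_trans (loS (leqnn d.+1) hp) _; rewrite -/n.
case/andP: eps01 => eps0 eps1.
have eps2 : eps <= 64^-1.
  apply: le_trans eps1 _; rewrite ler_pdivrMr ?mulr_gt0 //.
  have := eta_le (leq0n d); have := m_ge; rewrite /eta expr0 mulr1; lra.
have np : n%:R * p = 32 by rewrite /p; field; rewrite gt_eqF.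
have p2 : p ^+ 2 * (n%:R * eps) <= p / 2.
  rewrite expr2 -mulrA mulrA [X in X * _]mulrC.
  rewrite (_ : p * p * (n%:R * eps) = p * ((n%:R * p) * eps)); last by ring.
  by rewrite np ler_wpM2l //; lra.
have p1 : p <= 1 by apply: le_trans pq (hi1 _).
apply: (@le_trans _ _ ((1 - p / 2) ^+ n)).
  apply: lerX; last lra.
  by rewrite addr_ge0 ?subr_ge0 // mulr_ge0 ?sqr_ge0 // mulr_ge0 // ltW.
have pp : 0 <= p / 2 <= 1 by lra.
apply: le_trans (pow_1mx_le n pp) _.
rewrite mulrA np -[leLHS]mul1r ler_pdivrMr //; lra.
Qed.

End Amplify.

(** * Approximations of ln 2, and fan-ins that keep the centers near 2^-m *)

Section LnTwo.
Local Open Scope ring_scope.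
Variable R : realType.

(** The remainder of the Taylor series of ln (1 - x). Its derivative -x^t/(1 - x) lies between -2
    2^-t and 0 on [0, 1/2], which gives both bounds on ln 2 at x = 1/2. *)
Definition lnrem (t : nat) (x : R) : R := ln (1 - x) + \sum_(i < t) x ^+ i.+1 / i.+1%:R.

Lemma is_derive_lnrem t (x : R) : x < 1 -> is_derive x 1 (lnrem t) (- (x ^+ t) / (1 - x)).
Proof.
move=> x1; have x0 : 0 < 1 - x by rewrite subr_gt0.
elim: t => [|t IH].
  have h : is_derive x 1 (fun y : R => 1 - y) (-1).
    have h3 := is_deriveB (is_derive_cst (1 : R) x 1) (is_derive_id x (1 : R)).
    by apply: is_derive_eq h3 _; rewrite sub0r.
  have h2 : is_derive (1 - x) 1 (@ln R) (1 - x)^-1 by apply: is_derive1_ln.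
  have -> : lnrem 0 = @ln R \o (fun y => 1 - y).
    by apply: funext => y; rewrite /lnrem big_ord0 addr0.
  have h3 := @is_derive1_comp _ (@ln R) (fun y : R => 1 - y) x _ _ h2 h.
  apply: is_derive_eq h3 _.
  by rewrite mulrC expr0.
have hX := is_deriveZ (t.+1%:R^-1 : R) (is_deriveX t.+1 (is_derive_id x (1 : R))).
have -> : lnrem t.+1 = lnrem t + (t.+1%:R^-1 \*: (id ^+ t.+1)).
  apply: funext => y; rewrite /lnrem big_ord_recr /= addrA !fctE; congr (_ + _).
  by rewrite mulrC.
apply: is_derive_eq (is_deriveD IH hX) _.
rewrite /= -![_ *: _]/(_ * _).
rewrite mulr1 mulKf ?pnatr_eq0 // exprS; field; by rewrite gt_eqF.
Qed.

Lemma ln2_bounds t : \sum_(i < t) 2^-1 ^+ i.+1 / i.+1%:R <= ln 2 :> R /\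
  ln 2 <= \sum_(i < t) 2^-1 ^+ i.+1 / i.+1%:R + 2^-1 ^+ t :> R.
Proof.
have h2 : lnrem t 2^-1 = - ln 2 + \sum_(i < t) 2^-1 ^+ i.+1 / i.+1%:R :> R.
  rewrite /lnrem (_ : 1 - 2^-1 = 2^-1 :> R); last by field.
  by rewrite lnV ?posrE.
have h0 : lnrem t 0 = 0 :> R.
  rewrite /lnrem subr0 ln1 add0r big1 // => i _.
  by rewrite expr0n /= mul0r.
have itv (x : R) : x \in `]0, 2^-1[%R -> x < 1.
  by rewrite in_itv /= => /andP[_ h]; lra.
have itv2 (x : R) : x \in `[0, 2^-1]%R -> x < 1.
  by rewrite in_itv /= => /andP[_ h]; lra.
have half : 0 <= 2^-1 :> R by rewrite invr_ge0.
split.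
  have : lnrem t (2^-1 : R) <= lnrem t 0.
    apply: (@ler0_derive1_nincr R (lnrem t) 0 2^-1) => //.
    - by move=> x /itv x1; have [] := is_derive_lnrem t x1.
    - move=> x hx; have x1 := itv x hx; have hd := is_derive_lnrem t x1.
      rewrite derive1E derive_val mulNr oppr_le0.
      move: hx; rewrite in_itv /= => /andP[x0 _].
      apply: divr_ge0; [apply: exprn_ge0; exact: ltW | rewrite subr_ge0; exact: ltW].
    apply: derivable_within_continuous => x /itv2 x1.
    by have [] := is_derive_lnrem t x1.
  by rewrite h2 h0; lra.
pose g : R -> R := lnrem t + ((2 * 2^-1 ^+ t) \*: id).
have hg (x : R) : x < 1 -> is_derive x 1 g (- (x ^+ t) / (1 - x) + 2 * 2^-1 ^+ t).
  move=> x1; have hd := is_derive_lnrem t x1.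
  have hZ := is_deriveZ (2 * 2^-1 ^+ t : R) (is_derive_id x (1 : R)).
  by apply: is_derive_eq (is_deriveD hd hZ) _; rewrite -[_ *: _]/(_ * _) mulr1.
have : g 0 <= g 2^-1.
  apply: (@ger0_derive1_ndecr R g 0 2^-1) => //.
  - by move=> x /itv x1; have [] := hg x x1.
  - move=> x hx; have x1 := itv x hx; have hd := hg x x1.
    rewrite derive1E derive_val.
    move: hx; rewrite in_itv /= => /andP[x0 x2].
    have e1 : x ^+ t <= 2^-1 ^+ t by apply: lerX; apply: ltW.
    have e2 : x ^+ t / (1 - x) <= 2 * 2^-1 ^+ t.
      rewrite mulrC; apply: ler_pM => //; rewrite ?exprn_ge0 ?invr_ge0 ?subr_ge0 ?(ltW x0) ?(ltW x1) //.
      rewrite -[2]invrK lef_pV2 ?posrE ?subr_gt0 ?invr_gt0 //; lra.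
    by rewrite mulNr addrC subr_ge0.
  apply: derivable_within_continuous => x /itv2 x1.
  by have [] := hg x x1.
have gE y : g y = lnrem t y + 2 * 2^-1 ^+ t * y by [].
rewrite !gE h2 h0 mulr0 addr0.
have -> : 2 * 2^-1 ^+ t * 2^-1 = 2^-1 ^+ t :> R by field.
by lra.
Qed.

(** Each of the t terms loses at most 1 by rounding, and the tail of the series, scaled by 2^t,
    loses at most 1 more. *)
Lemma LMnat_bounds t : (2 ^ t)%:R * ln 2 - (t.+1)%:R <= (LMnat t)%:R :> R /\
  (LMnat t)%:R <= (2 ^ t)%:R * ln 2 :> R.
Proof.
have [b1 b2] := ln2_bounds t.
have e : (LMnat t)%:R = \sum_(i < t) (qr (t - i.+1) i.+1).1%:R :> R.
  by rewrite /LMnat big_add1 big_mkord natr_sum.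
have pt : 0 < (2 ^ t)%:R :> R by rewrite ltr0n expn_gt0.
have term (i : 'I_t) : (2 ^ t)%:R * (2^-1 ^+ i.+1 / i.+1%:R) - 1 <= (qr (t - i.+1) i.+1).1%:R :> R /\
   (qr (t - i.+1) i.+1).1%:R <= (2 ^ t)%:R * (2^-1 ^+ i.+1 / i.+1%:R) :> R.
  have i0 : 0 < i.+1%:R :> R by rewrite ltr0n.
  have -> : (2 ^ t)%:R * (2^-1 ^+ i.+1 / i.+1%:R) = (2 ^ (t - i.+1))%:R / i.+1%:R :> R.
    rewrite mulrA; congr (_ / _); rewrite -{1}(subnK (ltn_ord i)) expnD natrM -mulrA.
    by rewrite !natrX -exprMn mulfV ?expr1n ?mulr1 // pnatr_eq0.
  have := qrE (t - i.+1) i.+1; have := qr_le (t - i.+1) (ltn0Sn i).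
  move: (qr _ _) => [q r] /= hr hq.
  split.
    rewrite lerBlDr ler_pdivrMr // mulrDl mul1r -natrM -natrD ler_nat -hq leq_add2l //.
  by rewrite ler_pdivlMr // -natrM ler_nat -hq leq_addr.
rewrite e; split; last first.
  apply: (@le_trans _ _ ((2 ^ t)%:R * \sum_(i < t) 2^-1 ^+ i.+1 / i.+1%:R)); last first.
    by apply: ler_wpM2l => //; exact: ltW.
  rewrite mulr_sumr.
  by apply: ler_sum => i _; case: (term i).
apply: (@le_trans _ _ (\sum_(i < t) ((2 ^ t)%:R * (2^-1 ^+ i.+1 / i.+1%:R) - 1))).
  rewrite sumrB -mulr_sumr sumr_const card_ord.
  have := ler_wpM2l (ltW pt) b2; rewrite mulrDr.
  have -> : (2 ^ t)%:R * 2^-1 ^+ t = 1 :> R.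
    by rewrite natrX -exprMn mulfV ?expr1n // pnatr_eq0.
  by rewrite -natr1; lra.
by apply: ler_sum => i _; case: (term i).
Qed.

End LnTwo.

Lemma ltn_add_exp a : 2 ^ a + a < 3 * 2 ^ a.
Proof. by have := ltn_expl a (isT : 1 < 2); lia. Qed.

Section Centers.
Local Open Scope ring_scope.
Variable R : realType.

Lemma ln2_half : 2^-1 <= ln 2 :> R.
Proof. by have [h _] := ln2_bounds R 1; move: h; rewrite big_ord1 expr1 divr1. Qed.

Lemma ln2_le1 : ln 2 <= 1 :> R.
Proof. by have [_ h] := ln2_bounds R 0; move: h; rewrite big_ord0 add0r. Qed.

Lemma ln_1m_bounds (c : R) : 0 <= c <= 2^-1 ->
  c <= - ln (1 - c) /\ - ln (1 - c) <= c / (1 - c).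
Proof.
case/andP=> c0 c1; have c2 : 0 < 1 - c by lra.
split; first by rewrite lerNr; apply: le_ln1Dx; lra.
rewrite -lnV ?posrE //.
rewrite [X in ln X](_ : _ = 1 + c / (1 - c)); last by field; rewrite gt_eqF.
apply: le_ln1Dx; have h : 0 <= c / (1 - c) by rewrite divr_ge0 // ltW.
by lra.
Qed.

Variable a : nat.
Hypothesis a11 : (11 <= a)%N.
Let m : R := (2 ^ a)%:R.
Let mu : R := (2 ^ (2 ^ a))%:R.

Let m_ge : 2048 <= m.
Proof. by rewrite /m (_ : 2048 = (2 ^ 11)%:R) ?ler_nat ?leq_exp2l // -natrX; ring. Qed.

Let mu_ge : 2 * m <= mu.
Proof.
rewrite /m /mu -natrM ler_nat -expnS leq_exp2l //.
exact: ltn_expl.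
Qed.

Let mu0 : 0 < mu. Proof. by move: m_ge mu_ge => h1 h2; lra. Qed.

Let ln_mu : ln mu = m * ln 2.
Proof. by rewrite /mu natrX lnXn // mulr_natl. Qed.

Definition near_center (c : R) := 2^-1 <= mu * c <= 2.

Lemma near_le c : near_center c -> 0 < c <= 4^-1.
Proof.
case/andP=> h1 h2; move: m_ge mu_ge => h3 h4.
have c0 : 0 < c by rewrite -(pmulr_rgt0 _ mu0); lra.
by rewrite c0 /=; nra.
Qed.

(** The logarithm of (1 - c)^n is within ln 2 of -m ln 2, and -ln (1 - c) is c up to a factor 4/3.
    So two consecutive centers determine n c up to constants, however n was found. *)
Lemma kappa_near c n : near_center c -> near_center ((1 - c) ^+ n) ->
  m / 4 <= n%:R * c <= 2 * m.
Proof.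
move=> hc hc'; have /andP[c0 c1] := near_le hc.
have c12 : 0 <= c <= 2^-1 by lra.
have [l1 l2] := ln_1m_bounds c12.
have /andP[h1 h2] := hc'.
have z0 : 0 < (1 - c) ^+ n by apply: exprn_gt0; lra.
have lz : ln (mu * (1 - c) ^+ n) = m * ln 2 + n%:R * ln (1 - c).
  by rewrite lnM ?posrE // ln_mu lnXn ?mulr_natl //; lra.
have l2h := ln2_half; have l21 := ln2_le1; move: m_ge => mg.
have n0 : 0 <= n%:R :> R by [].
have hlo : - ln 2 <= ln (mu * (1 - c) ^+ n).
  by rewrite -lnV ?posrE // ler_ln ?posrE ?invr_gt0 ?mulr_gt0.
have hhi : ln (mu * (1 - c) ^+ n) <= ln 2.
  by rewrite ler_ln ?posrE ?mulr_gt0.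
rewrite lz in hlo hhi.
apply/andP; split.
  have h3 : n%:R * (- ln (1 - c)) <= n%:R * (c / (1 - c)) by apply: ler_wpM2l.
  have h4 : m / 4 * (1 - c)^-1 <= n%:R * c * (1 - c)^-1.
    rewrite -[leRHS]mulrA; apply: le_trans _ h3.
    have h5 : (1 - c)^-1 <= 4 / 3 by rewrite -[4 / 3]invrK lef_pV2 ?posrE //; [lra| lra | rewrite invf_div; lra].
    have h6 : m / 4 / (1 - c) <= m / 4 * (4 / 3) by apply: ler_wpM2l => //; lra.
    nra.
  by move: h4; rewrite ler_pM2r // invr_gt0; lra.
have h3 : n%:R * c <= n%:R * (- ln (1 - c)) by apply: ler_wpM2l.
nra.
Qed.

(** n is least with (1 - c)^n <= 1/mu. As 1 - c >= 3/4, the last factor cannot lead from above 1/mu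
    to below 1/(2 mu). *)
Lemma least_near c : near_center c -> exists n : nat, near_center ((1 - c) ^+ n).
Proof.
move=> hc; have /andP[c0 c1] := near_le hc.
have ex : exists n, (1 - c) ^+ n <= mu^-1.
  have cmu : 0 <= mu / c by rewrite divr_ge0 // ltW.
  exists (Num.Def.archi_bound (mu / c)).
  have hb := archi_boundP cmu; set n := Num.Def.archi_bound _ in hb *.
  have c01 : 0 <= c <= 1 by lra.
  apply: le_trans (pow_1mx_le n c01) _; rewrite lef_pV2 ?posrE //.
    by move: hb; rewrite ltr_pdivrMr //; lra.
  by rewrite ltr_wpDr // mulr_ge0 // ltW.
exists (ex_minn ex); case: ex_minnP => -[|n] hn hmin; rewrite /near_center.
  move: hn; rewrite expr0 => hn; have : mu <= 1.
    by rewrite -[mu]invrK invf_le1 ?invr_gt0.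
  by move: m_ge mu_ge => ? ?; lra.
have hn' : mu^-1 < (1 - c) ^+ n.
  by rewrite ltNge; apply/negP => /hmin; rewrite ltnn.
have e1 : mu * (1 - c) ^+ n.+1 <= 1 by rewrite mulrC -ler_pdivlMr // mul1r.
have e2 : 1 < mu * (1 - c) ^+ n by rewrite mulrC -ltr_pdivrMr // mul1r.
rewrite exprS in e1 *; rewrite mulrCA in e1 *.
move: (mu * (1 - c) ^+ n) e1 e2 => z e1 e2; nra.
Qed.

(** As 2^(2^a + a) = mu m, the product n c is m ln 2 up to a relative error D from c. The term 16/mu
    covers the rounding of n and the quadratic term of ln (1 - c). Exponentiating at most doubles
    the bound. *)
Lemma LM_near c D : 0 <= D <= 4^-1 -> `|mu * c - 1| <= D ->
  m * (D + 16 / mu) <= 4^-1 ->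
  `|mu * (1 - c) ^+ LMnat (2 ^ a + a) - 1| <= 2 * (m * (D + 16 / mu)).
Proof.
move=> /andP[D0 D1]; rewrite ler_norml => /andP[x1 x2] hY.
set n := LMnat _; set Y := m * (D + 16 / mu) in hY *.
have hc : near_center c by rewrite /near_center; apply/andP; split; lra.
have /andP[c0 c1] := near_le hc; have c12 : 0 <= c <= 2^-1 by lra.
have [l1 l2] := ln_1m_bounds c12.
have l2h := ln2_half; have l21 := ln2_le1; move: m_ge mu_ge => mg mug.
have z0 : 0 < (1 - c) ^+ n by apply: exprn_gt0; lra.
have lz : ln (mu * (1 - c) ^+ n) = m * ln 2 + n%:R * ln (1 - c).
  by rewrite lnM ?posrE // ln_mu lnXn ?mulr_natl //; lra.
have [n1 n2] := LMnat_bounds R (2 ^ a + a); rewrite -/n in n1 n2.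
have et : (2 ^ (2 ^ a + a))%:R = mu * m :> R by rewrite expnD natrM.
rewrite et in n1 n2.
have st : (2 ^ a + a).+1%:R <= 3 * m.
  by rewrite -natrM ler_nat ltn_add_exp.
set v := mu * c in x1 x2; have vE : c = v / mu by rewrite /v; field; rewrite gt_eqF.
have imu : 0 < mu^-1 by rewrite invr_gt0.
have n0 : 0 <= n%:R :> R by [].
have nu_lo : m * ln 2 - Y <= n%:R * (- ln (1 - c)).
  apply: (@le_trans _ _ (n%:R * c)); last by apply: ler_wpM2l.
  apply: (@le_trans _ _ ((mu * m * ln 2 - 3 * m) * c)); last first.
    by apply: ler_wpM2r; [exact: ltW | lra].
  rewrite vE (_ : (mu * m * ln 2 - 3 * m) * (v / mu) = m * (v * (ln 2 - 3 / mu))); last first.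
    by field; rewrite gt_eqF.
  rewrite /Y -mulrBr ler_wpM2l //.
  have w12 : mu^-1 <= 12^-1 by rewrite lef_pV2 ?posrE //; lra.
  move: (mu^-1) imu w12 => w w0 w1.
  have h1 : 0 <= (v - (1 - D)) * (ln 2 - 3 * w) by apply: mulr_ge0; lra.
  have h2 : 0 <= D * (1 - ln 2) by apply: mulr_ge0; lra.
  have h3 : 0 <= D * w by apply: mulr_ge0; lra.
  by nra.
have nu_hi : n%:R * (- ln (1 - c)) <= m * ln 2 + Y.
  apply: (@le_trans _ _ (n%:R * (c / (1 - c)))); first by apply: ler_wpM2l.
  have cc : c / (1 - c) <= c * (1 + 2 * c).
    by rewrite ler_pdivrMr; nra.
  apply: (@le_trans _ _ (mu * m * ln 2 * (c * (1 + 2 * c)))).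
    by apply: ler_pM => //; rewrite divr_ge0 //; lra.
  rewrite vE (_ : mu * m * ln 2 * (v / mu * (1 + 2 * (v / mu))) = m * (v * ln 2 * (1 + 2 * (v / mu)))); last first.
    by field; rewrite gt_eqF.
  rewrite /Y -mulrDr ler_wpM2l //.
  have v0 : 0 <= v by lra.
  have vl : v * ln 2 <= ln 2 + D by nra.
  have v2 : v * ln 2 * (2 * (v / mu)) <= 16 / mu.
    rewrite (_ : v * ln 2 * (2 * (v / mu)) = (2 * v * v * ln 2) / mu); last by field; rewrite gt_eqF.
    by rewrite ler_pM2r //; nra.
  lra.
have Y0 : 0 <= Y by rewrite /Y mulr_ge0 ?addr_ge0 ?divr_ge0 // ltW //; lra.
have hz : 0 < mu * (1 - c) ^+ n by rewrite mulr_gt0.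
rewrite ler_norml; apply/andP; split.
  have := expR_ge1Dx (ln (mu * (1 - c) ^+ n)); rewrite lnK ?posrE // lz; lra.
have := expR_ge1Dx (- ln (mu * (1 - c) ^+ n)); rewrite expRN lnK ?posrE // lz.
set z := mu * _ in hz *; move=> h.
have h1 : 1 - Y <= z^-1 by lra.
have : (1 - Y) * z <= 1 by rewrite -ler_pdivlMr // mul1r.
nra.
Qed.

End Centers.

(** In exponents: 32 (4m)^(d+1) <= 2^m for m = 2^a, so that the errors accumulated over the levels
    stay below 1/2. *)
Lemma regime_bound d a : d + 8 <= a -> (a + 2) * d.+1 + 5 <= 2 ^ a.
Proof.
move=> da; apply: (@leq_trans (a ^ 2)); first by nia.
have a4 : 4 <= a by lia.
elim: a a4 {da} => // a IH; rewrite leq_eqVlt => /orP[/eqP<- //|a4].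
by have := IH a4; rewrite [2 ^ a.+1]expnS; nia.
Qed.

Section CentersExist.
Local Open Scope ring_scope.
Variables (R : realType) (d : nat).

(* The error bound for the approximation by ln 2 needs a >= d + 8; the finitely
   many other fan-ins are tabulated in [T]. *)
Definition mid_fanin (T : nat -> nat -> nat) a i : nat :=
  if (a < d + 8)%N then T a i else LMnat (2 ^ a + a).

Definition low_fanin (T : nat -> nat -> nat) a i : nat :=
  if i == 1%N then (2 ^ a)%N else mid_fanin T a i.

Fixpoint center (M : nat -> nat) i : R :=
  if i is i'.+1 then (1 - center M i') ^+ M i else 2^-1.

Lemma centers_exist : exists T : nat -> nat -> nat, forall a, (11 <= a)%N ->
  (forall i, 0 < T a i)%N /\
  forall i, (1 <= i <= d.+1)%N -> near_center a (center (low_fanin T a) i).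
Proof.
have [L hL] : {L : nat * R -> nat & forall p, (11 <= p.1)%N -> near_center p.1 p.2 ->
    near_center p.1 ((1 - p.2) ^+ L p)}.
  apply: (@boolp.choice _ _ (fun p n => (11 <= p.1)%N -> near_center p.1 p.2 ->
    near_center p.1 ((1 - p.2) ^+ n))) => -[a c].
  have [a11|] := boolP (11 <= a)%N; last by exists 0%N.
  have [hc|] := boolP (near_center a c); last by exists 0%N.
  by have [n hn] := least_near a11 hc; exists n.
(* The centers obtained with fan-ins from [least_near]. [cI a i] is the center of level i + 1, and
   the fan-in of level i acts on the center of level i - 1, hence the shift by 2. *)
pose cI a := fix f i : R := if i is i'.+1 then (1 - f i') ^+ L (a, f i')
  else (2 ^ (2 ^ a))%:R^-1.
exists (fun a i => L (a, cI a (i - 2)%N)) => a a11.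
have mu0 : (2 ^ (2 ^ a))%:R != 0 :> R by rewrite pnatr_eq0 expn_eq0.
have mu4 : 4 <= (2 ^ (2 ^ a))%:R :> R.
  rewrite ler_nat (@leq_exp2l 2 2) // (@leq_trans a) // ?(leq_trans _ a11) //.
  exact: ltnW (ltn_expl _ _).
have near0 : near_center a ((2 ^ (2 ^ a))%:R^-1 : R).
  by rewrite /near_center mulfV //; apply/andP; split; lra.
have nearI i : near_center a (cI a i).
  by elim: i => //= i IH; apply: (hL (a, cI a i)).
split=> [i|i].
  rewrite lt0n; apply/eqP => h.
  have := hL (a, cI a (i - 2)%N) a11 (nearI _); rewrite h /near_center expr0 mulr1.
  by case/andP=> _; lra.
set M := low_fanin _ _; case: i => // i.
have c1 : center M 1 = (2 ^ (2 ^ a))%:R^-1.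
  rewrite /= /M /low_fanin /= (_ : 1 - 2^-1 = 2^-1 :> R); last by field.
  by rewrite natrX exprVn.
move=> /andP[_]; rewrite ltnS => id.
have [ad|ad] := ltnP a (d + 8).
  suff -> : center M i.+1 = cI a i by apply: nearI.
  elim: i {id} => [|i IH]; first by rewrite c1.
  rewrite [LHS]/= -/(center M i.+1) IH /M /low_fanin /mid_fanin ad /=.
  by rewrite subn2.
set mu : R := (2 ^ (2 ^ a))%:R in mu0 mu4 near0 c1 *; set m : R := (2 ^ a)%:R.
have m1 : 1 <= m by rewrite ler1n expn_gt0.
pose u : R := 16 / mu.
have u0 : 0 < u by rewrite divr_gt0 //; lra.
have hu j : (j <= d)%N -> u * (4 * m) ^+ j.+1 <= 2^-1.
  move=> jd; rewrite /u mulrAC ler_pdivrMr; last by lra.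
  rewrite [2^-1 * _]mulrC ler_pdivlMr // /mu /m -!(natrM, natrX) ler_nat.
  rewrite (_ : 4 * 2 ^ a = 2 ^ (a + 2))%N; last by rewrite expnD mulnC.
  rewrite -expnM -(expnD 2 4) -expnSr leq_exp2l //.
  by have := regime_bound ad; move: (2 ^ a)%N => z; nia.
(* One level turns a deviation D >= u into at most 2m (D + u) <= 4m D. *)
suff H : `|mu * center M i.+1 - 1| <= u * (4 * m) ^+ i.
  move: H; have h1 : u * (4 * m) ^+ i <= 2^-1.
    case: i id => [|i] id; last by apply: hu; apply: ltnW.
    apply: le_trans (hu 0%N (leq0n _)); rewrite expr0 expr1 ler_wpM2l ?ltW //; lra.
  by rewrite /near_center ler_norml => /andP[h2 h3]; apply/andP; split; lra.
elim: i id => [|i IH] id.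
  by rewrite c1 mulfV // subrr normr0 mulr1 ltW.
have hD := IH (ltnW id); set D := u * (4 * m) ^+ i in hD *.
have uD : u <= D.
  by rewrite /D ler_peMr ?exprn_ege1 ?ltW //; lra.
have e1 : u * (4 * m) ^+ i.+1 = 4 * m * D by rewrite exprS mulrCA.
have DS := hu i (ltnW id); rewrite e1 in DS.
rewrite e1 [center M i.+2]/= -/(center M i.+1).
have -> : M i.+2 = LMnat (2 ^ a + a).
  by rewrite /M /low_fanin /mid_fanin /= ltnNge ad.
have D4 : D <= 4^-1.
  have : D <= m * D by rewrite ler_peMl //; lra.
  lra.
have D0 : 0 <= D <= 4^-1 by rewrite D4 andbT; lra.
have mD : m * (D + 16 / mu) <= m * (D + D) by rewrite ler_wpM2l ?lerD2l //; lra.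
apply: le_trans (LM_near a11 D0 hD _) _; rewrite -/m -/u in mD *; first by lra.
by lra.
Qed.

End CentersExist.

(** * The formula solves the coin problem *)

Section BuildProb.
Local Open Scope ring_scope.
Variables (R : realType) (M s : nat -> nat) (HW : nat -> W -> W -> W).
Hypothesis M0 : forall i, (0 < M i)%N.

Definition phi i (x : {ffun 'I_(2 ^ nb s i) -> bool}) : R :=
  (ev M HW x == odd i)%:R.

Lemma prod_bool n (b : 'I_n -> bool) : \prod_(k < n) ((b k)%:R : R) = [forall k, b k]%:R.
Proof.
have [/forallP h|/forallPn[k hk]] := boolP [forall k, b k].
  by rewrite big1 // => k _; rewrite h.
by rewrite (bigD1 k) //= (negPf hk) mul0r.
Qed.

Lemma phiS i x : phi x = layer (fun k : 'I_(M i.+1) => @sg s HW i k) (@phi i) x.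
Proof.
rewrite /layer /phi /= -[RHS](_ : \prod_(k < M i.+1)
  ((ev M HW (pull (@sg s HW i k) x) != odd i)%:R : R) = _); last first.
  by apply: eq_bigr => k _; case: (_ == _); rewrite ?subrr ?subr0.
rewrite prod_bool; case: (odd i) => /=.
  rewrite eqbF_neg negb_exists; congr (nat_of_bool _)%:R.
  by apply: eq_forallb => k; rewrite eqb_id.
rewrite eqb_id; congr (nat_of_bool _)%:R.
by apply: eq_forallb => k; case: (ev _ _ _).
Qed.

Lemma phi01 i x : 0 <= @phi i x <= 1.
Proof. by rewrite /phi; case: (_ == _); rewrite ?lexx ler01. Qed.

Lemma sg_inj i k : injective (@sg s HW i k).
Proof. by move=> j j'; apply: sg_eq. Qed.

Lemma mon_phi i : mon (odd i) (@phi i).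
Proof.
elim: i => [|i IH].
  move=> j x; rewrite /phi /= !ffunE; have -> : (ord0 == j) = true.
    by apply/eqP/val_inj; case: j => -[|j] //=; rewrite expn0.
  by rewrite ler_nat.
have h := mon_layer (sg := fun k : 'I_(M i.+1) => @sg s HW i k) (@sg_inj i) IH (@phi01 i).
by move=> j x; rewrite !phiS; apply: h.
Qed.

Definition alpha (b : bool) (delta : R) : R := if b then (1 + delta) / 2 else (1 - delta) / 2.

Lemma alpha01 b delta : 0 <= delta <= 1 -> 0 <= alpha b delta <= 1.
Proof. by case/andP=> h0 h1; rewrite /alpha; case: b; apply/andP; split; lra. Qed.

Lemma build_solves d a (delta1 delta eps : R) : (11 <= a)%N ->
  delta1 = 32 * (16 / (2 ^ a)%:R) ^+ d.+1 ->
  0 <= eps <= delta1 / (16 * (2 ^ a)%:R) -> delta1 <= delta -> delta < 1 ->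
  M 1 = (2 ^ a)%N -> M d.+2 = (2 ^ (2 ^ a))%N ->
  (forall i, (1 <= i <= d.+1)%N -> near_center a (center R M i)) ->
  (forall i (k : 'I_(M i.+1)), (i <= d.+1)%N ->
    \sum_(l < M i.+1 | (l != k) && (shared (fun k : 'I_(M i.+1) => @sg s HW i k) l k != set0))
      4 ^+ #|shared (fun k : 'I_(M i.+1) => @sg s HW i k) l k| <= (M i.+1)%:R * eps) ->
  solves_coin delta (@ev M s HW d.+2).
Proof.
move=> a11 d1E heps d1d d_lt1 M1 Md hnear hsh.
set m : R := (2 ^ a)%:R in d1E heps.
have m_ge : 2048 <= m.
  by rewrite /m (_ : 2048 = (2 ^ 11)%:R) ?ler_nat ?leq_exp2l // -natrX; ring.
have m0 : 0 < m by lra.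
have d10 : 0 < delta1 by rewrite d1E mulr_gt0 ?exprn_gt0 ?divr_gt0.
have d12 : delta1 <= 4^-1.
  have h : 16 / m <= 128^-1 by rewrite ler_pdivrMr //; lra.
  rewrite d1E exprS; have : (16 / m) ^+ d <= 1.
    by apply: exprn_ile1; [rewrite divr_ge0 ?ltW | lra].
  have : 0 <= 16 / m by rewrite divr_ge0 ?ltW.
  move: (16 / m) h ((16 / m) ^+ d) => z hz w z0 w1; nra.
have d101 : 0 <= delta1 <= 1 by lra.
pose E b i := expect (alpha b delta1) (@phi i).
have a01 b := alpha01 b d101.
(* delta1 <= 1/4 keeps the probabilities of both values of a bit above 1/4, hence the factor 4 for
   each shared variable. *)
have b14 b : 1 <= 4 * alpha b delta1 /\ 1 <= 4 * (1 - alpha b delta1).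
  by rewrite /alpha; case: b; lra.
have E01 b i : 0 <= E b i <= 1.
  apply/andP; split; first by apply: expect_ge0 => // x; case/andP: (phi01 x).
  rewrite -[leRHS](expect_cst (2 ^ nb s i) (alpha b delta1)).
  by apply: le_expect => // x; case/andP: (phi01 x).
have ES b i : E b i.+1 = expect (alpha b delta1)
    (layer (fun k : 'I_(M i.+1) => @sg s HW i k) (@phi i)).
  by apply: eq_expect => x; rewrite phiS.
have sgE i (k l : 'I_(M i.+1)) j j' : @sg s HW i k j = @sg s HW i l j' -> j = j' by apply: sg_eq.
have mu0 : 0 < (2 ^ (2 ^ a))%:R :> R by rewrite ltr0n expn_gt0.
have E0 b : E b 0%N = 1 - alpha b delta1.
  rewrite /E (@eq_expect _ _ _ _ (fun x => 1 - (x ord0)%:R)); last first.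
    by move=> x; rewrite /phi /=; case: (x ord0); rewrite ?subrr ?subr0.
  rewrite expectB expect_cst; congr (1 - _).
  rewrite /expect (bigID (fun x : {ffun 'I_(2 ^ 0) -> bool} => x ord0)) /=.
  rewrite [X in _ + X]big1 ?addr0; last by move=> x /negPf ->; rewrite mulr0.
  rewrite (big_pred1 [ffun=> true]) => [|x]; last first.
    apply/idP/eqP => [h|->]; last by rewrite ffunE.
    by apply/ffunP => j; rewrite ffunE (ord1 j) -h.
  by rewrite ffunE mulr1 /coin_dist big_ord1 ffunE.
have [h1 h2] : 9 / 10 <= E (odd d.+2) d.+2 /\ E (~~ odd d.+2) d.+2 <= 1 / 10.
  (* The coin that favours E_i alternates with the parity of i, starting with E_0, the event that
     the bit is 0. *)
  apply: (@amplify R d m delta1 eps M (center R M) (fun i => E (odd i) i) (fun i => E (~~ odd i) i)) => //.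
  - case=> [|i] id; first by rewrite /=; apply/andP; split; lra.
    by have := near_le a11 (hnear i.+1 id); lra.
  - case=> [|i] id.
      by rewrite M1 /= -/m; apply/andP; split; lra.
    apply: (kappa_near a11 (hnear i.+1 _)); first exact: leqW.
    exact: (hnear i.+2 id).
  - by move=> i; case/andP: (E01 (odd i) i).
  - by rewrite E0 /alpha /=; lra.
  - by rewrite E0 /alpha /=; lra.
  - move=> i id; rewrite ES.
    apply: expect_layer_ge => //; [exact: sg_inj | exact: mon_phi | exact: phi01].
  - move=> i p id hp; rewrite /= negbK ES.
    have [b1 b2] := b14 (odd i).
    apply: (expect_layer_le _ _ _ (@mon_phi i) (@phi01 i) b1 b2 hp) => //.
    + exact: sg_inj.
    + by move=> k l j j'; apply: sg_eq.
    by move=> k; apply: hsh.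
  - by rewrite Md -lt0n expn_gt0.
  by rewrite Md; apply: hnear; rewrite ltnS leqnn.
(* Monotonicity carries the result over from the bias delta1 to the larger bias delta. *)
have mg : mon true (fun x => (@ev M s HW d.+2 x)%:R : R).
  move=> j x; have := mon_phi j x; rewrite /phi.
  rewrite !ler_nat; case: (odd d.+2); first by rewrite !eqb_id.
  rewrite -[~~ false]/true -[~~ true]/false !eqbF_neg.
  by move: (ev M HW (setb x j true)) (ev M HW (setb x j false)) => [] [].
have phiE b : expect (alpha b delta1) (fun x => (@ev M s HW d.+2 x)%:R) =
    if odd d.+2 then E b d.+2 else 1 - E b d.+2.
  rewrite /E /phi; case: (odd d.+2).
    by apply: eq_expect => x; rewrite eqb_id.
  rewrite -[X in _ = X - _](expect_cst (2 ^ nb s d.+2) (alpha b delta1)) -expectB.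
  by apply: eq_expect => x; case: (ev _ _ _); rewrite /= ?subr0 ?subrr.
rewrite /solves_coin !coin_probE; split.
  apply: (@le_trans _ _ (expect (alpha false delta1) (fun x => (@ev M s HW d.+2 x)%:R))).
    by apply: expect_mono => //; rewrite /alpha; lra.
  by rewrite phiE; move: h1 h2; case: (odd d.+2) => /=; lra.
apply: (@le_trans _ _ (expect (alpha true delta1) (fun x => (@ev M s HW d.+2 x)%:R))).
  by rewrite phiE; move: h1 h2; case: (odd d.+2) => /=; lra.
by apply: expect_mono => //; rewrite /alpha; lra.
Qed.

End BuildProb.

(** * The concrete parameters, and the program that decides wires *)

Lemma LMnat_lt t : LMnat t < 2 ^ t.
Proof.
apply: (@leq_ltn_trans (\sum_(1 <= n < t.+1) 2 ^ (t - n))).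
  rewrite /LMnat big_nat [leqRHS]big_nat; apply: leq_sum => n /andP[n0 _].
  by rewrite -(qrE (t - n) n); apply: leq_trans (leq_addr _ _); rewrite leq_pmulr.
rewrite big_add1 /= big_nat_rev /= add0n big_mkord.
rewrite (eq_bigr (fun i : 'I_t => 2 ^ i)); last first.
  by move=> i _; congr (2 ^ _); have := ltn_ord i; lia.
by elim: t => [|t IH]; [rewrite big_ord0 | rewrite big_ord_recr expnS /=; lia].
Qed.

(** Together with [LMnat_lt]: [LMnat t] has exactly t binary digits. The first term is only 2^(t-1)
    - 1, since the remainder may equal the divisor; the second term makes up for the missing 1. *)
Lemma LMnat_ge t : 4 <= t -> 2 ^ t.-1 <= LMnat t.
Proof.
case: t => [|[|[|t]]] // t0; rewrite /LMnat big_ltn // big_ltn //.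
rewrite addnA; apply: leq_trans (leq_addr _ _).
have := qrE t.+2 1; have := @qr_le t.+2 1 isT; have := qrE t.+1 2; have := @qr_le t.+1 2 isT.
rewrite !subSS !subn0 => h1 h2 h3 h4.
have : 2 ^ 1 <= 2 ^ t by rewrite leq_exp2l.
by move: h2 h4; rewrite !expnS; move: (qr _ _) (qr _ _) h1 h3 => [? ?] [? ?] /=; lia.
Qed.

Section Params.
Variables (d : nat) (T : nat -> nat -> nat).

Definition fanin a i := if i == d.+2 then 2 ^ (2 ^ a) else low_fanin d T a i.

Definition modW i (aW : W) : W := tripn (d + i) (h3W aW).

(** At level 1 the hash is the number of the copy, in a bits, so that these 2^a copies have disjoint
    variables. *)
Definition hashes (aW : W) i (k j : W) : W :=
  if i == 1 then take (size aW) (k ++ nseq (size aW) (Some false))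
  else hashW (modW i aW) j k.

Definition hsize a i : nat :=
  if i == 1 then a else size (modW i (nseq a (Some true)) ++ modW i (nseq a (Some true))).

Definition tableW i (aW : W) : W :=
  if size aW < d + 8 then enc_nat (T (size aW) i) else [::].

(** A fan-in with 2^a + a digits may be too long to be written down. Lengths decide unless k has
    exactly that many digits, and then k itself serves as the unary argument of [LMW]. *)
Definition below (aW : W) i (k : W) : bool :=
  if i == 1 then size k <= size aW
  else if i == d.+2 then size k <= size (powcap aW k)
  else if size aW < d + 8 then lessW k (tableW i aW)
  else if size k < size (powcap aW k ++ aW) then true
  else if size (powcap aW k ++ aW) < size k then false
  else lessW k (LMW k).

Lemma fanin_gt0 a i : (forall i, 0 < T a i) -> 0 < fanin a i.
Proof.
move=> T0; rewrite /fanin /low_fanin /mid_fanin; do 2![case: ifP => _; first by rewrite expn_gt0].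
have [//|ad] := ltnP a (d + 8).
apply: (leq_trans _ (LMnat_ge _)); rewrite ?expn_gt0 //.
by apply: leq_trans (leq_addl _ _); lia.
Qed.

Lemma None_hashW h j k : None \notin hashW h j k.
Proof.
rewrite /hashW /hash_state; elim/last_ind: {-1}k => [|l a _].
  by rewrite /= mem_nseq andbF.
rewrite fold3_rcons /= /hash1; move: (mulW _ _ _) => v.
by set u := (X in xorW X _); elim: u v => //= b u IH v; rewrite inE negb_or IH.
Qed.

Lemma None_hashes aW i k j : None \notin k -> None \notin hashes aW i k j.
Proof.
move=> kN; rewrite /hashes; case: ifP => _; last exact: None_hashW.
apply: contra kN => /mem_take; rewrite mem_cat mem_nseq andbF orbF //.
Qed.

Lemma size_hashes a i k j : size (hashes (nseq a (Some true)) i k j) = hsize a i.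
Proof.
rewrite /hashes /hsize; case: ifP => _; last by rewrite size_hashW.
by rewrite size_take_min size_cat !size_nseq; lia.
Qed.

Lemma belowE a i k : 4 <= a -> below (nseq a (Some true)) i (enc_nat k) = (k < fanin a i).
Proof.
move=> a4; rewrite /below /fanin /low_fanin size_nseq size_powcap size_nseq.
have [->|i1] := eqVneq i 1; first by rewrite size_enc_nat.
have [_|i2] := eqVneq i d.+2.
  by rewrite size_enc_nat; move: (2 ^ a) => z; lia.
rewrite /mid_fanin /tableW size_nseq; have [ad|ad] := ltnP a (d + 8).
  by rewrite lessWE !val2_enc.
rewrite size_cat size_powcap !size_nseq.
set t := 2 ^ a + a; have t4 : 4 <= t by rewrite /t; lia.
have e1 : (size (enc_nat k) < minn (2 ^ a) (size (enc_nat k)).+1 + a) = (size (enc_nat k) < t).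
  by rewrite /t; move: (2 ^ a) => z; lia.
have e2 : (minn (2 ^ a) (size (enc_nat k)).+1 + a < size (enc_nat k)) = (t < size (enc_nat k)).
  by rewrite /t; move: (2 ^ a) => z; lia.
rewrite e1 e2; have h1 := size_enc_nat k t; have h2 := size_enc_nat k t.-1.
have h3 := LMnat_lt t; have h4 := LMnat_ge t4.
case: ltnP => k1; first by rewrite (leq_trans _ h4) // h2; lia.
case: ltnP => k2; first by apply/esym/negbTE; rewrite -leqNgt (leq_trans (ltnW h3)) // leqNgt h1 -ltnNge.
by rewrite lessWE val2_enc val2_LMW; congr (_ < LMnat _); lia.
Qed.

Lemma PT_modW i f : PT f -> PT (fun e => modW i (f e)).
Proof. by move=> hf; rewrite /modW; pt. Qed.
#[local] Hint Resolve PT_modW : pt.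

Lemma PT_hashes i A f g : PT A -> PT f -> PT g -> PT (fun e => hashes (A e) i (f e) (g e)).
Proof.
move=> hA hf hg; rewrite /hashes; case: (i == 1); last by pt.
by apply: PT_take => //; apply: PT_cat => //; pt.
Qed.

Lemma PTB_below i A f : PT A -> PT f -> PTB (fun e => below (A e) i (f e)).
Proof.
move=> hA hf; rewrite /below; case: (i == 1); first by pt.
case: (i == d.+2); first by pt.
apply: PTB_if; [|apply: PTB_lessW => //|].
- by have := PTB_ltn hA (PT_const (nseq (d + 8) (Some true))); apply: eq_PTB => e; rewrite size_nseq.
- exact: (PT_table (fun n => enc_nat (T n i)) (d + 8) hA).
have hu : PT (fun e => powcap (A e) (f e) ++ A e) by pt.
by apply: PTB_if; pt.
Qed.

(** [None] stands for the case delta >= 7/8: all gates have fan-in 1 and there is a single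
    variable. *)
Definition sizes (o : option nat) : nat -> nat := if o is Some a then hsize a else fun=> 0.

Definition fanins (o : option nat) : nat -> nat := if o is Some a then fanin a else fun=> 1.

Definition shifts (o : option nat) : nat -> W -> W -> W :=
  if o is Some a then hashes (nseq a (Some true)) else fun _ _ _ => [::].

Definition gamma (o : option nat) : formula (2 ^ nb (sizes o) d.+2) :=
  build (fanins o) (s := sizes o) (shifts o) (i := d.+2) id.

Definition zeros b : W := nseq b (Some false).

(* p/q < 7/8, that is, 8p + q < 8q; otherwise a single sample suffices. *)
Definition moderate (p q : W) : bool := lessW (addW (zeros 3 ++ p) q) (zeros 3 ++ q).

(** The additional 10 makes 2^a larger by 2^10 = 16 64, which absorbs the constants in the required
    bias 32 (16/2^a)^(d+1). *)
Definition scale (p q : W) : W := nseq 10 (Some true) ++ nseq (size (apar d.+1 p q)) (Some true).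

Definition wiring (p q g h : W) : W :=
  let b := if moderate p q then wireW (hashes (scale p q)) (below (scale p q)) d.+2 g h
    else wireW (fun _ _ _ => [::]) (fun _ k => nilp k) d.+2 g h in
  if b then [:: Some true] else [::].

Lemma PT_wiring : PT (fun e => wiring (e 0) (e 1) (e 2) (e 3)).
Proof.
have pA : PT (fun e => scale (e 0) (e 1)).
  rewrite /scale; apply: PT_cat; first by pt.
  by apply: (@PT_nseq _ (fun e => apar d.+1 (e 0) (e 1))); pt.
have h1 : PTB (fun e => wireW (hashes (scale (e 0) (e 1))) (below (scale (e 0) (e 1))) d.+2 (e 2) (e 3)).
  apply: (@PTB_wireW (fun e => hashes (scale (e 0) (e 1))) (fun e => below (scale (e 0) (e 1)))) => //; try pt.
    by move=> i f g hf hg; apply: PT_hashes.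
  by move=> i f hf; apply: PTB_below.
have h2 : PTB (fun e => wireW (fun _ _ _ => [::]) (fun _ k => nilp k) d.+2 (e 2) (e 3)).
  by apply: (@PTB_wireW (fun e _ _ _ => [::]) (fun e _ k => nilp k)) => *; pt.
have h3 : PTB (fun e => moderate (e 0) (e 1)).
  rewrite /moderate /zeros; apply: PTB_lessW; last by pt.
  by apply: PT_addW; pt.
by rewrite /wiring; apply: PT_ifb; [apply: PTB_if | pt | pt].
Qed.

Definition param (p q : nat) : option nat :=
  if 8 * p + q < 8 * q then Some (10 + size (apar d.+1 (enc_nat p) (enc_nat q))) else None.

Lemma wiringE p q g h : (forall a i, 11 <= a -> 0 < T a i) -> 0 < p < q ->
  ohead (wiring (enc_nat p) (enc_nat q) (enc_gate g) (enc_gate h)) = Some (Some true) <->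
  wire (gamma (param p q)) g h.
Proof.
move=> T0 /andP[p0 pq]; rewrite /wiring.
have -> : moderate (enc_nat p) (enc_nat q) = (8 * p + q < 8 * q).
  by rewrite /moderate lessWE addWE !val2_cat !val2_nseq !size_nseq !val2_enc !add0n.
rewrite /gamma /param; case: ltnP => hpq; last first.
  rewrite -(@wireWE _ (fun=> 0) (fun _ _ _ => [::]) (fun _ k => nilp k)) //.
    by case: ifP.
  by move=> i k; have := size_enc_nat k 0; rewrite leqn0.
set a := 10 + _; have -> : scale (enc_nat p) (enc_nat q) = nseq a (Some true).
  by rewrite /scale -nseqD.
have [] := @aparE d.+1 (enc_nat p) (enc_nat q) isT.
  by rewrite val2_enc.
rewrite !val2_enc => h1 _.
have a11 : 11 <= a.
  rewrite /a; case: (size _) h1 => [|n _]; last by lia.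
  by rewrite muln0 mul1n leqNgt pq.
rewrite -(@wireWE (fanin a) (hsize a) (hashes (nseq a (Some true))) (below (nseq a (Some true)))).
- by case: ifP.
- by move=> i k j; apply: size_hashes.
- by move=> i k j; apply: None_hashes.
- by move=> i; apply: fanin_gt0 => j; apply: T0.
by move=> i k; apply: belowE; lia.
Qed.

Lemma explicit_gamma (R : realType) (o : R -> option nat) :
  (forall a i, 11 <= a -> 0 < T a i) ->
  (forall p q, 0 < p < q -> o (p%:R / q%:R)%R = param p q) ->
  explicit (fun delta => gamma (o delta)).
Proof.
move=> T0 ho; have [c [e he]] := PT_program PT_wiring.
exists c, e => p q g h pq.
have sz x : 0 < x -> 0 < size (enc_nat x).
  by move=> x0; have := size_enc_nat x 0; case: (size _) => //; lia.
have [//|/=|t [st [h1 h2 h3]]] := he (query p q g h).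
  by case/andP: pq => p0 pq; rewrite !size_cat; have := sz p p0; have := sz q (ltn_trans p0 pq); lia.
exists t, st; split => //; rewrite ho // -wiringE // /accepting h3 //.
Qed.

End Params.

(** * Bounds on sharing, size and sample complexity, and the theorem *)

Section Design.
Variables (d : nat) (T : nat -> nat -> nat) (a : nat).
Hypothesis a0 : 0 < a.
Let aW : W := nseq a (Some true).

(** The hash of level i + 2 has 2 3^(d+i+2+n) bits and is added to at most 3^(d+i+2+n) index bits,
    so the bound triples with each level. *)
Lemma nb_le n i : size (h3W aW) = 3 ^ n -> a <= 3 ^ n ->
  nb (hsize d a) i.+1 <= 3 ^ (d + i.+2 + n).
Proof.
move=> hn an; elim: i => [|i IH].
  rewrite /= /hsize /= add0n (leq_trans an) // leq_exp2l // leq_addl //.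
have e1 : hsize d a i.+2 = 3 ^ (d + i.+2 + n) + 3 ^ (d + i.+2 + n).
  by rewrite /hsize [_ == 1]/= size_cat /modW size_tripn hn -expnD.
rewrite (_ : nb _ i.+2 = nb (hsize d a) i.+1 + hsize d a i.+2) // e1.
rewrite [3 ^ (d + i.+3 + n)](_ : _ = 3 * 3 ^ (d + i.+2 + n)); last by rewrite -expnS; congr (3 ^ _); lia.
lia.
Qed.

Lemma sg_hashes i k l j : @sg (hsize d a) (hashes d aW) i k j = sg (hashes d aW) l j ->
  hashes d aW i.+1 (enc_nat k) (bits (nb (hsize d a) i) j) =
  hashes d aW i.+1 (enc_nat l) (bits (nb (hsize d a) i) j).
Proof.
move=> /(congr1 val) /= /eqP; rewrite eqn_add2l eqn_mul2l expn_eq0 /= /hnat => /eqP.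
set u := hashes _ _ _ _ _; set v := hashes _ _ _ _ _.
have su : size u = hsize d a i.+1 by apply: size_hashes.
have sv : size v = hsize d a i.+1 by apply: size_hashes.
rewrite -{1}su -sv !modn_small ?val2_lt // => E.
rewrite -[u]bits_val2 ?None_hashes ?None_enc // -[v]bits_val2 ?None_hashes ?None_enc //.
by rewrite E su sv.
Qed.

Local Open Scope ring_scope.

Lemma shared_hashes (R : realType) i (k : 'I_(fanin d T a i.+1)) : (i <= d.+1)%N ->
  \sum_(l < fanin d T a i.+1 | (l != k) &&
      (shared (fun k : 'I_(fanin d T a i.+1) => @sg (hsize d a) (hashes d aW) i k) l k != set0))
    4 ^+ #|shared (fun k : 'I_(fanin d T a i.+1) => @sg (hsize d a) (hashes d aW) i k) l k| <=
  (fanin d T a i.+1)%:R * (32 * (16 / (2 ^ a)%:R) ^+ d.+1 / (16 * (2 ^ a)%:R)) :> R.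
Proof.
have m1 : 1 <= (2 ^ a)%:R :> R by rewrite ler1n expn_gt0.
have m0 : 0 < (2 ^ a)%:R :> R by lra.
case: i k => [|i] k id.
  rewrite big_pred0; first by rewrite mulr_ge0 // divr_ge0 ?mulr_ge0 ?exprn_ge0 ?divr_ge0 // ltW.
  move=> l; apply/negbTE; rewrite negb_and !negbK; case: eqVneq => //= lk.
  apply/eqP/setP => j; rewrite !inE; apply/eqP => E; have := congr1 val2 (@sg_hashes 0 l k j E).
  rewrite /hashes /= !(val2_take_drop _ _).1 !val2_cat !val2_nseq !muln0 !addn0 !val2_enc size_nseq.
  have hl : (l < 2 ^ a)%N := ltn_ord l; have hk : (k < 2 ^ a)%N := ltn_ord k.
  by rewrite !modn_small // => /val_inj e; rewrite e eqxx in lk.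
have [n [hn an _]] : exists n, [/\ size (h3W aW) = 3 ^ n,
    size aW <= 3 ^ n & 3 ^ n <= 3 * size aW]%N by apply: h3WE; rewrite size_nseq.
rewrite size_nseq in an.
pose e := (d + i.+2 + n)%N; pose K := (2 ^ (3 ^ e + 3 ^ e))%N; pose m : R := (2 ^ a)%:R.
have hm : size (modW d i.+2 aW) = (3 ^ e)%N by rewrite /modW size_tripn hn -expnD.
have hnb := nb_le i hn an; rewrite -/e in hnb.
have he : (3 + a * d.+2 <= 3 ^ e)%N.
  rewrite /e !expnD; have h1 : (d < 3 ^ d)%N by apply: ltn_expl.
  have h2 : (3 ^ 2 <= 3 ^ i.+2)%N by rewrite leq_exp2l.
  apply: (@leq_trans (d.+1 * 9 * a)); first by nia.
  by apply: leq_mul => //; apply: leq_mul.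
apply: le_trans (@sum_shared R _ _ K (fun l => shared (fun k0 : 'I_(fanin d T a i.+2) =>
    @sg (hsize d a) (hashes d aW) i.+1 k0) l k) k 4 _ _ _) _ => //.
- by rewrite expn_gt0.
- move=> S S0; apply: card_agree => // [|l l' hl hl' hq]; first by rewrite expn_gt0.
  apply: val_inj.
  apply: (@hash_agree e (modW d i.+2 aW) hm (nb (hsize d a) i.+1) l l' [seq val x | x in S]).
  + by rewrite (leq_trans hnb) // leq_addr.
  + by rewrite map_inj_uniq ?enum_uniq //; apply: val_inj.
  + move=> j /imageP[x xS ->]; split; first exact: ltn_ord.
    have h (y : 'I_(fanin d T a i.+2)) :
        (y == k) || (S \subset shared (fun k0 : 'I_(fanin d T a i.+2) =>
          @sg (hsize d a) (hashes d aW) i.+1 k0) y k) ->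
        hashW (modW d i.+2 aW) (bits (nb (hsize d a) i.+1) x) (enc_nat y) =
        hashW (modW d i.+2 aW) (bits (nb (hsize d a) i.+1) x) (enc_nat k).
      case/orP=> [/eqP -> //|/subsetP /(_ _ xS)]; rewrite inE => /eqP E.
      exact: (sg_hashes E).
    by rewrite (h l hl) (h l' hl').
  + by rewrite size_map -cardE.
rewrite ler_wpM2l //; set N := (2 ^ _)%N.
have K0 : 0 < K%:R :> R by rewrite ltr0n expn_gt0.
(* Of the 2 3^e bits of the hash, one half makes up for the number N of variables, the other for the
   factor 8 m^(d+2). *)
have hK : 8 * N%:R * m ^+ d.+2 <= K%:R :> R.
  rewrite /m /N /K -!(natrM, natrX) ler_nat (_ : 8 = 2 ^ 3)%N // -expnM -!expnD leq_exp2l //.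
  by move: (nb _ _) hnb he => z; move: (3 ^ e)%N => w; lia.
have mq : 1 <= m ^+ d.+2 by apply: exprn_ege1.
pose x : R := 4 / K%:R.
have x0 : 0 <= x by rewrite divr_ge0 // ltW.
have hNx : 2 * (N%:R * x) * m ^+ d.+2 <= 1.
  rewrite (_ : 2 * _ * _ = 8 * N%:R * m ^+ d.+2 / K%:R); last by rewrite /x; ring.
  by rewrite ler_pdivrMr // mul1r.
have N0 : 0 <= N%:R * x by rewrite mulr_ge0.
have hh : 2 * (N%:R * x) <= 1 by apply: le_trans hNx; rewrite ler_peMr // mulr_ge0.
(* From (1 + x)^N (1 - x)^N <= 1 and Bernoulli's inequality, (1 + x)^N <= 1/(1 - N x). *)
have hpow : (1 + x) ^+ N - 1 <= 2 * (N%:R * x).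
  have x1 : 0 <= x <= 1.
    have : 1 * x <= N%:R * x by rewrite ler_wpM2r // ler1n expn_gt0.
    lra.
  have h1 : 1 - N%:R * x <= (1 - x) ^+ N.
    by rewrite -mulrN; apply: bernoulli; lra.
  have h2 : (1 + x) ^+ N * (1 - x) ^+ N <= 1.
    rewrite -exprMn; apply: exprn_ile1; nra.
  have h3 : 1 <= (1 + x) ^+ N by apply: exprn_ege1; lra.
  have h4 : (1 + x) ^+ N * (1 - N%:R * x) <= 1.
    by apply: le_trans h2; rewrite ler_wpM2l //; lra.
  by move: h3 h4 hh N0; move: ((1 + x) ^+ N) (N%:R * x) => y z; nra.
apply: le_trans hpow _; rewrite -/m expr_div_n.
have -> : 32 * (16 ^+ d.+1 / m ^+ d.+1) / (16 * m) = 2 * 16 ^+ d.+1 / m ^+ d.+2.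
  have mB : m ^+ d.+1 != 0 by rewrite expf_neq0 // gt_eqF.
  have mA : m != 0 by rewrite gt_eqF.
  rewrite [m ^+ d.+2]exprSr; move: (m ^+ d.+1) (16 ^+ d.+1) mB => B A mB.
  by field; rewrite mA mB.
rewrite ler_pdivlMr; last by lra.
apply: le_trans hNx _; have : 1 <= 16 ^+ d.+1 :> R by apply: exprn_ege1; lra.
lra.
Qed.

End Design.

Lemma bsize_le M B n : (forall i, 1 <= i <= n -> M i <= 2 ^ B) ->
  bsize M n <= 2 ^ (B.+1 * n).
Proof.
elim: n => [|n IH] h; first by rewrite muln0.
have {}IH : bsize M n <= 2 ^ (B.+1 * n).
  by apply: IH => i /andP[i0 iN]; apply: h; rewrite i0 leqW.
have := h n.+1 (ltnSn n); rewrite mulnS /= expnD expnS => hM.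
apply: (@leq_trans (2 ^ B * 2 ^ (B.+1 * n)).+1); first by rewrite ltnS leq_mul.
have : 0 < 2 ^ B * 2 ^ (B.+1 * n) by rewrite muln_gt0 !expn_gt0.
rewrite -mulnA; move: (_ * _) => z; lia.
Qed.

Lemma leq_add3_exp a : 3 <= a -> a + 3 <= 2 ^ a.
Proof.
elim: a => // a IH; rewrite leq_eqVlt => /orP[/eqP<- //|/IH].
by rewrite expnS; lia.
Qed.

Section Assembly.
Local Open Scope ring_scope.
Variable R : realType.

Lemma coin_prob_coordinate (al : R) n (j : 'I_n) : n = 1%N ->
  coin_prob al (fun x => x j) = al.
Proof.
move=> n1; subst n; rewrite /coin_prob (big_pred1 [ffun=> true]) => [|x].
  by rewrite /coin_dist big_ord1 ffunE.
apply/idP/eqP => [h|->]; last by rewrite ffunE.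
by apply/ffunP => i; rewrite ffunE (ord1 i) -(ord1 j).
Qed.

Lemma ev_trivial i x : @ev (fun=> 1%N) (fun=> 0%N) (fun _ _ _ => [::]) i x =
  x (Ordinal (expn_gt0 2 (nb (fun=> 0%N) i))).
Proof.
elim: i x => [|i IH] x; first by congr (x _); apply: val_inj.
have e (k : 'I_1) : pull (@sg (fun=> 0%N) (fun _ _ _ => [::]) i k) x
    (Ordinal (expn_gt0 2 (nb (fun=> 0%N) i))) = x (Ordinal (expn_gt0 2 (nb (fun=> 0%N) i.+1))).
  by rewrite ffunE; congr (x _); apply: val_inj; rewrite /= modn1 muln0.
rewrite [LHS]/=; case: (odd i).
  by apply/existsP/idP => [[k]|h]; [rewrite IH e | exists ord0; rewrite IH e].
by apply/forallP/idP => [/(_ ord0)|h k]; rewrite IH e.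
Qed.

Variables (d : nat) (T : nat -> nat -> nat).
Hypothesis T0 : forall a i, (11 <= a -> 0 < T a i)%N.
Hypothesis hT : forall a i, (11 <= a)%N -> (1 <= i <= d.+1)%N ->
  near_center a (center R (low_fanin d T a) i).

Lemma solves_gamma o delta : solves_coin delta (@ev (fanins d T o) (sizes d o) (shifts d o) d.+2) ->
  (forall i, 0 < fanins d T o i)%N ->
  solves_coin (R := R) delta (fun x => eval x (gamma d T o)).
Proof.
move=> h M0; rewrite (_ : (fun x => _) = @ev (fanins d T o) (sizes d o) (shifts d o) d.+2) //.
apply/boolp.funext => x; rewrite eval_build //; congr ev.
by apply/ffunP => j; rewrite ffunE.
Qed.

Lemma solves_trivial (delta : R) : 7 / 8 <= delta < 1 -> solves_coin delta (fun x => eval x (gamma d T None)).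
Proof.
move=> /andP[h1 h2]; apply: solves_gamma => //.
have e : @ev (fun=> 1%N) (fun=> 0%N) (fun _ _ _ => [::]) d.+2 =
    fun x => x (Ordinal (expn_gt0 2 (nb (fun=> 0%N) d.+2))).
  by apply/boolp.funext => x; rewrite ev_trivial.
have n1 : (2 ^ nb (fun=> 0%N) d.+2 = 1)%N.
  by elim: d.+2 => //= i; rewrite addn0.
by rewrite /fanins /sizes /shifts e /solves_coin !(coin_prob_coordinate _ _ n1); split; lra.
Qed.

Lemma near_fanin a i : (11 <= a)%N -> (1 <= i <= d.+1)%N -> near_center a (center R (fanin d T a) i).
Proof.
move=> a11 id; suff -> : center R (fanin d T a) i = center R (low_fanin d T a) i by apply: hT.
case/andP: id => _; elim: i => //= i IH id; rewrite IH ?(ltnW id) //.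
by rewrite /fanin ltn_eqF.
Qed.

Lemma solves_moderate a (delta : R) : (11 <= a)%N -> 32 * (16 / (2 ^ a)%:R) ^+ d.+1 <= delta ->
  delta < 1 -> solves_coin delta (fun x => eval x (gamma d T (Some a))).
Proof.
move=> a11 h1 h2; apply: solves_gamma => [|i]; last first.
  by apply: fanin_gt0 => j; apply: T0.
apply: (build_solves (delta1 := 32 * (16 / (2 ^ a)%:R) ^+ d.+1)
  (eps := 32 * (16 / (2 ^ a)%:R) ^+ d.+1 / (16 * (2 ^ a)%:R)) a11) => //.
- by rewrite lexx andbT divr_ge0 ?mulr_ge0 ?exprn_ge0 ?divr_ge0.
- by rewrite /= /fanin eqxx.
- by move=> i; apply: near_fanin.
by move=> i k; apply: shared_hashes; apply: leq_trans a11.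
Qed.

(** Tabulated fan-ins are known only through their centers: M c <= 2m and c >= 2^-m/2 bound a middle
    fan-in by 4 m 2^m. *)
Lemma fanin_le a i : (11 <= a)%N -> (1 <= i <= d.+2)%N -> (fanin d T a i <= 2 ^ (2 ^ a + a + 2))%N.
Proof.
move=> a11 id; rewrite -addnA.
have [->|i2] := eqVneq i d.+2.
  by rewrite /fanin eqxx leq_exp2l // leq_addr.
have [->|i1] := eqVneq i 1%N.
  by rewrite /fanin /low_fanin /= leq_exp2l //; move: (2 ^ a)%N => z; lia.
case: i id i1 i2 => [|[|i]] // id _ i2.
have hi : (1 <= i.+1 <= d.+1)%N by lia.
have hi2 : (1 <= i.+2 <= d.+1)%N by lia.
have hc := near_fanin a11 hi; have hc2 := near_fanin a11 hi2.
have /andP[_ hk] := kappa_near a11 hc hc2.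
move: hc; rewrite /near_center; set c := center R _ _ in hk * => /andP[h1 _].
rewrite -(ler_nat R) !expnD !natrM.
move: hk h1; set M := (fanin _ _ _ _)%:R; set mu : R := (2 ^ _ ^ _)%:R; set m : R := (2 ^ a)%:R.
move=> hk h1; have M0 : 0 <= M by [].
have mu0 : 0 <= mu by [].
have e1 : M * 2^-1 <= M * (mu * c) by apply: ler_wpM2l.
have e2 : M * c * mu <= 2 * m * mu by apply: ler_wpM2r.
lra.
Qed.

Lemma least_scale (delta : R) : 0 < delta -> exists n : nat,
  1 <= (2 ^ (d.+1 * n))%:R * delta /\ forall b, (b < n)%N -> (2 ^ (d.+1 * b))%:R * delta < 1.
Proof.
move=> d0; have ex : exists n, 1 <= (2 ^ (d.+1 * n))%:R * delta.
  have h0 : 0 <= delta^-1 by rewrite invr_ge0 ltW.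
  exists (Num.Def.archi_bound delta^-1).
  have := archi_boundP h0; set n := Num.Def.archi_bound _ => hn.
  rewrite -ler_pdivrMr // mul1r; apply: le_trans (ltW hn) _; rewrite ler_nat.
  by apply: leq_trans (ltnW (ltn_expl n (ltnSn 1))) _; rewrite leq_exp2l // leq_pmull.
exists (ex_minn ex); case: ex_minnP => n hn hmin; split => // b bn.
by rewrite ltNge; apply: contraL bn => /hmin; rewrite leqNgt.
Qed.

(** The formula is needed for every real delta, whereas the program sees a fraction. The real
    parameter is characterized by minimality, so it agrees with the one computed from any p and q
    representing delta. *)
Lemma param_exists : exists o : R -> option nat,
  [/\ forall p q, (0 < p < q)%N -> o (p%:R / q%:R) = param d p q,
      forall delta : R, 7 / 8 <= delta -> o delta = None &
      forall delta : R, 0 < delta < 7 / 8 -> exists n, [/\ o delta = Some (10 + n)%N,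
        1 <= (2 ^ (d.+1 * n))%:R * delta &
        forall b, (b < n)%N -> (2 ^ (d.+1 * b))%:R * delta < 1]].
Proof.
pose P (delta : R) n := 1 <= (2 ^ (d.+1 * n))%:R * delta /\
  forall b, (b < n)%N -> (2 ^ (d.+1 * b))%:R * delta < 1.
have [f hf] : {f : R -> nat & forall delta : R, 0 < delta -> P delta (f delta)}.
  apply: (@boolp.choice _ _ (fun delta n => 0 < delta -> P delta n)) => delta.
  by have [/least_scale [n hn]|] := boolP (0 < delta); [exists n | exists 0%N].
exists (fun delta => if delta < 7 / 8 then Some (10 + f delta)%N else None); split.
- move=> p q /andP[p0 pq]; rewrite /param.
  have q0 : 0 < q%:R :> R by rewrite ltr0n (leq_ltn_trans _ pq).
  have dp : 0 < p%:R / q%:R :> R by rewrite divr_gt0 // ltr0n.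
  rewrite ltr_pdivrMr // mulrAC ltr_pdivlMr // -!natrM ltr_nat.
  rewrite (_ : (p * 8 < 7 * q)%N = (8 * p + q < 8 * q)%N); last by lia.
  case: ifP => // _; congr Some; congr addn.
  have [h1 h2] := hf _ dp.
  have [|h3 h4] := @aparE d.+1 (enc_nat p) (enc_nat q) isT; first by rewrite val2_enc.
  rewrite !val2_enc in h3 h4.
  have e n : (1 <= (2 ^ (d.+1 * n))%:R * (p%:R / q%:R) :> R) = (q <= 2 ^ (d.+1 * n) * p)%N.
    by rewrite mulrA ler_pdivlMr // mul1r -natrM ler_nat.
  apply/eqP; rewrite eqn_leq; apply/andP; split; rewrite leqNgt; apply/negP.
    by move=> /h2; rewrite ltNge e h3.
  by move=> /h4; rewrite ltnNge -e h1.
- by move=> delta; rewrite leNgt => /negPf ->.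
move=> delta /andP[d0 ->]; exists (f delta).
by have [h1 h2] := hf _ d0.
Qed.

Lemma natr_exp_expR n : (2 ^ n)%:R <= expR n%:R :> R.
Proof.
rewrite -[n%:R]mulr1 expRM_natl natrX lerXn2r ?nnegrE ?expR_ge0 //.
by have := expR_ge1Dx (1 : R); rewrite (_ : 1 + 1 = 2 :> R) //; ring.
Qed.

Lemma fsize_moderate a : (11 <= a)%N ->
  (fsize (gamma d T (Some a)))%:R <= expR ((2 * 2 ^ a * d.+2)%:R : R).
Proof.
move=> a11; rewrite /gamma fsize_build => [|i]; last by apply: fanin_gt0 => j; apply: T0.
apply: le_trans (natr_exp_expR _); rewrite ler_nat.
apply: leq_trans (bsize_le (fun i => @fanin_le a i a11)) _.
rewrite leq_exp2l // leq_mul2r /=.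
have : (a + 3 <= 2 ^ a)%N by apply: leq_add3_exp; apply: leq_trans a11.
by move: (2 ^ a)%N => z; lia.
Qed.

End Assembly.

Local Open Scope ring_scope.

Theorem theorem2p2 (R : realType) :
  exists C : nat, forall d : nat, (2 <= d)%N ->
  exists (N : R -> nat) (Gamma : forall delta : R, formula (N delta)),
    explicit Gamma /\
    forall delta : R, 0 < delta < 1 ->
      [/\ (1 <= N delta)%N,
          depth (Gamma delta) = d,
          solves_coin delta (fun x => eval x (Gamma delta)),
          (fsize (Gamma delta))%:R
            <= expR (C%:R * (d%:R * (1 / delta) `^ (1 / (d.-1)%:R))) &
          (N delta)%:R <= (1 / delta) ^+ (2 ^ (C * d))].
Proof.
(* The size dictates the constant: 2 2^a = 2^12 2^n for a = 10 + (n + 1). The sample complexity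
   leaves ample room. *)
exists (2 ^ 12)%N => -[|[|d]] // _.
have [T hT] := centers_exist R d.
have T0 a i : (11 <= a -> 0 < T a i)%N by move=> /hT[].
have hc a i : (11 <= a)%N -> (1 <= i <= d.+1)%N -> near_center a (center R (low_fanin d T a) i).
  by move=> /hT[_]; apply.
have [o [o1 o2 o3]] := param_exists R d.
exists (fun delta => 2 ^ nb (sizes d (o delta)) d.+2)%N, (fun delta => gamma d T (o delta)).
split; first exact: explicit_gamma.
move=> delta /andP[d0 d1]; set y := (1 / delta) `^ _.
have x1 : 1 <= 1 / delta by rewrite ler_pdivlMr // mul1r ltW.
have yx : y ^+ d.+1 = 1 / delta.
  rewrite -powR_mulrn ?powR_ge0 // /y -powRrM divfK ?pnatr_eq0 // powRr1 //; lra.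
have y0 : 0 <= y by apply: powR_ge0.
have y1 : 1 <= y.
  by rewrite leNgt; apply/negP => h; move: x1; rewrite -yx leNgt exprn_ilt1.
split; first by rewrite expn_gt0.
- exact: depth_build.
- have [h|h] := leP (7 / 8) delta; first by rewrite o2 //; apply: solves_trivial; rewrite h.
  have [|n [-> h1 h2]] := o3 delta; first by rewrite d0.
  apply: (solves_moderate T0 hc) => //.
    case: n h1 {h2} => //.
    by rewrite muln0 mul1r leNgt d1.
  have z0 : 0 < (2 ^ (d.+1 * n))%:R :> R by rewrite ltr0n expn_gt0.
  rewrite (_ : 16 / (2 ^ (10 + n))%:R = 64^-1 / (2 ^ n)%:R); last first.
    rewrite expnD natrM (_ : (2 ^ 10)%:R = 16 * 64 :> R); last by rewrite -natrM.
    by field; rewrite pnatr_eq0 expn_eq0.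
  have e : (2 ^ n)%:R^-1 ^+ d.+1 = (2 ^ (d.+1 * n))%:R^-1 :> R.
    by rewrite exprVn -natrX -expnM mulnC.
  rewrite exprMn e mulrA ler_pdivrMr // [delta * _]mulrC.
  have : (64^-1) ^+ d.+1 <= 64^-1 :> R by rewrite -[leRHS]expr1 ler_wiXn2l //; lra.
  lra.
- have [h|h] := leP (7 / 8) delta.
    rewrite o2 // /gamma fsize_build // (_ : bsize _ _ = d.+3); last first.
      by elim: d.+2 => //= n ->; rewrite mul1n.
    apply: le_trans (expR_ge1Dx _); rewrite -addn1 natrD addrC lerD2l.
    rewrite mulrCA ler_peMr // natrX.
    have : 1 <= (2 : R) ^+ 12 by apply: exprn_ege1; lra.
    by move: ((2 : R) ^+ 12) => z; nra.
  have [|n [-> h1 h2]] := o3 delta; first by rewrite d0.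
  have a11 : (11 <= 10 + n)%N.
    case: n h1 {h2} => //.
    by rewrite muln0 mul1r leNgt d1.
  apply: le_trans (fsize_moderate T0 hc a11) _; rewrite ler_expR.
  case: n h1 h2 a11 => // n h1 h2 a11.
  (* Minimality of n + 1 gives 2^((d+1) n) < 1/delta. *)
  have hy : (2 ^ n)%:R <= y.
    rewrite -(@ler_pXn2r _ d.+1) ?nnegrE // yx -natrX -expnM mulnC.
    by rewrite ler_pdivlMr // ltW // h2.
  rewrite natrM mulrCA mulrC ler_wpM2l // (_ : 2 * 2 ^ (10 + n.+1) = 2 ^ 12 * 2 ^ n)%N; last first.
    by rewrite -expnS -expnD; congr (2 ^ _)%N; lia.
  by rewrite natrM ler_wpM2l.
have [h|h] := leP (7 / 8) delta.
  rewrite o2 // (_ : nb _ _ = 0%N); first exact: exprn_ege1.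
  by elim: d.+2 => //= i; rewrite addn0.
have [|n [-> h1 h2]] := o3 delta; first by rewrite d0.
case: n h1 h2 => [|n h1 h2]; first by move=> h1; exfalso; move: h1; rewrite muln0 mul1r leNgt d1.
have a0 : (0 < 10 + n.+1)%N by [].
have [l [hl al l3]] : exists l, [/\ size (h3W (nseq (10 + n.+1) (Some true))) = 3 ^ l,
    size (nseq (10 + n.+1) (Some true : symbol)) <= 3 ^ l &
    3 ^ l <= 3 * size (nseq (10 + n.+1) (Some true : symbol))]%N by apply: h3WE; rewrite size_nseq.
rewrite size_nseq in al l3.
(* The factor 11 comes from 3^l <= 3 (n + 11) <= 33 (n + 1). *)
have hN : (nb (sizes d (Some (10 + n.+1))) d.+2 <= n.+1 * (11 * 9 ^ d.+2))%N.
  apply: leq_trans (nb_le d a0 d.+1 hl al) _.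
  rewrite (_ : d + d.+3 + l = d.+1 + d.+2 + l)%N; last by lia.
  rewrite expnD (_ : 9 ^ d.+2 = 3 ^ (d.+1 + d.+2) * 3)%N.
    by move: (3 ^ (d.+1 + d.+2))%N => z; nia.
  by rewrite -(expnM 3 2) -expnSr; congr (3 ^ _)%N; lia.
apply: le_trans (_ : (2 ^ (n.+1 * (11 * 9 ^ d.+2)))%:R <= _); first by rewrite ler_nat leq_exp2l.
(* 2^n is at most 1/delta, and the remaining factor 2 is paid for by (1/delta)^6, as 1/delta > 8/7.
   This is the use of the restriction to delta < 7/8. *)
have hn : (2 ^ n.+1)%:R <= (1 / delta) ^+ 7.
  have hx : (2 ^ n)%:R <= 1 / delta.
    rewrite ler_pdivlMr // ltW //; apply: le_lt_trans (h2 n (ltnSn n)).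
    by rewrite ler_wpM2r ?(ltW d0) // ler_nat leq_exp2l // leq_pmull.
  have x87 : 8 / 7 <= 1 / delta by rewrite ler_pdivlMr //; lra.
  have x6 : 2 <= (1 / delta) ^+ 6.
    apply: (@le_trans _ _ ((8 / 7) ^+ 6)); first by lra.
    by rewrite lerXn2r ?nnegrE //; lra.
  by rewrite expnS natrM exprSr ler_pM.
rewrite expnM natrX; apply: le_trans (_ : ((1 / delta) ^+ 7) ^+ (11 * 9 ^ d.+2) <= _).
  by rewrite lerXn2r ?nnegrE ?exprn_ge0 //; lra.
rewrite -exprM ler_weXn2l //.
apply: (@leq_trans (2 ^ 7 * (2 ^ 4) ^ d.+2)).
  by rewrite mulnA leq_mul // leq_exp2r.
by rewrite -expnM -expnD leq_exp2l //; lia.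
Qed.
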